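(* Let $\mathscr{R}$ be a two-sided noetherian Banach $K$-algebra with a triangular decomposition $(R,A,B,H,\partial)$, and let $\mathscr{A},\mathscr{B}$ be the closures of $A,B$ in $\mathscr{R}$, assumed to be noetherian Banach $K$-algebras. Let $\widehat{\mathcal{O}}$ be the full subcategory of $\mathrm{Mod}(\mathscr{R})$ consisting of the modules which are finite as $\mathscr{A}$-modules and admit a weight space decomposition with respect to the action of $\partial$. Then: (i) $\widehat{\mathcal{O}}$ is a full abelian subcategory of $\mathrm{Mod}(\mathscr{R})$. (ii) $\widehat{\mathcal{O}}$ is closed under subobjects (i.e. $\mathscr{R}$-submodules) and finite direct sums. (iii) Extension of scalars gives an equivalence of abelian categories $\mathscr{R}\otimes_R-:\mathcal{O}\rightarrow\widehat{\mathcal{O}}$, where $\mathcal{O}$ is the algebraic category $\mathcal{O}$ of $R$.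
   Context: $K$ is a complete discretely valued extension of $\mathbb{Q}_p$. Modules are left modules. **Algebraic triangular decomposition.** A triangular decomposition of a noetherian $\mathbb{Z}$-graded $K$-algebra $R$ is a tuple $(A,B,H,\partial)$ of graded subalgebras $A,B,H\subset R$ and an element $\partial\in R_0$ such that: (1) multiplication gives $R=A\otimes_K H\otimes_K B$ as $K$-vector spaces; (2) $B\cdot H=H\cdot B$ and $H\cdot A=A\cdot H$; (3) $A=\bigoplus_{n\ge 0}A_n$, $B=\bigoplus_{n\le 0}B_n$, $A_0=B_0=K$, $H\subset R_0$; (4) all $A_n,B_n$ are finite-dimensional; (5) $H$ is a finite-dimensional split semisimple $K$-algebra; (6) $R_n=\{x\in R\mid[\partial,x]=nx\}$ for all $n$. Put $B^n=B_{-n}$ and $B^{>n}=\bigoplus_{m>n}B^m$. The category $\mathcal{O}$ of $R$ is the full subcategory of finitely generated $R$-modules $M$ on which $B$ acts locally nilpotently, i.e. for every $m\in M$ there is $n\ge0$ with $B^{>n}m=0$. **Weight spaces.** For a locally convex $K$-vector space $V$ with a continuous endomorphism $\partial$ and $\lambda\in K$, put $V^\lambda=\{v\mid(\partial-\lambda)^nv=0\text{ for }n\gg0\}$, $\Lambda(V)=\{\lambda\in K\mid V^\lambda\neq0\}$ and $V^{\mathrm{ws}}=\bigoplus_{\lambda\in\Lambda(V)}V^\lambda\subset V$. $V$ admits a weight space decomposition (with respect to $I\subset\Lambda(V)$) if every $v\in V$ is a convergent sum $v=\sum_{\lambda\in I}v_\lambda$ with $v_\lambda\in V^\lambda$. It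 is semi-simple if $\partial$ acts on $V^\lambda$ as multiplication by $\lambda$ for each $\lambda\in I$. **Banach triangular decomposition.** A triangular decomposition of a noetherian Banach $K$-algebra $\mathscr{R}$ is a tuple $(R,A,B,H,\partial)$ where $R\subset\mathscr{R}$ is a dense graded subalgebra with algebraic triangular decomposition $(A,B,H,\partial)$, such that, with $\mathscr{A},\mathscr{B}$ the closures of $A,B$ in $\mathscr{R}$ and $\mathrm{ad}(\partial)=[\partial,-]$: (1) $\mathscr{R}=\mathscr{A}\widehat{\otimes}_KH\widehat{\otimes}_K\mathscr{B}$ as Banach spaces; (2) $\mathscr{A}$ has a semi-simple weight space decomposition for $\mathrm{ad}(\partial)$ and $\mathscr{A}^{\mathrm{ws}}=A$; (3) $\mathscr{B}$ has a semi-simple weight space decomposition for $\mathrm{ad}(\partial)$ and $\mathscr{B}^{\mathrm{ws}}=B$. $\mathrm{Mod}(\mathscr{R})$ denotes the category of finitely generated $\mathscr{R}$-modules; each carries its canonical Banach topology (the quotient topology from any surjection $\mathscr{R}^r\to M$). *)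

(* Defs.v *)
(* Mathematical Components, with the real numbers of MathComp-Analysis. *)
From HB Require Import structures.
From mathcomp Require Import all_boot all_order all_algebra finmap.
From mathcomp Require Import boolp classical_sets reals.

Set Implicit Arguments.
Unset Strict Implicit.
Unset Printing Implicit Defensive.

Import Order.TTheory GRing.Theory Num.Theory.

Local Open Scope classical_set_scope.
Local Open Scope ring_scope.

(** * Preadditive and abelian categories *)

Record preadditive := Preadditive {
  obj :> Type;
  hom : obj -> obj -> zmodType;
  idm : forall X, hom X X;
  comp : forall X Y Z, hom Y Z -> hom X Y -> hom X Z;
  compA : forall X Y Z T (f : hom Z T) (g : hom Y Z) (h : hom X Y),
    comp f (comp g h) = comp (comp f g) h;
  comp1m : forall X Y (f : hom X Y), comp (idm Y) f = f;
  compm1 : forall X Y (f : hom X Y), comp f (idm X) = f;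
  compDl : forall X Y Z (f f' : hom Y Z) (g : hom X Y),
    comp (f + f') g = comp f g + comp f' g;
  compDr : forall X Y Z (f : hom Y Z) (g g' : hom X Y),
    comp f (g + g') = comp f g + comp f g' }.

Section Categories.
Variable C : preadditive.
Implicit Types X Y Z W : C.

Definition monic X Y (m : hom X Y) :=
  forall W (g h : hom W X), comp m g = comp m h -> g = h.
Definition epic X Y (e : hom X Y) :=
  forall W (g h : hom Y W), comp g e = comp h e -> g = h.
Definition is_iso X Y (f : hom X Y) :=
  exists g : hom Y X, comp g f = idm X /\ comp f g = idm Y.

Definition is_kernel X Y Z (f : hom X Y) (k : hom Z X) :=
  comp f k = 0 /\
  forall W (h : hom W X), comp f h = 0 -> exists! u : hom W Z, comp k u = h.
Definition is_cokernel X Y Z (f : hom X Y) (c : hom Y Z) :=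
  comp c f = 0 /\
  forall W (h : hom Y W), comp h f = 0 -> exists! u : hom Z W, comp u c = h.

Definition is_zero_object Z :=
  forall X, (forall f : hom X Z, f = 0) /\ (forall f : hom Z X, f = 0).

Definition is_biproduct X Y P
    (i1 : hom X P) (i2 : hom Y P) (p1 : hom P X) (p2 : hom P Y) :=
  [/\ comp p1 i1 = idm X, comp p2 i2 = idm Y, comp p2 i1 = 0, comp p1 i2 = 0 &
      comp i1 p1 + comp i2 p2 = idm P].

Record is_abelian : Prop := {
  ab_zero : exists Z, is_zero_object Z;
  ab_biproduct : forall X Y, exists P i1 i2 p1 p2, @is_biproduct X Y P i1 i2 p1 p2;
  ab_kernel : forall X Y (f : hom X Y), exists Z (k : hom Z X), is_kernel f k;
  ab_cokernel : forall X Y (f : hom X Y), exists Z (c : hom Y Z), is_cokernel f c;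
  ab_monic : forall X Y (m : hom X Y), monic m ->
    exists Z (f : hom Y Z), is_kernel f m;
  ab_epic : forall X Y (e : hom X Y), epic e ->
    exists Z (f : hom Z X), is_cokernel f e }.

End Categories.

Record functor (C D : preadditive) := Functor {
  fobj :> C -> D;
  fmap : forall X Y : C, hom X Y -> hom (fobj X) (fobj Y);
  fmap1 : forall X, fmap (idm X) = idm (fobj X);
  fmapM : forall X Y Z (f : hom Y Z) (g : hom X Y),
    fmap (comp f g) = comp (fmap f) (fmap g) }.

Definition additive_functor C D (F : functor C D) :=
  forall X Y (f g : hom X Y), fmap F (f + g) = fmap F f + fmap F g.

Definition exact_functor C D (F : functor C D) :=
  [/\ additive_functor F,
      forall X Y Z (f : hom X Y) (k : hom Z X),
        is_kernel f k -> is_kernel (fmap F f) (fmap F k) &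
      forall X Y Z (f : hom X Y) (c : hom Y Z),
        is_cokernel f c -> is_cokernel (fmap F f) (fmap F c)].

Definition id_functor C : functor C C :=
  @Functor C C id (fun _ _ f => f) (fun _ => erefl) (fun _ _ _ _ _ => erefl).

Section CompFunctor.
Variables (C D E : preadditive) (G : functor D E) (F : functor C D).

Lemma comp_fmap1 X : fmap G (fmap F (idm X)) = idm (G (F X)).
Proof. by rewrite !fmap1. Qed.

Lemma comp_fmapM X Y Z (f : hom Y Z) (g : hom X Y) :
  fmap G (fmap F (comp f g)) = comp (fmap G (fmap F f)) (fmap G (fmap F g)).
Proof. by rewrite !fmapM. Qed.

Definition comp_functor : functor C E :=
  @Functor C E (fun X => G (F X)) (fun _ _ f => fmap G (fmap F f))
    comp_fmap1 comp_fmapM.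
End CompFunctor.

Definition naturally_isomorphic C D (F G : functor C D) :=
  exists eta : forall X, hom (F X) (G X),
    (forall X, is_iso (eta X)) /\
    (forall X Y (f : hom X Y), comp (fmap G f) (eta X) = comp (eta Y) (fmap F f)).

Definition is_equivalence C D (F : functor C D) :=
  exists G : functor D C,
    naturally_isomorphic (comp_functor G F) (id_functor C) /\
    naturally_isomorphic (comp_functor F G) (id_functor D).

Definition abelian_equivalence C D (F : functor C D) :=
  [/\ is_abelian C, is_abelian D, exact_functor F & is_equivalence F].

Definition full_sub (C : preadditive) (P : C -> Prop) : preadditive :=
  @Preadditive {X : C | P X} (fun X Y => hom (sval X) (sval Y))
    (fun X => idm (sval X)) (fun _ _ _ f g => comp f g)
    (fun _ _ _ _ f g h => compA f g h) (fun _ _ f => comp1m f)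
    (fun _ _ f => compm1 f) (fun _ _ _ f f' g => compDl f f' g)
    (fun _ _ _ f g g' => compDr f g g').

Definition sub_functor (C D : preadditive) (P : C -> Prop) (Q : D -> Prop) (F : functor C D)
    (PQ : forall X, P X -> Q (F X)) : functor (full_sub P) (full_sub Q) :=
  @Functor (full_sub P) (full_sub Q)
    (fun X => exist Q (F (sval X)) (PQ _ (svalP X)))
    (fun X Y f => fmap F (f : hom (sval X) (sval Y)))
    (fun X => fmap1 F (sval X)) (fun X Y Z f g => fmapM F f g).

Definition inclusion (C : preadditive) (P Q : C -> Prop) (PQ : forall X, P X -> Q X) :
    functor (full_sub P) (full_sub Q) :=
  @sub_functor C C P Q (id_functor C) PQ.

Definition full_abelian_subcategory (C : preadditive) (P Q : C -> Prop)
    (PQ : forall X, P X -> Q X) :=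
  is_abelian (full_sub P) /\ exact_functor (inclusion PQ).

(** * The category of left modules over a ring *)

Section LinearMaps.
Variables (R : nzRingType) (M N : lmodType R).

Definition lmod_hom := {linear M -> N}.
HB.instance Definition _ := gen_eqMixin lmod_hom.
HB.instance Definition _ := gen_choiceMixin lmod_hom.

Implicit Types f g h : lmod_hom.

Lemma lmod_homP f g : (f : M -> N) =1 g -> f = g.
Proof.
case: f g => [f fP] [g gP] /= /funext fg; move: fP gP; rewrite {}fg.
case=> [[[f0 fD]] [fZ]] [[[g0 gD]] [gZ]].
by rewrite (Prop_irrelevance f0 g0) (Prop_irrelevance fD gD)
  (Prop_irrelevance fZ gZ).
Qed.

Definition hom_zero : lmod_hom := \0.
Definition hom_opp f : lmod_hom := \- f.
Definition hom_add f g : lmod_hom := f \+ g.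

Fact hom_addA : associative hom_add.
Proof. by move=> f g h; apply: lmod_homP => x /=; rewrite addrA. Qed.
Fact hom_addC : commutative hom_add.
Proof. by move=> f g; apply: lmod_homP => x /=; rewrite addrC. Qed.
Fact hom_add0 : left_id hom_zero hom_add.
Proof. by move=> f; apply: lmod_homP => x /=; rewrite add0r. Qed.
Fact hom_addN : left_inverse hom_zero hom_opp hom_add.
Proof. by move=> f; apply: lmod_homP => x /=; rewrite addNr. Qed.

HB.instance Definition _ :=
  GRing.isZmodule.Build lmod_hom hom_addA hom_addC hom_add0 hom_addN.
End LinearMaps.

Section ModuleCategory.
Variable R : nzRingType.
Implicit Types M N P Q : lmodType R.

Definition hom_id M : lmod_hom M M := idfun.
Definition hom_comp M N P (f : lmod_hom N P) (g : lmod_hom M N) :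
  lmod_hom M P := f \o g.

Fact hom_compA M N P Q (f : lmod_hom P Q) (g : lmod_hom N P) (h : lmod_hom M N) :
  hom_comp f (hom_comp g h) = hom_comp (hom_comp f g) h.
Proof. exact: lmod_homP. Qed.
Fact hom_comp1m M N (f : lmod_hom M N) : hom_comp (hom_id N) f = f.
Proof. exact: lmod_homP. Qed.
Fact hom_compm1 M N (f : lmod_hom M N) : hom_comp f (hom_id M) = f.
Proof. exact: lmod_homP. Qed.
Fact hom_compDl M N P (f f' : lmod_hom N P) (g : lmod_hom M N) :
  hom_comp (f + f') g = hom_comp f g + hom_comp f' g.
Proof. exact: lmod_homP. Qed.
Fact hom_compDr M N P (f : lmod_hom N P) (g g' : lmod_hom M N) :
  hom_comp f (g + g') = hom_comp f g + hom_comp f g'.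
Proof. by apply: lmod_homP => x /=; rewrite linearD. Qed.

Definition LMod : preadditive :=
  Preadditive hom_compA hom_comp1m hom_compm1 hom_compDl hom_compDr.

Definition fin_gen_over (S : set R) M :=
  exists (r : nat) (g : 'I_r -> M), forall x, exists a : 'I_r -> R,
    (forall i, S (a i)) /\ x = \sum_i a i *: g i.

Definition fin_gen M := fin_gen_over setT M.

Definition is_direct_sum n (M : 'I_n -> lmodType R) (S : lmodType R)
    (i : forall k, lmod_hom (M k) S) :=
  bijective (fun x : forall k, M k => \sum_k i k (x k)).

Definition closed_under_submodules (P : LMod -> Prop) :=
  forall M N (i : lmod_hom N M), injective i -> P M -> P N.

Definition closed_under_direct_sums (P : LMod -> Prop) :=
  forall n (M : 'I_n -> lmodType R) S (i : forall k, lmod_hom (M k) S),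
    is_direct_sum i -> (forall k, P (M k)) -> P S.

(* For a subring [S] of [R]; [left_noetherian R] is the case [S = R]. *)
Definition left_noetherian_over (S : set R) :=
  forall I : set R, I `<=` S -> I 0 ->
    (forall x y, I x -> I y -> I (x - y)) ->
    (forall s x, S s -> I x -> I (s * x)) ->
  exists (r : nat) (g : 'I_r -> R), (forall i, I (g i)) /\
    forall x, I x -> exists a : 'I_r -> R,
      (forall i, S (a i)) /\ x = \sum_i a i * g i.

Definition left_noetherian := left_noetherian_over setT.

End ModuleCategory.

Definition two_sided_noetherian (R : nzRingType) :=
  left_noetherian R /\ left_noetherian R^c.

(** * Restriction and extension of scalars *)

Definition restrict_scalars (S T : nzRingType) (f : {rmorphism S -> T})
  (M : lmodType T) : Type := M.

Section RestrictScalars.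
Variables (S T : nzRingType) (f : {rmorphism S -> T}) (M : lmodType T).
Local Notation V := (restrict_scalars f M).

HB.instance Definition _ := GRing.Zmodule.on V.

Let scale (s : S) (m : V) : V := f s *: (m : M).
Fact restrict_scaleA a b m : scale a (scale b m) = scale (a * b) m.
Proof. by rewrite /scale rmorphM scalerA. Qed.
Fact restrict_scale1 : left_id 1 scale.
Proof. by move=> m; rewrite /scale rmorph1 scale1r. Qed.
Fact restrict_scaleDr : right_distributive scale +%R.
Proof. by move=> a m n; rewrite /scale scalerDr. Qed.
Fact restrict_scaleDl m : {morph scale^~ m : a b / a + b}.
Proof. by move=> a b; rewrite /scale rmorphD scalerDl. Qed.
HB.instance Definition _ := GRing.Zmodule_isLmodule.Build S V
  restrict_scaleA restrict_scale1 restrict_scaleDr restrict_scaleDl.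
End RestrictScalars.

(* The tensor product [T \otimes_S M]: the list [:: (t1, m1); ..; (tn, mn)]
   stands for [t1 \otimes m1 + ... + tn \otimes mn]; [tens_rel] is the congruence
   generated by commutativity, biadditivity and [S]-balancedness. *)
Section ExtendScalars.
Variables (S T : nzRingType) (f : {rmorphism S -> T}) (M : lmodType S).

Inductive tens_rel : seq (T * M) -> seq (T * M) -> Prop :=
| tens_refl u : tens_rel u u
| tens_sym u v : tens_rel u v -> tens_rel v u
| tens_trans u v w : tens_rel u v -> tens_rel v w -> tens_rel u w
| tens_cat u u' v v' : tens_rel u u' -> tens_rel v v' ->
    tens_rel (u ++ v) (u' ++ v')
| tens_comm u v : tens_rel (u ++ v) (v ++ u)
| tens_zero m : tens_rel [:: (0, m)] [::]
| tens_addl t t' m : tens_rel [:: (t + t', m)] [:: (t, m); (t', m)]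
| tens_addr t m m' : tens_rel [:: (t, m + m')] [:: (t, m); (t, m')]
| tens_balanced t s m : tens_rel [:: (t * f s, m)] [:: (t, s *: m)].

Definition tens_relb u v := `[< tens_rel u v >].
Fact tens_relb_refl : reflexive tens_relb.
Proof. by move=> u; apply/asboolP; exact: tens_refl. Qed.
Fact tens_relb_sym : symmetric tens_relb.
Proof. by move=> u v; apply/asboolP/asboolP => /tens_sym. Qed.
Fact tens_relb_trans : transitive tens_relb.
Proof.
move=> u v w /asboolP vu /asboolP uw.
by apply/asboolP; exact: tens_trans vu uw.
Qed.
Canonical tens_equiv :=
  EquivRel tens_relb tens_relb_refl tens_relb_sym tens_relb_trans.

Definition extend_scalars := {eq_quot tens_equiv}%qT.
HB.instance Definition _ := Choice.on extend_scalars.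
HB.instance Definition _ := Quotient.on extend_scalars.

Definition tens_pi (u : seq (T * M)) : extend_scalars := (\pi u)%qT.

Lemma tens_piP u v : tens_pi u = tens_pi v <-> tens_rel u v.
Proof.
by split=> [/eqmodP/asboolP//|uv]; apply/eqmodP/asboolP.
Qed.

Lemma tens_reprP u : tens_rel (repr (tens_pi u)) u.
Proof. by apply/tens_piP; rewrite /tens_pi reprK. Qed.

Lemma tens_ind (P : extend_scalars -> Prop) :
  (forall u, P (tens_pi u)) -> forall x, P x.
Proof. by move=> Pu x; rewrite -[x]reprK; exact: Pu. Qed.

Lemma tens_map (h : T * M -> T * M) u v :
  (forall m, tens_rel [:: h (0, m)] [::]) ->
  (forall t t' m, tens_rel [:: h (t + t', m)] [:: h (t, m); h (t', m)]) ->
  (forall t m m', tens_rel [:: h (t, m + m')] [:: h (t, m); h (t, m')]) ->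
  (forall t s m, tens_rel [:: h (t * f s, m)] [:: h (t, s *: m)]) ->
  tens_rel u v -> tens_rel (map h u) (map h v).
Proof.
move=> h0 hl hr hb; elim=> {u v} /=.
- by move=> u; exact: tens_refl.
- by move=> u v _; exact: tens_sym.
- by move=> u v w _ uv _; exact: tens_trans.
- by move=> u u' v v' _ uu' _ vv'; rewrite !map_cat; exact: tens_cat.
- by move=> u v; rewrite !map_cat; exact: tens_comm.
- exact: h0.
- exact: hl.
- exact: hr.
- exact: hb.
Qed.

Definition tens_oppr (u : seq (T * M)) := map (fun x => (- x.1, x.2)) u.
Definition tens_scaler (a : T) (u : seq (T * M)) :=
  map (fun x => (a * x.1, x.2)) u.

Lemma tens_oppr_rel u v : tens_rel u v -> tens_rel (tens_oppr u) (tens_oppr v).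
Proof.
apply: tens_map => //= [m|t t' m|t m m'|t s m].
- by rewrite oppr0; exact: tens_zero.
- by rewrite opprD; exact: tens_addl.
- exact: tens_addr.
- by rewrite -mulNr; exact: tens_balanced.
Qed.

Lemma tens_scaler_rel a u v :
  tens_rel u v -> tens_rel (tens_scaler a u) (tens_scaler a v).
Proof.
apply: tens_map => //= [m|t t' m|t m m'|t s m].
- by rewrite mulr0; exact: tens_zero.
- by rewrite mulrDr; exact: tens_addl.
- exact: tens_addr.
- by rewrite mulrA; exact: tens_balanced.
Qed.

Definition tens_add (x y : extend_scalars) := tens_pi (repr x ++ repr y).
Definition tens_opp (x : extend_scalars) := tens_pi (tens_oppr (repr x)).
Definition tens_scale (a : T) (x : extend_scalars) :=
  tens_pi (tens_scaler a (repr x)).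

Lemma tens_addE u v : tens_add (tens_pi u) (tens_pi v) = tens_pi (u ++ v).
Proof. by apply/tens_piP/tens_cat; exact: tens_reprP. Qed.
Lemma tens_oppE u : tens_opp (tens_pi u) = tens_pi (tens_oppr u).
Proof. by apply/tens_piP/tens_oppr_rel/tens_reprP. Qed.
Lemma tens_scaleE a u : tens_scale a (tens_pi u) = tens_pi (tens_scaler a u).
Proof. by apply/tens_piP/tens_scaler_rel/tens_reprP. Qed.

Fact tens_addA : associative tens_add.
Proof.
elim/tens_ind=> u; elim/tens_ind=> v; elim/tens_ind=> w.
by rewrite !tens_addE catA.
Qed.
Fact tens_addC : commutative tens_add.
Proof.
elim/tens_ind=> u; elim/tens_ind=> v.
by rewrite !tens_addE; apply/tens_piP/tens_comm.
Qed.
Fact tens_add0 : left_id (tens_pi [::]) tens_add.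
Proof. by elim/tens_ind=> u; rewrite tens_addE. Qed.
Fact tens_addN : left_inverse (tens_pi [::]) tens_opp tens_add.
Proof.
elim/tens_ind=> u; rewrite tens_oppE tens_addE; apply/tens_piP.
elim: u => [|[t m] u IHu] /=; first exact: tens_refl.
have rot : tens_rel (tens_oppr u ++ (t, m) :: u) ([:: (t, m)] ++ u ++ tens_oppr u).
  by rewrite catA; exact: tens_comm.
apply: (tens_trans (tens_cat (tens_refl [:: (- t, m)]) rot)); rewrite catA.
apply: (tens_cat (u' := [::]) (v' := [::])); last exact: tens_trans (tens_comm _ _) IHu.
apply: (tens_trans (tens_sym (tens_addl (- t) t m))).
by rewrite addNr; exact: tens_zero.
Qed.
HB.instance Definition _ :=
  GRing.isZmodule.Build extend_scalars tens_addA tens_addC tens_add0 tens_addN.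

Fact tens_scaleA a b x : tens_scale a (tens_scale b x) = tens_scale (a * b) x.
Proof.
elim/tens_ind: x => u; rewrite !tens_scaleE /tens_scaler -map_comp.
by congr tens_pi; apply: eq_map => y /=; rewrite mulrA.
Qed.
Fact tens_scale1 : left_id 1 tens_scale.
Proof.
elim/tens_ind=> u; rewrite tens_scaleE; congr tens_pi.
by rewrite -[RHS]map_id; apply: eq_map => -[t m] /=; rewrite mul1r.
Qed.
Fact tens_scaleDr : right_distributive tens_scale +%R.
Proof.
move=> a; elim/tens_ind=> u; elim/tens_ind=> v.
rewrite -![_ + _]/(tens_add _ _) !(tens_addE, tens_scaleE).
by rewrite /tens_scaler map_cat.
Qed.
Fact tens_scaleDl x : {morph tens_scale^~ x : a b / a + b}.
Proof.
move=> a b; elim/tens_ind: x => u.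
rewrite -[RHS]/(tens_add _ _) !(tens_addE, tens_scaleE); apply/tens_piP.
elim: u => [|[t m] u IHu] /=; first exact: tens_refl.
apply: (@tens_trans _ (([:: (a * t, m)] ++ [:: (b * t, m)])
                       ++ (tens_scaler a u ++ tens_scaler b u))).
  rewrite mulrDl -cat1s; apply: tens_cat IHu; exact: tens_addl.
rewrite -catA -[X in tens_rel _ X]cat1s.
apply: tens_cat; first exact: tens_refl.
rewrite catA -[X in tens_rel _ (_ ++ X)]cat1s catA.
by apply: tens_cat; [exact: tens_comm|exact: tens_refl].
Qed.
HB.instance Definition _ := GRing.Zmodule_isLmodule.Build T extend_scalars
  tens_scaleA tens_scale1 tens_scaleDr tens_scaleDl.
End ExtendScalars.

Section ExtendScalarsFunctor.
Variables (S T : nzRingType) (f : {rmorphism S -> T}).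

Section Map.
Variables (M N : lmodType S) (g : lmod_hom M N).

Definition tens_mapr (u : seq (T * M)) : seq (T * N) :=
  map (fun x => (x.1, g x.2)) u.

Lemma tens_mapr_rel u v :
  tens_rel f u v -> tens_rel f (tens_mapr u) (tens_mapr v).
Proof.
elim=> {u v} /=.
- by move=> u; exact: tens_refl.
- by move=> u v _; exact: tens_sym.
- by move=> u v w _ uv _; exact: tens_trans.
- by move=> u u' v v' _ uu' _ vv'; rewrite /tens_mapr !map_cat; exact: tens_cat.
- by move=> u v; rewrite /tens_mapr !map_cat; exact: tens_comm.
- by move=> m; exact: tens_zero.
- by move=> t t' m; exact: tens_addl.
- by move=> t m m'; rewrite linearD; exact: tens_addr.
- by move=> t s m; rewrite linearZ; exact: tens_balanced.
Qed.

Definition extend_map_fun (x : extend_scalars f M) : extend_scalars f N :=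
  tens_pi f (tens_mapr (repr x)).

Lemma extend_map_funE u :
  extend_map_fun (tens_pi f u) = tens_pi f (tens_mapr u).
Proof. by apply/tens_piP/tens_mapr_rel/tens_reprP. Qed.

Fact extend_map_is_linear : linear extend_map_fun.
Proof.
move=> a; elim/tens_ind=> u; elim/tens_ind=> v.
rewrite -![_ + _]/(tens_add _ _) -![_ *: _]/(tens_scale _ _).
rewrite !(extend_map_funE, tens_scaleE, tens_addE).
by rewrite /tens_mapr /tens_scaler map_cat -!map_comp.
Qed.
HB.instance Definition _ :=
  GRing.isLinear.Build T (extend_scalars f M) (extend_scalars f N) _
    extend_map_fun extend_map_is_linear.

(* [t \otimes m |-> t \otimes g m] *)
Definition extend_map : lmod_hom (extend_scalars f M) (extend_scalars f N) :=
  extend_map_fun.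
End Map.

Fact extend_map1 M : extend_map (hom_id M) = hom_id (extend_scalars f M).
Proof.
apply: lmod_homP; elim/tens_ind=> u /=; rewrite extend_map_funE.
by congr tens_pi; rewrite -[RHS]map_id; apply: eq_map => -[].
Qed.

Fact extend_mapM M N P (g : lmod_hom N P) (h : lmod_hom M N) :
  extend_map (hom_comp g h) = hom_comp (extend_map g) (extend_map h).
Proof.
apply: lmod_homP; elim/tens_ind=> u /=; rewrite !extend_map_funE.
by rewrite /tens_mapr -map_comp.
Qed.

Definition extension_of_scalars : functor (LMod S) (LMod T) :=
  @Functor (LMod S) (LMod T) (fun M => extend_scalars f M) extend_map
    extend_map1 extend_mapM.
End ExtendScalarsFunctor.

(** * Nonarchimedean fields and Banach spaces *)

Definition complete_for (Rl : realType) (V : zmodType) (N : V -> Rl) :=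
  forall u : nat -> V,
    (forall e, 0 < e -> exists n0, forall m n,
      (n0 <= m)%N -> (n0 <= n)%N -> N (u m - u n) < e) ->
  exists l, forall e, 0 < e -> exists n0, forall n,
    (n0 <= n)%N -> N (u n - l) < e.

Record nonarch_abs (Rl : realType) (K : fieldType) (v : K -> Rl) : Prop := {
  abs_ge0 : forall x, 0 <= v x;
  abs_eq0 : forall x, v x = 0 <-> x = 0;
  absM : forall x y, v (x * y) = v x * v y;
  absD : forall x y, v (x + y) <= Num.max (v x) (v y) }.

Definition discretely_valued (Rl : realType) (K : fieldType) (v : K -> Rl) :=
  exists2 c : Rl, 0 < c < 1 &
    [set v x | x in [set x | x != 0]] = [set c ^ n | n in [set: int]].

(* Normalised by [|p| = 1/p]. *)
Definition padic_abs (Rl : realType) (p : nat) (q : rat) : Rl :=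
  if q == 0 then 0
  else p%:R ^ ((logn p `|denq q|%N)%:Z - (logn p `|numq q|%N)%:Z).

(* [(Q, v)] is the completion of the rationals for the [p]-adic absolute value. *)
Record is_Qp (Rl : realType) (p : nat) (Q : fieldType) (v : Q -> Rl) : Prop := {
  Qp_abs : nonarch_abs v;
  Qp_complete : complete_for v;
  Qp_padic : forall q : rat, v (ratr q) = padic_abs Rl p q;
  Qp_dense : forall x e, 0 < e -> exists q : rat, v (x - ratr q) < e }.

Record complete_dv_extension_of_Qp (Rl : realType) (p : nat) (K : fieldType)
    (v : K -> Rl) : Prop := {
  cdv_abs : nonarch_abs v;
  cdv_complete : complete_for v;
  cdv_discrete : discretely_valued v;
  cdv_ext : exists (Q : fieldType) (w : Q -> Rl) (i : {rmorphism Q -> K}),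
    is_Qp p w /\ forall x, v (i x) = w x }.

Section Banach.
Variables (Rl : realType) (K : fieldType) (v : K -> Rl).

Record banach_space (V : lmodType K) (N : V -> Rl) : Prop := {
  norm_ge0 : forall x, 0 <= N x;
  norm_eq0 : forall x, N x = 0 -> x = 0;
  normZ : forall a x, N (a *: x) = v a * N x;
  normD : forall x y, N (x + y) <= Num.max (N x) (N y);
  norm_complete : complete_for N }.

(* Only continuity of the product is required, not submultiplicativity. *)
Definition banach_algebra (A : algType K) (N : A -> Rl) :=
  banach_space N /\ exists C : Rl, forall x y, N (x * y) <= C * N x * N y.

Definition norm_open (V : zmodType) (N : V -> Rl) : set (set V) :=
  [set U | forall x, U x ->
    exists2 e : Rl, 0 < e & forall y, N (y - x) < e -> U y].

Definition norm_closure (V : zmodType) (N : V -> Rl) (X : set V) : set V :=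
  [set x | forall e, 0 < e -> exists2 y, X y & N (y - x) < e].

(* The open sets of the canonical topology of a finitely generated module over
   the Banach algebra [(A, N)]: the sets with open preimage in [A ^ r] for every
   surjection [A ^ r -> M]. *)
Definition canonical_open (A : algType K) (N : A -> Rl) (M : lmodType A) :
    set (set M) :=
  [set U | forall r (pi : {linear 'rV[A]_r -> M}), (forall m, exists x, pi x = m) ->
    forall x : 'rV[A]_r, U (pi x) -> exists2 e : Rl, 0 < e &
      forall y : 'rV[A]_r, (forall i, N (y 0 i - x 0 i) < e) -> U (pi y)].

End Banach.

(** * Weight spaces *)

Definition sums (V : zmodType) (X : set V) : set V :=
  [set x | exists2 s : seq V, (forall y, y \in s -> X y) & x = \sum_(y <- s) y].

(* [W] is a subspace of [V] stable under [D]; the notions are those of the space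
   [W] with the operator [D], for the topology on [W] induced by the topology
   [op] of [V]. *)
Section Weights.
Variables (K : fieldType) (V : lmodType K).
Variables (op : set (set V)) (W : set V) (D : V -> V).

Definition weight_space (l : K) : set V :=
  [set x | W x /\ exists n0, forall n, (n0 <= n)%N ->
    iter n (fun y => D y - l *: y) x = 0].

Definition weights : set K := [set l | exists2 x, weight_space l x & x != 0].

Definition weight_sum : set V :=
  sums [set x | exists2 l, weights l & weight_space l x].

(* Convergence of the net of finite subsums. *)
Definition converges_to (I : set K) (w : K -> V) (x : V) :=
  forall U, op U -> U x -> exists2 F0 : {fset K},
    (forall l, l \in F0 -> I l) &
    forall F : {fset K}, (F0 `<=` F)%fset -> (forall l, l \in F -> I l) ->
      U (\sum_(l <- F) w l).

Definition weight_decomposition_wrt (I : set K) :=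
  I `<=` weights /\ forall x, W x -> exists2 w : K -> V,
    (forall l, I l -> weight_space l (w l)) & converges_to I w x.

Definition weight_decomposition := exists I, weight_decomposition_wrt I.

Definition semisimple_weight_decomposition := exists2 I,
  weight_decomposition_wrt I &
  forall l x, I l -> weight_space l x -> D x = l *: x.

End Weights.

(** * Algebraic triangular decompositions *)

Section Triangular.
Variables (K : fieldType) (R : algType K).
Implicit Types (A B H X Y W : set R) (G : int -> set R).

Definition subspace W :=
  W 0 /\ forall (a : K) x y, W x -> W y -> W (a *: x + y).

Definition subalgebra X :=
  [/\ subspace X, X 1 & forall x y, X x -> X y -> X (x * y)].

Definition fin_dim W := exists (r : nat) (g : 'I_r -> R),
  (forall i, W (g i)) /\
  forall x, W x -> exists c : 'I_r -> K, x = \sum_i c i *: g i.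

Definition grading G :=
  [/\ forall n, subspace (G n),
      G 0 1,
      forall m n x y, G m x -> G n y -> G (m + n) (x * y),
      forall x, sums (\bigcup_n G n) x &
      forall (s : seq int) (y : int -> R), uniq s -> (forall n, G n (y n)) ->
        \sum_(n <- s) y n = 0 -> forall n, n \in s -> y n = 0].

Definition graded_subalgebra G X :=
  subalgebra X /\ X `<=` sums (\bigcup_n (X `&` G n)).

Definition span_prod X Y := sums [set x * y | x in X & y in Y].

Definition linear_on (V : lmodType K) X (f : R -> V) :=
  forall (a : K) x y, X x -> X y -> f (a *: x + y) = a *: f x + f y.

Definition trilinear_on (V : lmodType K) A H B (f : R -> R -> R -> V) :=
  [/\ forall h b, H h -> B b -> linear_on A (fun a => f a h b),
      forall a b, A a -> B b -> linear_on H (fun h => f a h b) &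
      forall a h, A a -> H h -> linear_on B (fun b => f a h b)].

Definition extends_trilinear (V : lmodType K) A H B (f : R -> R -> R -> V)
    (g : {linear R -> V}) :=
  forall a h b, A a -> H h -> B b -> g (a * h * b) = f a h b.

(* Universal property of [A \otimes H \otimes B] for [(a, h, b) |-> a * h * b]. *)
Definition is_tensor_product A H B :=
  forall (V : lmodType K) (f : R -> R -> R -> V), trilinear_on A H B f ->
    exists2 g : {linear R -> V}, extends_trilinear A H B f g &
      forall g', extends_trilinear A H B f g' -> g' =1 g.

(* Isomorphic to a finite product of matrix algebras over [K], via the [phi i]. *)
Definition split_semisimple H :=
  exists (r : nat) (n : 'I_r -> nat) (phi : forall i, R -> 'M[K]_((n i).+1)),
    [/\ forall i, linear_on H (phi i),
        forall i, phi i 1 = 1,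
        forall i x y, H x -> H y -> phi i (x * y) = phi i x * phi i y,
        forall x, H x -> (forall i, phi i x = 0) -> x = 0 &
        forall z : (forall i, 'M[K]_((n i).+1)),
          exists2 x, H x & forall i, phi i x = z i].

Record triangular_decomposition G A B H (d : R) : Prop := {
  tri_noetherian : left_noetherian R;
  tri_grading : grading G;
  tri_A : graded_subalgebra G A;
  tri_B : graded_subalgebra G B;
  tri_H : graded_subalgebra G H;
  tri_d : G 0 d;
  tri_tensor : is_tensor_product A H B;
  tri_BH : span_prod B H = span_prod H B;
  tri_HA : span_prod H A = span_prod A H;
  tri_A_ge0 : forall n, n < 0 -> A `&` G n `<=` [set 0];
  tri_B_le0 : forall n, 0 < n -> B `&` G n `<=` [set 0];
  tri_A0 : A `&` G 0 = [set c%:A | c in [set: K]];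
  tri_B0 : B `&` G 0 = [set c%:A | c in [set: K]];
  tri_H0 : H `<=` G 0;
  tri_A_fin : forall n, fin_dim (A `&` G n);
  tri_B_fin : forall n, fin_dim (B `&` G n);
  tri_H_fin : fin_dim H;
  tri_H_split : split_semisimple H;
  tri_ad : forall n, G n = [set x | d * x - x * d = n%:~R *: x] }.

(* [B^{>n}], where [B^m = B_{-m}] *)
Definition upper_part G B (n : nat) : set R :=
  sums (\bigcup_(m in [set m : nat | (n < m)%N]) (B `&` G (- m%:Z))).

Definition categoryO G B (M : LMod R) : Prop :=
  fin_gen M /\
  forall m : (M : lmodType R), exists n : nat,
    forall b, upper_part G B n b -> b *: m = 0.

End Triangular.

(** * Triangular decompositions of Banach algebras *)

Section BanachTriangular.
Variables (Rl : realType) (K : fieldType) (v : K -> Rl).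
Variables (RB : algType K) (N : RB -> Rl).

Definition bounded_linear (V : lmodType K) (NV : V -> Rl) (g : RB -> V) :=
  exists C : Rl, forall x, NV (g x) <= C * N x.

Definition bounded_trilinear_on (V : lmodType K) (NV : V -> Rl) (A H B : set RB)
    (f : RB -> RB -> RB -> V) :=
  exists C : Rl, forall a h b, A a -> H h -> B b ->
    NV (f a h b) <= C * N a * N h * N b.

(* Universal property, among Banach spaces and continuous maps, of the completed
   tensor product of [A], [H], [B] for [(a, h, b) |-> a * h * b]. *)
Definition is_completed_tensor_product (A H B : set RB) :=
  forall (V : lmodType K) (NV : V -> Rl), banach_space v NV ->
  forall f : RB -> RB -> RB -> V,
    trilinear_on A H B f -> bounded_trilinear_on NV A H B f ->
  exists2 g : {linear RB -> V},
    bounded_linear NV g /\ extends_trilinear A H B f g &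
    forall g' : {linear RB -> V},
      bounded_linear NV g' -> extends_trilinear A H B f g' -> g' =1 g.

Definition ad (x y : RB) : RB := x * y - y * x.

(* [R] is viewed as a subalgebra of [RB] through the embedding [j]. *)
Variables (R : algType K) (j : {lrmorphism R -> RB}).

Record banach_triangular_decomposition (G : int -> set R) (A B H : set R)
    (d : R) : Prop := {
  btri_inj : injective j;
  btri_dense : norm_closure N (range j) = setT;
  btri_alg : triangular_decomposition G A B H d;
  btri_tensor : is_completed_tensor_product
    (norm_closure N (j @` A)) (j @` H) (norm_closure N (j @` B));
  btri_A_wsd : semisimple_weight_decomposition
    (norm_open N) (norm_closure N (j @` A)) (ad (j d));
  btri_A_ws : weight_sum (norm_closure N (j @` A)) (ad (j d)) = j @` A;
  btri_B_wsd : semisimple_weight_decomposition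
    (norm_open N) (norm_closure N (j @` B)) (ad (j d));
  btri_B_ws : weight_sum (norm_closure N (j @` B)) (ad (j d)) = j @` B }.

Definition category_fin_gen (M : LMod RB) : Prop := fin_gen M.

Definition categoryOhat (A : set R) (d : R) (M : LMod RB) : Prop :=
  [/\ category_fin_gen M,
      fin_gen_over (norm_closure N (j @` A)) M &
      weight_decomposition (V := restrict_scalars (in_alg RB) M)
        (canonical_open N (M := M)) setT (fun m : M => j d *: m)].

Lemma categoryOhat_fin_gen A d M : categoryOhat A d M -> category_fin_gen M.
Proof. by case. Qed.

End BanachTriangular.

(* Main.v *)
From HB Require Import structures.
Require Import Defs.
From mathcomp Require Import all_boot all_order all_algebra finmap.
From mathcomp Require Import boolp classical_sets reals.
From mathcomp Require Import ring.
Import Defs.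

(** Write [Abar] for the closure of [A] in the Banach algebra [RB], and call weight
    vector a generalized eigenvector of [d].

    Everything rests on the description [categoryOhatP] of the completed category O:
    its objects are the modules generated over [Abar] by finitely many weight vectors
    [e i], of weights [lam i]. The elements of [Abar] are convergent sums of weight
    vectors of weights 0, 1, 2 and so on, so that an element of such a module is a
    convergent sum of weight vectors whose weights are natural numbers shifted by some
    [lam i]. Conversely, if every element is a convergent sum of weight vectors, then
    the weight vectors span the module, because submodules of finite modules over a
    noetherian Banach algebra are closed ([submod_closed]: the closure has finitely
    many generators, and by the open mapping argument generators can be perturbed).

    Quotients and finite sums of objects are clearly objects. For a submodule [W], the
    point is that the weight components of an element of [W] lie in [W]
    ([weight_component]). This is not formal, because the weights may accumulate: the
    powers of [p] tend to 0. Given a weight [mu] and a small [eps], one splits the sum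
    into the terms of weight [eps]-close to [mu] and the other terms, and groups the
    latter by the class of the weight modulo a natural number of absolute value at most
    [eps]. Each group is an approximate eigenvector of [d], and a suitable polynomial in
    [d] nearly kills the far groups while it nearly fixes the near one
    ([near_eigen_separation]); as [W] is closed, the near part lies in [W], and it tends
    to the component of weight [mu] as [eps] tends to 0. Closure under submodules,
    quotients and sums makes the category abelian, with the usual kernels and cokernels
    ([full_sub_abelian], [full_sub_inclusion_exact]).

    For the equivalence, an object [M] of category O is generated over [A] by finitely
    many weight vectors ([categoryO_generators]): the elements of [B] lower the
    generators to zero in finitely many steps, and on vectors killed by all the [B_ k]
    with [k > 0] the element [d] acts as a central element of the split semisimple
    algebra [H], hence through a split polynomial. Thus the extension of [M] is an
    object of the completed category, and its weight vectors come from [M]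
    ([gen_eigen_extend]). The map from [M] to its extension is injective
    ([iota_injective]): a nonzero [m] is detected by a functional on [M] that vanishes
    in large degrees of [A], and such a functional extends continuously to [RB] along
    the orbit of each vector, since the homogeneous coordinates on [Abar] and on the
    closure of [B] are bounded ([graded_coordinates], by uniform boundedness applied to
    binomial polynomials in [ad d]). Hence the functor is faithful, and it is full, as a
    morphism between extensions preserves weight vectors. Finally, an object [X] is the
    extension of the span of its weight vectors: the kernel of the natural surjection is
    itself an object, so it is generated by weight vectors, of which there are none
    ([extension_surjective]). A fully faithful and essentially surjective additive
    functor is an exact equivalence ([fully_faithful_equivalence],
    [fully_faithful_exact]). *)

Set Implicit Arguments.
Unset Strict Implicit.
Unset Printing Implicit Defensive.

Import Order.TTheory GRing.Theory Num.Theory.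

Local Open Scope classical_set_scope.
Local Open Scope ring_scope.

(** * Fully faithful functors *)

Section FullyFaithful.
Variables (C D : preadditive) (F : functor C D).
Hypothesis F_full : forall (X Y : C) (h : hom (F X) (F Y)), exists f, fmap F f = h.
Hypothesis F_faithful : forall (X Y : C) (f g : hom X Y), fmap F f = fmap F g -> f = g.
Hypothesis F_surj : forall Y : D, exists (X : C) (e : hom (F X) Y), is_iso e.

Let pre (X Y : C) (h : hom (F X) (F Y)) : hom X Y := sval (cid (F_full h)).
Let preK (X Y : C) (h : hom (F X) (F Y)) : fmap F (pre h) = h.
Proof. by rewrite /pre; case: cid. Qed.

Let iso_choice : {G : D -> C & {e : forall Y, hom (F (G Y)) Y &
  {e' : forall Y, hom Y (F (G Y)) |
    forall Y, comp (e' Y) (e Y) = idm _ /\ comp (e Y) (e' Y) = idm _}}}.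
Proof.
have H Y := cid (F_surj Y).
pose G Y := sval (H Y); exists G.
have H' Y : exists e : hom (F (G Y)) Y, is_iso e := svalP (H Y).
have H'' Y := cid (H' Y); exists (fun Y => sval (H'' Y)).
have H3 Y := cid (svalP (H'' Y)); exists (fun Y => sval (H3 Y)) => Y.
exact: svalP (H3 Y).
Qed.

(** The chosen preimages of the objects of [D] form a functor, on morphisms by
    conjugation with the chosen isomorphisms. *)
Lemma fully_faithful_equivalence : is_equivalence F.
Proof.
have [G [e [e' ee']]] := iso_choice.
have e'e Y : comp (e' Y) (e Y) = idm _ by have [] := ee' Y.
have eeV Y : comp (e Y) (e' Y) = idm _ by have [] := ee' Y.
pose Gm X Y (f : hom X Y) := pre (comp (e' Y) (comp f (e X))).
have Gm1 X : Gm X X (idm X) = idm (G X).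
  by apply: F_faithful; rewrite preK comp1m e'e fmap1.
have GmM X Y Z (f : hom Y Z) (g : hom X Y) :
    Gm _ _ (comp f g) = comp (Gm _ _ f) (Gm _ _ g).
  apply: F_faithful; rewrite fmapM !preK !compA.
  by rewrite -(compA _ (e Y) (e' Y)) eeV compm1.
exists (Functor Gm1 GmM); split.
  exists (fun X : C => pre (e (F X)) : hom (G (F X)) X); split.
    move=> X; exists (pre (e' (F X))); split; apply: F_faithful => /=.
      by rewrite fmapM !preK e'e fmap1.
    by rewrite fmapM !preK eeV fmap1.
  move=> X Y f; apply: F_faithful => /=; rewrite !fmapM !preK.
  by rewrite !compA eeV comp1m.
exists e; split => [Y|X Y f]; first by exists (e' Y); exact: ee'.
by rewrite /= preK !compA eeV comp1m.
Qed.

(** Kernels and cokernels are tested against arbitrary objects of [D], each of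
    which is isomorphic to an object in the image. *)
Lemma fully_faithful_exact : additive_functor F -> exact_functor F.
Proof.
move=> FD.
have F0 X Y : fmap F (0 : hom X Y) = 0.
  by apply: (addrI (fmap F (0 : hom X Y))); rewrite -FD !addr0.
have comp0m (A : preadditive) (X Y Z : A) (g : hom X Y) : comp (0 : hom Y Z) g = 0.
  by apply: (addrI (comp (0 : hom Y Z) g)); rewrite -compDl !addr0.
have compm0 (A : preadditive) (X Y Z : A) (g : hom Y Z) : comp g (0 : hom X Y) = 0.
  by apply: (addrI (comp g (0 : hom X Y))); rewrite -compDr !addr0.
split=> // [X Y Z f k [fk0 ku]|X Y Z f c [cf0 cu]].
  split=> [|W h fh0]; first by rewrite -fmapM fk0 F0.
  have [V [e [e' [e'e ee']]]] := F_surj W.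
  have [h' Fh'] := F_full (comp h e).
  have fh'0 : comp f h' = 0.
    by apply: F_faithful; rewrite fmapM Fh' compA fh0 comp0m F0.
  have [u [ku' uu]] := ku _ _ fh'0.
  exists (comp (fmap F u) e'); split.
    by rewrite compA -fmapM ku' Fh' -compA ee' compm1.
  move=> w kw; have [w' Fw'] := F_full (comp w e).
  rewrite (uu w'); first by rewrite Fw' -compA ee' compm1.
  by apply: F_faithful; rewrite fmapM Fw' compA kw Fh'.
split=> [|W h hf0]; first by rewrite -fmapM cf0 F0.
have [V [e [e' [e'e ee']]]] := F_surj W.
have [h' Fh'] := F_full (comp e' h).
have h'f0 : comp h' f = 0.
  by apply: F_faithful; rewrite fmapM Fh' -compA hf0 compm0 F0.
have [u [uc uu]] := cu _ _ h'f0.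
exists (comp e (fmap F u)); split.
  by rewrite -compA -fmapM uc Fh' compA ee' comp1m.
move=> w wc; have [w' Fw'] := F_full (comp e' w).
rewrite (uu w'); first by rewrite Fw' compA ee' comp1m.
by apply: F_faithful; rewrite fmapM Fw' -compA wc Fh'.
Qed.

End FullyFaithful.

(** * Submodules and quotients *)

Section Submodules.
Variables (R : nzRingType) (V : lmodType R).

Definition is_submod (U : set V) := [/\ U 0,
  forall x y, U x -> U y -> U (x + y) & forall a x, U x -> U (a *: x)].

Lemma submodN U x : is_submod U -> U x -> U (- x).
Proof. by case=> _ _ UZ Ux; rewrite -scaleN1r; exact: UZ. Qed.

Lemma submodB U x y : is_submod U -> U x -> U y -> U (x - y).
Proof. move=> hU Ux Uy; have [_ UD _] := hU; by apply: UD => //; exact: submodN. Qed.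

Section Sub.
Variables (U : set V) (hU : is_submod U).

Definition submod_type of is_submod U : Type := {x : V | U x}.
Local Notation S := (submod_type hU).

HB.instance Definition _ := gen_eqMixin S.
HB.instance Definition _ := gen_choiceMixin S.

Lemma submod_inj (x y : S) : sval x = sval y -> x = y.
Proof.
case: x y => [x Ux] [y Uy] /= xy; case: _ / xy Uy => Uy.
by rewrite (Prop_irrelevance Ux Uy).
Qed.

Let szero : S := exist _ 0 (let: And3 h _ _ := hU in h).
Let sopp (x : S) : S := exist _ _ (submodN hU (svalP x)).
Let sadd (x y : S) : S :=
  exist _ _ ((let: And3 _ h _ := hU in h) _ _ (svalP x) (svalP y)).
Let sscale a (x : S) : S :=
  exist _ _ ((let: And3 _ _ h := hU in h) a _ (svalP x)).

Fact submod_addA : associative sadd.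
Proof. by move=> x y z; apply: submod_inj => /=; rewrite addrA. Qed.
Fact submod_addC : commutative sadd.
Proof. by move=> x y; apply: submod_inj => /=; rewrite addrC. Qed.
Fact submod_add0 : left_id szero sadd.
Proof. by move=> x; apply: submod_inj => /=; rewrite add0r. Qed.
Fact submod_addN : left_inverse szero sopp sadd.
Proof. by move=> x; apply: submod_inj => /=; rewrite addNr. Qed.
HB.instance Definition _ :=
  GRing.isZmodule.Build S submod_addA submod_addC submod_add0 submod_addN.

Fact submod_scaleA a b x : sscale a (sscale b x) = sscale (a * b) x.
Proof. by apply: submod_inj => /=; rewrite scalerA. Qed.
Fact submod_scale1 : left_id 1 sscale.
Proof. by move=> x; apply: submod_inj => /=; rewrite scale1r. Qed.
Fact submod_scaleDr : right_distributive sscale +%R.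
Proof. by move=> a x y; apply: submod_inj => /=; rewrite scalerDr. Qed.
Fact submod_scaleDl x : {morph sscale^~ x : a b / a + b}.
Proof. by move=> a b; apply: submod_inj => /=; rewrite scalerDl. Qed.
HB.instance Definition _ := GRing.Zmodule_isLmodule.Build R S
  submod_scaleA submod_scale1 submod_scaleDr submod_scaleDl.

Definition submod_val (x : S) : V := sval x.
Fact submod_val_linear : linear submod_val. Proof. by []. Qed.
HB.instance Definition _ :=
  GRing.isLinear.Build R S V _ submod_val submod_val_linear.

Definition submod_incl : lmod_hom S V := submod_val.

Lemma submod_incl_inj : injective submod_incl.
Proof. by move=> x y; exact: submod_inj. Qed.

Lemma submod_inclP x : U x <-> exists y, submod_incl y = x.
Proof.
by split=> [Ux|[y <-]]; [exists (exist _ x Ux)|exact: (svalP y)].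
Qed.
End Sub.

Section Quotient.
Variables (U : set V) (hU : is_submod U).

Let rep x := xget 0 [set y | U (y - x)].
Let repP x : U (rep x - x).
Proof.
rewrite /rep; apply: (xgetPex 0 (P := [set y | U (y - x)])).
by exists x => /=; rewrite subrr; case: hU.
Qed.
Let rep_eq x y : U (x - y) -> rep x = rep y.
Proof.
move=> Uxy; rewrite /rep; congr xget; apply/predeqP => z /=; split=> Uz.
  by rewrite -(subrK x z) -addrA; have [_ UD _] := hU; exact: UD.
rewrite -(subrK y z) -addrA; have [_ UD _] := hU; apply: UD => //.
by rewrite -opprB; exact: submodN.
Qed.
Let rep_eqP x y : rep x = rep y -> U (x - y).
Proof.
move=> xy; rewrite -(subrK (rep x) x) -addrA {2}xy.
by have [_ UD _] := hU; apply: UD (repP y); rewrite -opprB; exact: submodN.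
Qed.

(** The points of the quotient are the chosen representatives of the cosets, so
    that equal cosets are equal points. *)
Definition quot_type of is_submod U : Type := {x : V | rep x = x}.
Local Notation Q := (quot_type hU).
Let cls x : Q := exist _ (rep x) (rep_eq (repP x)).

HB.instance Definition _ := gen_eqMixin Q.
HB.instance Definition _ := gen_choiceMixin Q.

Let val_inj_quot (x y : Q) : sval x = sval y -> x = y.
Proof.
case: x y => [x rx] [y ry] /= xy; case: _ / xy ry => ry.
by rewrite (Prop_irrelevance rx ry).
Qed.
Let clsP x y : cls x = cls y <-> U (x - y).
Proof.
split=> [xy|/rep_eq xy]; last exact: (@val_inj_quot (cls x) (cls y) xy).
exact: rep_eqP (congr1 sval xy).
Qed.
Let clsK (x : Q) : cls (sval x) = x.
Proof. by apply: val_inj_quot; case: x. Qed.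

Let qadd (x y : Q) : Q := cls (sval x + sval y).
Let qopp (x : Q) : Q := cls (- sval x).
Let qscale a (x : Q) : Q := cls (a *: sval x).
Let qaddE x y : qadd (cls x) (cls y) = cls (x + y).
Proof.
apply/clsP; rewrite /= opprD addrACA; have [_ UD _] := hU.
by apply: UD; exact: repP.
Qed.
Let qoppE x : qopp (cls x) = cls (- x).
Proof. by apply/clsP; rewrite /= -opprD; apply: submodN => //; exact: repP. Qed.
Let qscaleE a x : qscale a (cls x) = cls (a *: x).
Proof. by apply/clsP; rewrite /= -scalerBr; have [_ _] := hU; apply; exact: repP. Qed.

Fact quot_addA : associative qadd.
Proof.
by move=> x y z; rewrite -(clsK x) -(clsK y) -(clsK z) !qaddE addrA.
Qed.
Fact quot_addC : commutative qadd.
Proof. by move=> x y; rewrite /qadd addrC. Qed.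
Fact quot_add0 : left_id (cls 0) qadd.
Proof. by move=> x; rewrite -(clsK x) qaddE add0r. Qed.
Fact quot_addN : left_inverse (cls 0) qopp qadd.
Proof. by move=> x; rewrite -(clsK x) qoppE qaddE addNr. Qed.
HB.instance Definition _ :=
  GRing.isZmodule.Build Q quot_addA quot_addC quot_add0 quot_addN.

Fact quot_scaleA a b x : qscale a (qscale b x) = qscale (a * b) x.
Proof. by rewrite -(clsK x) !qscaleE scalerA. Qed.
Fact quot_scale1 : left_id 1 qscale.
Proof. by move=> x; rewrite -(clsK x) qscaleE scale1r. Qed.
Fact quot_scaleDr : right_distributive qscale +%R.
Proof.
move=> a x y; rewrite -(clsK x) -(clsK y) -![_ + _]/(qadd _ _).
by rewrite !(qaddE, qscaleE) scalerDr.
Qed.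
Fact quot_scaleDl x : {morph qscale^~ x : a b / a + b}.
Proof.
by move=> a b; rewrite -(clsK x) -[RHS]/(qadd _ _) !qscaleE qaddE scalerDl.
Qed.
HB.instance Definition _ := GRing.Zmodule_isLmodule.Build R Q
  quot_scaleA quot_scale1 quot_scaleDr quot_scaleDl.

Definition quot_fun (x : V) : Q := cls x.
Fact quot_fun_linear : linear quot_fun.
Proof.
move=> a x y; rewrite /quot_fun -[RHS]/(qadd (qscale _ _) _).
by rewrite qscaleE qaddE.
Qed.
HB.instance Definition _ :=
  GRing.isLinear.Build R V Q _ quot_fun quot_fun_linear.

Definition quot_proj : lmod_hom V Q := quot_fun.

Lemma quot_proj_surj y : exists x, quot_proj x = y.
Proof. by exists (sval y); exact: clsK. Qed.

Lemma quot_proj_eq0 x : quot_proj x = 0 <-> U x.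
Proof. by rewrite (clsP x 0) subr0. Qed.
End Quotient.
End Submodules.

Section LinearConstructions.
Variable R : nzRingType.

Section Pack.
Variables (M N : lmodType R) (f : M -> N) (hf : linear f).
Definition linear_fun of linear f := f.
HB.instance Definition _ := GRing.isLinear.Build R M N _ (linear_fun hf) hf.
Definition pack_linear : lmod_hom M N := linear_fun hf.
End Pack.

Variables M N P : lmodType R.

Lemma linear_lift (m : lmod_hom M N) (h : lmod_hom P N) : injective m ->
  (forall x, exists y, m y = h x) -> exists u : lmod_hom P M, hom_comp m u = h.
Proof.
move=> m_inj /choice[u mu].
have u_lin : linear u by move=> a x y; apply: m_inj; rewrite linearP !mu linearP.
by exists (pack_linear u_lin); apply: lmod_homP => x /=; rewrite mu.
Qed.

Lemma linear_descend (e : lmod_hom M N) (h : lmod_hom M P) :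
  (forall y, exists x, e x = y) -> (forall x, e x = 0 -> h x = 0) ->
  exists u : lmod_hom N P, hom_comp u e = h.
Proof.
move=> /choice[s es] e0h0.
have eh x y : e x = e y -> h x = h y.
  move=> exy; apply/eqP; rewrite -subr_eq0 -linearB; apply/eqP/e0h0.
  by rewrite linearB exy subrr.
have u_lin : linear (h \o s).
  by move=> a x y; rewrite /= -linearP; apply: eh; rewrite linearP !es.
by exists (pack_linear u_lin); apply: lmod_homP => x /=; apply: eh; rewrite es.
Qed.

End LinearConstructions.

Section Images.
Variables (R : nzRingType) (M N : lmodType R) (f : lmod_hom M N).

Lemma ker_submod : is_submod [set x | f x = 0].
Proof.
split=> [|x y /= fx fy|a x /= fx]; first exact: linear0.
  by rewrite linearD fx fy addr0.
by rewrite linearZ /= fx scaler0.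
Qed.

Lemma im_submod : is_submod [set y | exists x, f x = y].
Proof.
split=> [|_ _ [x <-] [y <-]|a _ [x <-]]; first by exists 0; exact: linear0.
  by exists (x + y); rewrite linearD.
by exists (a *: x); rewrite linearZ.
Qed.

Lemma ker0_inj : (forall x, f x = 0 -> x = 0) -> injective f.
Proof.
move=> f0 x y fxy; apply/eqP; rewrite -subr_eq0; apply/eqP/f0.
by rewrite linearB fxy subrr.
Qed.
End Images.

(** * Full subcategories of modules *)

Section FullSubcategories.
Variables (R : nzRingType) (P : LMod R -> Prop).

Definition closed_under_quotients := forall M N (q : lmod_hom M N),
  (forall y, exists x, q x = y) -> P M -> P N.
(** Closure under finite sums of submodules and finite direct sums at once; the
    empty sum gives the zero module. *)
Definition closed_under_sums := forall n (M : 'I_n -> lmodType R) (S : lmodType R)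
    (i : forall k, lmod_hom (M k) S),
  (forall x, exists y : forall k, M k, x = \sum_k i k (y k)) ->
  (forall k, P (M k)) -> P S.

Lemma direct_sums_of_sums : closed_under_sums -> closed_under_direct_sums P.
Proof.
move=> P_sums n M S i [g _ gK]; apply: (P_sums n M S i) => x.
by exists (g x); rewrite [RHS]gK.
Qed.

Local Notation C := (full_sub P).

Lemma usual_kernel (X Y Z : C) (f : hom X Y) (k : hom Z X) :
  injective (k : lmod_hom _ _) ->
  (forall x, (f : lmod_hom _ _) x = 0 <-> exists z, (k : lmod_hom _ _) z = x) ->
  is_kernel f k.
Proof.
move=> k_inj kP; split=> [|W h fh0].
  by apply: lmod_homP => z; apply/kP; exists z.
have fh0' x : (f : lmod_hom _ _) ((h : lmod_hom _ _) x) = 0.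
  by have /(congr1 (fun g : lmod_hom _ _ => g x)) := fh0.
have [u ku] := linear_lift k_inj (fun x => (kP _).1 (fh0' x)).
exists u; split=> // w kw; apply: lmod_homP => x; apply: k_inj.
have /(congr1 (fun g : lmod_hom _ _ => g x)) := ku.
by have /(congr1 (fun g : lmod_hom _ _ => g x)) := kw => /= -> ->.
Qed.

Lemma usual_cokernel (X Y Z : C) (f : hom X Y) (c : hom Y Z) :
  (forall z, exists y, (c : lmod_hom _ _) y = z) ->
  (forall y, (c : lmod_hom _ _) y = 0 <-> exists x, (f : lmod_hom _ _) x = y) ->
  is_cokernel f c.
Proof.
move=> c_surj cP; split=> [|W h hf0].
  by apply: lmod_homP => x; apply/cP; exists x.
have hc0 y : (c : lmod_hom _ _) y = 0 -> (h : lmod_hom _ _) y = 0.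
  by move=> /cP[x <-]; have /(congr1 (fun g : lmod_hom _ _ => g x)) := hf0.
have [u uc] := linear_descend c_surj hc0.
exists u; split=> // w wc; apply: lmod_homP => z; have [y <-] := c_surj z.
have /(congr1 (fun g : lmod_hom _ _ => g y)) := uc.
by have /(congr1 (fun g : lmod_hom _ _ => g y)) := wc => /= -> ->.
Qed.

Hypothesis P_sub : closed_under_submodules P.
Hypothesis P_quot : closed_under_quotients.

Let sub_obj (M : lmodType R) (PM : P M) U (hU : is_submod U) : C :=
  exist P (submod_type hU : lmodType R) (P_sub (@submod_incl_inj _ M U hU) PM).
Let quot_obj (M : lmodType R) (PM : P M) U (hU : is_submod U) : C :=
  exist P (quot_type hU : lmodType R) (P_quot (@quot_proj_surj _ M U hU) PM).

(** A monic is tested against the inclusion of its module-theoretic kernel, which is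
    an object of the subcategory. *)
Lemma monic_injective (X Y : C) (m : hom X Y) :
  monic m -> injective (m : lmod_hom _ _).
Proof.
move=> m_mon; apply: ker0_inj => x mx0.
pose K := ker_submod (m : lmod_hom _ _).
have [y <-] := (submod_inclP K x).1 mx0.
have i0 : (submod_incl K : @hom C (sub_obj (svalP X) K) X) = 0.
  apply: m_mon; apply: lmod_homP => z /=.
  by rewrite linear0; exact: (svalP z).
by have /(congr1 (fun g : lmod_hom _ _ => g y)) := i0.
Qed.

Lemma epic_surjective (X Y : C) (e : hom X Y) :
  epic e -> forall y, exists x, (e : lmod_hom _ _) x = y.
Proof.
move=> e_epi y; pose I := im_submod (e : lmod_hom _ _).
apply/(quot_proj_eq0 I y).
have q0 : (quot_proj I : @hom C Y (quot_obj (svalP Y) I)) = 0.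
  apply: e_epi; apply: lmod_homP => x /=.
  by apply/(quot_proj_eq0 I); exists x.
by have /(congr1 (fun g : lmod_hom _ _ => g y)) := q0.
Qed.

Lemma kernel_usual (X Y Z : C) (f : hom X Y) (k : hom Z X) : is_kernel f k ->
  injective (k : lmod_hom _ _) /\
  (forall x, (f : lmod_hom _ _) x = 0 <-> exists z, (k : lmod_hom _ _) z = x).
Proof.
move=> [fk0 ku]; split.
  apply: monic_injective => W g h kgh.
  have fkh0 : comp f (comp k h) = 0.
    by rewrite compA fk0; apply: lmod_homP.
  by have [u [_ uu]] := ku _ _ fkh0; rewrite -(uu g kgh) -(uu h).
move=> x; split=> [fx0|[z <-]]; last first.
  by have /(congr1 (fun g : lmod_hom _ _ => g z)) := fk0.
pose K := ker_submod (f : lmod_hom _ _).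
have fi0 : comp f (submod_incl K : @hom C (sub_obj (svalP X) K) X) = 0.
  by apply: lmod_homP => z /=; exact: (svalP z).
have [u [kui _]] := ku _ _ fi0; have [y <-] := (submod_inclP K x).1 fx0.
exists ((u : lmod_hom _ _) y).
by have /(congr1 (fun g : lmod_hom _ _ => g y)) := kui.
Qed.

Lemma cokernel_usual (X Y Z : C) (f : hom X Y) (c : hom Y Z) : is_cokernel f c ->
  (forall z, exists y, (c : lmod_hom _ _) y = z) /\
  (forall y, (c : lmod_hom _ _) y = 0 <-> exists x, (f : lmod_hom _ _) x = y).
Proof.
move=> [cf0 cu]; split.
  apply: epic_surjective => W g h gch.
  have hcf0 : comp (comp h c) f = 0.
    by rewrite -compA cf0; apply: lmod_homP => x /=; rewrite linear0.
  by have [u [_ uu]] := cu _ _ hcf0; rewrite -(uu g gch) -(uu h).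
move=> y; split=> [cy0|[x <-]]; last first.
  by have /(congr1 (fun g : lmod_hom _ _ => g x)) := cf0.
pose I := im_submod (f : lmod_hom _ _).
have qf0 : comp (quot_proj I : @hom C Y (quot_obj (svalP Y) I)) f = 0.
  by apply: lmod_homP => x /=; apply/(quot_proj_eq0 I); exists x.
have [u [ucq _]] := cu _ _ qf0; apply/(quot_proj_eq0 I).
have /(congr1 (fun g : lmod_hom _ _ => g y)) := ucq => /= <-.
by rewrite cy0 linear0.
Qed.

(** Closure under submodules and quotients makes the module-theoretic kernels and
    cokernels objects of the subcategory. *)
Lemma full_sub_abelian : closed_under_sums -> is_abelian C.
Proof.
move=> P_sums; split.
- have P0 : P ('rV[R]_0 : lmodType R).
    apply: (P_sums 0 (fun=> 'rV[R]_0) _ (fun=> hom_id _)) => [x|[]//].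
    by exists (fun=> 0); rewrite big_ord0; apply/rowP => -[].
  exists (exist P _ P0) => X; split=> f; apply: lmod_homP => x /=.
    by apply/rowP => -[].
  by rewrite [x](_ : _ = 0) ?linear0//; apply/rowP => -[].
- move=> X Y; pose M : lmodType R := sval X; pose N : lmodType R := sval Y.
  pose S : lmodType R := (M * N)%type.
  have i1_lin : linear (fun x : M => (x, 0) : S).
    by move=> a x y; rewrite [RHS]surjective_pairing /= scaler0 addr0.
  have i2_lin : linear (fun y : N => (0, y) : S).
    by move=> a x y; rewrite [RHS]surjective_pairing /= scaler0 addr0.
  have PXY : P S.
    pose T k : lmodType R := if k is 0%N then M else N.
    pose i k : lmod_hom (T k) S :=
      if k is 0%N then pack_linear i1_lin else pack_linear i2_lin.
    apply: (P_sums 2 (fun k => T k) S (fun k => i k)) => [[x y]|[[|k] kP]].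
    - exists (fun k => if nat_of_ord k is 0%N as n return T n then x else y).
      by rewrite !big_ord_recl big_ord0 /= addr0 [RHS]surjective_pairing /= addr0 add0r.
    - exact: (svalP X).
    - exact: (svalP Y).
  have p1_lin : linear (fun z : M * N => z.1) by [].
  have p2_lin : linear (fun z : M * N => z.2) by [].
  exists (exist P _ PXY), (pack_linear i1_lin), (pack_linear i2_lin).
  exists (pack_linear p1_lin), (pack_linear p2_lin).
  split; apply: lmod_homP => //= -[x y].
  by rewrite [LHS]surjective_pairing /= addr0 add0r.
- move=> X Y f; pose K := ker_submod (f : lmod_hom _ _).
  exists (sub_obj (svalP X) K), (submod_incl K); apply: usual_kernel.
    exact: submod_incl_inj.
  exact: submod_inclP.
- move=> X Y f; pose I := im_submod (f : lmod_hom _ _).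
  exists (quot_obj (svalP Y) I), (quot_proj I); apply: usual_cokernel.
    exact: quot_proj_surj.
  exact: quot_proj_eq0.
- move=> X Y m m_mon; pose I := im_submod (m : lmod_hom _ _).
  exists (quot_obj (svalP Y) I), (quot_proj I); apply: usual_kernel.
    exact: monic_injective.
  exact: quot_proj_eq0.
- move=> X Y e e_epi; pose K := ker_submod (e : lmod_hom _ _).
  exists (sub_obj (svalP X) K), (submod_incl K); apply: usual_cokernel.
    exact: epic_surjective.
  exact: submod_inclP.
Qed.

End FullSubcategories.

(** Kernels and cokernels in the subcategory are the module-theoretic ones, and these
    have the universal property in every full subcategory that contains them. *)
Lemma full_sub_inclusion_exact (R : nzRingType) (P Q : LMod R -> Prop)
    (PQ : forall X, P X -> Q X) :
  closed_under_submodules P -> closed_under_quotients P ->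
  exact_functor (inclusion PQ).
Proof.
move=> P_sub P_quot; split=> // [X Y Z f k kP|X Y Z f c cP].
  by have [? ?] := kernel_usual P_sub kP; apply: usual_kernel.
by have [? ?] := cokernel_usual P_quot cP; apply: usual_cokernel.
Qed.

(** * Finite generation over a subring *)

Section FiniteGeneration.
Variables (R : nzRingType) (S : set R).

Definition is_subring := [/\ S 1, forall x y, S x -> S y -> S (x - y) &
  forall x y, S x -> S y -> S (x * y)].

Hypothesis S_ring : is_subring.

Lemma subringB x y : S x -> S y -> S (x - y). Proof. by case: S_ring => _ + _; apply. Qed.
Lemma subringM x y : S x -> S y -> S (x * y). Proof. by case: S_ring => _ _; apply. Qed.
Lemma subring1 : S 1. Proof. by case: S_ring. Qed.
Lemma subring0 : S 0. Proof. by rewrite -(subrr 1); apply: subringB; exact: subring1. Qed.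
Lemma subringN x : S x -> S (- x).
Proof. by move=> Sx; rewrite -sub0r; apply: subringB => //; exact: subring0. Qed.

Variable M : lmodType R.

Definition is_submod_over (U : set M) := [/\ U 0,
  forall x y, U x -> U y -> U (x - y) & forall a x, S a -> U x -> U (a *: x)].

Definition span_over (I : finType) (g : I -> M) : set M :=
  [set x | exists a : I -> R, (forall i, S (a i)) /\ x = \sum_i a i *: g i].

Definition fin_gen_submod (U : set M) :=
  exists (r : nat) (u : 'I_r -> M), (forall i, U (u i)) /\ U `<=` span_over u.

Lemma submod_overD U x y : is_submod_over U -> U x -> U y -> U (x + y).
Proof.
move=> [U0 UB UZ] Ux Uy; rewrite -[y]opprK; apply/UB => //.
by rewrite -sub0r; exact: UB.
Qed.

Lemma submod_over_sum U (I : Type) (s : seq I) (P : pred I) (F : I -> M) :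
  is_submod_over U -> (forall i, P i -> U (F i)) -> U (\sum_(i <- s | P i) F i).
Proof.
move=> hU UF; elim/big_ind: _ => //; first by case: hU.
by move=> x y; exact: submod_overD.
Qed.

Lemma span_over_submod (I : finType) (g : I -> M) : is_submod_over (span_over g).
Proof.
split=> [|x y [a [Sa ->]] [b [Sb ->]]|c x Sc [a [Sa ->]]].
- exists (fun=> 0); split=> [i|]; first exact: subring0.
  by rewrite big1// => i _; rewrite scale0r.
- exists (fun i => a i - b i); split=> [i|]; first exact: subringB.
  by rewrite -sumrB; apply: eq_bigr => i _; rewrite scalerBl.
- exists (fun i => c * a i); split=> [i|]; first exact: subringM.
  by rewrite scaler_sumr; apply: eq_bigr => i _; rewrite scalerA.
Qed.

Lemma mem_span_over (I : finType) (g : I -> M) i : span_over g (g i).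
Proof.
exists (fun k => (k == i)%:R); split=> [k|].
  by case: eqP => _; [exact: subring1|exact: subring0].
rewrite (bigD1 i)//= eqxx scale1r big1 ?addr0// => k /negPf ->.
by rewrite scale0r.
Qed.

Lemma span_over_min (I : finType) (g : I -> M) U :
  is_submod_over U -> (forall i, U (g i)) -> span_over g `<=` U.
Proof.
move=> hU Ug _ [a [Sa ->]]; apply: submod_over_sum => // i _.
by have [_ _] := hU; apply.
Qed.

(** The leading coefficients of the elements of [U], with respect to the last
    generator, form an ideal of [S]. *)
Lemma noetherian_fin_gen_submod (r : nat) (g : 'I_r -> M) U :
  left_noetherian_over S -> is_submod_over U -> U `<=` span_over g ->
  fin_gen_submod U.
Proof.
move=> S_noeth; elim: r g U => [|r IHr] g U hU Ug.
  exists 0, (fun=> 0); split=> [[]//|x /Ug[a [_ ->]]].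
  by exists (fun=> 0); rewrite !big_ord0; split=> // -[].
have [U0 UB UZ] := hU; pose g' i := g (widen_ord (leqnSn r) i).
pose I : set R := [set s | S s /\ exists2 u, U u & span_over g' (u - s *: g ord_max)].
have hg' := span_over_submod g'; have [g'0 g'B g'Z] := hg'.
have [||||k [t [It tI]]] := S_noeth I.
- by move=> s [].
- by split; [exact: subring0|exists 0 => //; rewrite scale0r subr0].
- move=> x y [Sx [u Uu ug]] [Sy [w Uw wg]]; split; first exact: subringB.
  exists (u - w); first exact: UB.
  rewrite [X in span_over _ X](_ : _ =
    (u - x *: g ord_max) - (w - y *: g ord_max)); first exact: g'B.
  by rewrite scalerBl !opprB addrACA [RHS]addrACA [- w + _]addrC.
- move=> s x Ss [Sx [u Uu ug]]; split; first exact: subringM.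
  by exists (s *: u); [exact: UZ|rewrite -scalerA -scalerBr; exact: g'Z].
have /choice[u uP] i : exists u, U u /\ span_over g' (u - t i *: g ord_max).
  by have [_ [u Uu ug]] := It i; exists u.
pose U' : set M := [set x | U x /\ span_over g' x].
have [|x []//|l [w [U'w wU']]] := IHr g' U'.
  split=> [//|x y [Ux gx] [Uy gy]|a x Sa [Ux gx]].
    by split; [exact: UB|exact: g'B].
  by split; [exact: UZ|exact: g'Z].
exists (k + l)%N, (fun i => match split i with inl i => u i | inr i => w i end).
split=> [i|x Ux].
  by case: split => i'; [have [] := uP i'|have [] := U'w i'].
have [a [Sa xE]] := Ug x Ux.
have [|b [Sb aE]] := tI (a ord_max).
  split=> //; exists x => //; exists (fun i => a (widen_ord (leqnSn r) i)).
  by split=> //; rewrite xE big_ord_recr /= addrK.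
have [|c [Sc cE]] := wU' (x - \sum_i b i *: u i).
  split.
    apply/UB => //; apply: submod_over_sum => // i _; apply: UZ => //.
    by have [] := uP i.
  have -> : x - \sum_i b i *: u i = \sum_i a (widen_ord (leqnSn r) i) *: g' i -
      \sum_i b i *: (u i - t i *: g ord_max).
    rewrite xE big_ord_recr /= aE -addrA; congr (_ + _).
    rewrite scaler_suml -sumrN -sumrN -big_split /=; apply: eq_bigr => i _.
    by rewrite scalerBr opprB scalerA addrC.
  apply/g'B; first by exists (fun i => a (widen_ord (leqnSn r) i)).
  apply: submod_over_sum => // i _; apply: g'Z => //.
  by have [] := uP i.
exists (fun i => match split i with inl i => b i | inr i => c i end).
split=> [i|]; first by case: split.
rewrite big_split_ord /=.
under eq_bigr do rewrite -[lshift _ _]/(unsplit (inl _)) unsplitK.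
under [X in _ + X]eq_bigr do rewrite -[rshift _ _]/(unsplit (inr _)) unsplitK.
by rewrite -cE addrC subrK.
Qed.
End FiniteGeneration.

(** * Ultrametric norms and Baire category *)

Section Ultranorm.
Variables (Rl : realType) (V : zmodType) (N : V -> Rl).

Record ultranorm : Prop := {
  ultra_ge0 : forall x, 0 <= N x;
  ultra_0 : N 0 = 0;
  ultra_eq0 : forall x, N x = 0 -> x = 0;
  ultraN : forall x, N (- x) = N x;
  ultraD : forall x y, N (x + y) <= Num.max (N x) (N y) }.

Hypothesis hN : ultranorm.

Lemma ultra_addle x y e : N x <= e -> N y <= e -> N (x + y) <= e.
Proof. by move=> xe ye; apply: (le_trans (ultraD hN x y)); rewrite ge_max xe. Qed.

Lemma ultra_addlt x y e : N x < e -> N y < e -> N (x + y) < e.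
Proof. by move=> xe ye; apply: (le_lt_trans (ultraD hN x y)); rewrite gt_max xe. Qed.

Lemma ultra_suble x y e : N x <= e -> N y <= e -> N (x - y) <= e.
Proof. by move=> xe ye; apply: ultra_addle; rewrite ?ultraN. Qed.

Lemma ultra_sublt x y e : N x < e -> N y < e -> N (x - y) < e.
Proof. by move=> xe ye; apply: ultra_addlt; rewrite ?ultraN. Qed.

Lemma ultra_distC x y : N (x - y) = N (y - x).
Proof. by rewrite -(ultraN hN) opprB. Qed.

Lemma ultra_sumle (I : Type) (s : seq I) (P : pred I) (F : I -> V) e : 0 <= e ->
  (forall i, P i -> N (F i) <= e) -> N (\sum_(i <- s | P i) F i) <= e.
Proof.
move=> e0 Fe; apply: (big_ind (fun x => N x <= e)) => //; first by rewrite ultra_0.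
by move=> x y; exact: ultra_addle.
Qed.

Lemma ultra_sumlt (I : Type) (s : seq I) (P : pred I) (F : I -> V) e : 0 < e ->
  (forall i, P i -> N (F i) < e) -> N (\sum_(i <- s | P i) F i) < e.
Proof.
move=> e0 Fe; apply: (big_ind (fun x => N x < e)) => //; first by rewrite ultra_0.
by move=> x y; exact: ultra_addlt.
Qed.

Lemma ultra_small_eq0 x : (forall e, 0 < e -> N x <= e) -> x = 0.
Proof.
move=> xe; apply: (ultra_eq0 hN); apply/eqP/negPn/negP => Nx0.
have Nx_gt0 : 0 < N x by rewrite lt_neqAle eq_sym Nx0 ultra_ge0.
have := xe _ (divr_gt0 Nx_gt0 (ltr0Sn _ 1)).
by rewrite leNgt ltr_pdivrMr// ltr_pMr// ltr1n.
Qed.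

Lemma norm_closure_id (X : set V) x : X x -> norm_closure N X x.
Proof. by move=> Xx e e0; exists x; rewrite ?subrr ?ultra_0. Qed.

Lemma norm_closureB (X : set V) : (forall x y, X x -> X y -> X (x - y)) ->
  forall x y, norm_closure N X x -> norm_closure N X y -> norm_closure N X (x - y).
Proof.
move=> XB x y Xx Xy e e0; have [x' Xx' xe] := Xx e e0; have [y' Xy' ye] := Xy e e0.
exists (x' - y'); first exact: XB.
rewrite (_ : x' - y' - (x - y) = (x' - x) + (y - y')).
  by apply: ultra_addlt => //; rewrite ultra_distC.
by rewrite opprB addrACA [RHS]addrACA [- y' + _]addrC.
Qed.

Lemma norm_closureK (X : set V) : norm_closure N (norm_closure N X) `<=` norm_closure N X.
Proof.
move=> x cx e e0; have [y cy yx] := cx e e0; have [z Xz zy] := cy e e0.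
by exists z => //; rewrite -(subrK y z) -addrA; exact: ultra_addlt.
Qed.

Definition norm_closed (X : set V) := norm_closure N X `<=` X.

Definition seq_lim (u : nat -> V) (l : V) := forall e, 0 < e ->
  exists n0, forall n, (n0 <= n)%N -> N (u n - l) < e.

Lemma seq_lim_closure (X : set V) u l n1 :
  (forall n, (n1 <= n)%N -> X (u n)) -> seq_lim u l -> norm_closure N X l.
Proof.
move=> Xu ul e e0; have [n0 h] := ul e e0; exists (u (maxn n0 n1)).
  by apply: Xu; exact: leq_maxr.
by apply: h; exact: leq_maxl.
Qed.

Hypothesis N_complete : complete_for N.

Lemma exists_inv_lt (e : Rl) : 0 < e -> exists k : nat, k.+1%:R^-1 < e.
Proof.
move=> e0; exists (Num.bound e^-1).
rewrite invf_plt ?posrE//; have /ltW ei0 := e0.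
apply: (lt_trans (archi_boundP _)); first by rewrite invr_ge0.
by rewrite ltr_nat.
Qed.

(** Otherwise there are nested balls with centres in [Y], the [k]-th one disjoint
    from [C k]; their common point lies in no [C k]. *)
Lemma baire (Y : set V) (C : nat -> set V) y0 :
  norm_closed Y -> Y y0 -> Y `<=` \bigcup_k C k ->
  exists k y (e : Rl), [/\ Y y, 0 < e &
    forall z, Y z -> N (z - y) < e -> norm_closure N (C k) z].
Proof.
move=> Ycl Yy0 YC; apply: contrapT => nB.
pose good (p : V * Rl) := Y p.1 /\ 0 < p.2.
pose next (k : nat) (p q : V * Rl) := [/\ good q, q.2 <= p.2 /\ q.2 <= k.+1%:R^-1,
  N (q.1 - p.1) < p.2 & forall w, C k w -> q.2 <= N (w - q.1)].
have /choice[f fP] : forall kp : nat * (V * Rl), exists q,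
    good kp.2 -> next kp.1 kp.2 q.
  move=> [k [y e]] /=; have [[/= Yy e0]|] := pselect (good (y, e)); last by exists (y, e).
  have [z [Yz zy [e' e'0 h]]] : exists z, [/\ Y z, N (z - y) < e &
      exists2 e', 0 < e' & forall w, C k w -> e' <= N (w - z)].
    apply: contrapT => nz; apply: nB; exists k, y, e; split=> // z Yz zy e' e'0.
    apply: contrapT => nw; apply: nz; exists z; split=> //; exists e' => // w Cw.
    by rewrite leNgt; apply/negP => we; apply: nw; exists w.
  exists (z, Num.min e (Num.min k.+1%:R^-1 e')) => _; split => //=.
  - by split=> //=; rewrite !lt_min e0 e'0 invr_gt0 ltr0Sn.
  - by rewrite !ge_min !lexx /= orbT.
  - by move=> w Cw; rewrite !ge_min h// !orbT.
pose s := fix s k := if k is k'.+1 then f (k', s k') else (y0, 1 : Rl).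
have sgood k : good (s k).
  elim: k => [|k IH]; first by split=> /=.
  by have [] : next k (s k) (s k.+1) := fP (k, s k) IH.
have snext k : next k (s k) (s k.+1) := fP (k, s k) (sgood k).
have s2 k m : (k <= m)%N -> (s m).2 <= (s k).2.
  move/subnKC <-; elim: (m - k)%N => [|l IH]; first by rewrite addn0.
  by rewrite addnS; have [_ [le _] _ _] := snext (k + l)%N; exact: le_trans le IH.
have s1 k m : (k <= m)%N -> N ((s m).1 - (s k).1) < (s k).2.
  move/subnKC <-; elim: (m - k)%N => [|l IH].
    by rewrite addn0 subrr ultra_0; have [] := sgood k.
  rewrite addnS -(subrK (s (k + l)%N).1 (s _).1) -addrA; apply: ultra_addlt => //.
  have [_ _ lt _] := snext (k + l)%N; apply: lt_le_trans lt _.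
  by apply: s2; exact: leq_addr.
have [l lP] : exists l, seq_lim (fun k => (s k).1) l.
  apply: N_complete => e e0; have [k ke] := exists_inv_lt e0.
  have kk : (s k.+1).2 < e by have [_ [_ h] _ _] := snext k; exact: le_lt_trans h ke.
  exists k.+1 => m n km kn; rewrite -(subrK (s k.+1).1 (s m).1) -addrA.
  apply: ultra_addlt; first exact: lt_trans (s1 _ _ km) kk.
  by rewrite ultra_distC; exact: lt_trans (s1 _ _ kn) kk.
have ls k : N (l - (s k).1) < (s k).2.
  have [_ sk0] := sgood k; have [n0 h] := lP _ sk0.
  rewrite -(subrK (s (maxn n0 k)).1 l) -addrA; apply: ultra_addlt.
    by rewrite ultra_distC; apply: h; exact: leq_maxl.
  by apply: s1; exact: leq_maxr.
have [|k _ Ck] := YC l.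
  apply: Ycl; apply: (seq_lim_closure (n1 := 0%N)) lP => n _.
  by have [] := sgood n.
have [_ _ _ /(_ l Ck)] := snext k.
by rewrite leNgt ls.
Qed.

Lemma cauchy_series (u : nat -> V) (c q : Rl) : 0 <= c -> q <= 2^-1 -> 0 <= q ->
  (forall k, N (u k) <= c * q ^+ k) ->
  exists l, seq_lim (fun n => \sum_(k < n) u k) l.
Proof.
move=> c0 q2 q0 uq; apply: N_complete => e e0.
have [n0 hn] : exists n0, c * q ^+ n0 < e.
  exists (Num.bound (c / e)); apply: (@le_lt_trans _ _ (c * 2^-1 ^+ Num.bound (c / e))).
    by rewrite ler_wpM2l// lerXn2r// nnegrE// invr_ge0.
  rewrite exprVn ltr_pdivrMr ?exprn_gt0// mulrC -ltr_pdivrMr//.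
  exact: upper_nthrootP.
have small m : (n0 <= m)%N -> N (\sum_(k < m) u k - \sum_(k < n0) u k) < e.
  move/subnKC <-; elim: (m - n0)%N => [|l IH]; first by rewrite addn0 subrr ultra_0.
  rewrite addnS big_ord_recr /= addrAC; apply: ultra_addlt => //.
  apply: le_lt_trans (uq _) _; apply: le_lt_trans hn.
  rewrite ler_wpM2l// exprD ler_piMr ?exprn_ge0// exprn_ile1//.
  by apply: le_trans q2 _; rewrite invf_le1 ?ler1n.
exists n0 => m n hm hn'.
rewrite -(subrK (\sum_(k < n0) u k) (\sum_(k < m) u k)) -addrA.
by apply: ultra_addlt; [exact: small|rewrite ultra_distC; exact: small].
Qed.

End Ultranorm.

Section NonarchField.
Variables (Rl : realType) (K : fieldType) (v : K -> Rl).
Hypothesis hv : nonarch_abs v.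

Lemma abs0 : v 0 = 0. Proof. by apply/(abs_eq0 hv). Qed.
Lemma abs1 : v 1 = 1.
Proof.
have v1 : v 1 != 0 by apply/eqP => /(abs_eq0 hv)/eqP; rewrite oner_eq0.
by apply: (mulfI v1); rewrite -(absM hv) !mulr1.
Qed.
Lemma absN1 : v (-1) = 1.
Proof.
apply/eqP; rewrite -(@eqrXn2 _ 2) ?abs_ge0// expr1n expr2 -(absM hv).
by rewrite mulrNN mulr1 abs1.
Qed.
Lemma absN x : v (- x) = v x.
Proof. by rewrite -mulN1r absM// absN1 mul1r. Qed.
Lemma abs_gt0 x : (0 < v x) = (x != 0).
Proof.
rewrite lt_neqAle abs_ge0// andbT eq_sym; congr negb.
by apply/eqP/eqP => /(abs_eq0 hv).
Qed.
Lemma absX x n : v (x ^+ n) = v x ^+ n.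
Proof. by elim: n => [|n IH]; rewrite ?abs1// !exprS absM// IH. Qed.
Lemma absV x : v x^-1 = (v x)^-1.
Proof.
have [->|x0] := eqVneq x 0; first by rewrite invr0 abs0 invr0.
have vx : v x != 0 by rewrite gt_eqF// abs_gt0.
by apply: (mulfI vx); rewrite -absM// !mulfV ?abs1.
Qed.

Lemma abs_ultra : ultranorm v.
Proof.
split=> [x||x /(abs_eq0 hv)|x|x y] //; [exact: abs_ge0|exact: abs0|exact: absN|].
exact: absD.
Qed.

Lemma abs_nat n : v n%:R <= 1.
Proof.
elim: n => [|n IH]; first by rewrite abs0.
by rewrite -natr1; apply: (ultra_addle abs_ultra) => //; rewrite abs1.
Qed.

(** Rescaling by [c] brings a vector of norm [t] to a norm comparable with [e]; norms
    need not be values of [v], so that one cannot divide by them. *)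
Lemma scalar_between (pi : K) (t e : Rl) : 0 < v pi <= 2^-1 -> 0 < t -> 0 < e ->
  exists c, [/\ c != 0, v c * t < e & v pi * e <= v c * t].
Proof.
move=> /andP[pi0 pi2] t0 e0; have pin0 : pi != 0 by rewrite -abs_gt0.
have piX (x : Rl) : 0 < x -> exists n, v pi ^+ n < x.
  move=> x0; exists (Num.bound x^-1).
  apply: (@le_lt_trans _ _ (2^-1 ^+ Num.bound x^-1)).
    by rewrite lerXn2r ?nnegrE ?invr_ge0// ltW.
  rewrite exprVn invf_plt ?posrE ?exprn_gt0//.
  by apply: upper_nthrootP.
have [m hm] := piX (t / e) (divr_gt0 t0 e0).
pose t' := v (pi ^- m) * t.
have t'e : e <= t'.
  rewrite /t' absV absX mulrC ler_pdivlMr ?exprn_gt0//.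
  by rewrite mulrC -ler_pdivlMr//; exact: ltW.
have t'0 : 0 < t' := lt_le_trans e0 t'e.
have ex : exists n, v pi ^+ n * t' < e.
  by have [n hn] := piX (e / t') (divr_gt0 e0 t'0); exists n; rewrite -ltr_pdivlMr.
case: (ex_minnP ex) => -[|n] hn nmin; first by rewrite expr0 mul1r ltNge t'e in hn.
exists (pi ^+ n.+1 * pi ^- m); split.
- by rewrite mulf_neq0 ?invr_eq0 ?expf_neq0.
- by rewrite absM// absX -mulrA.
rewrite absM// absX -mulrA -/t' exprS -mulrA ler_pM2l// leNgt; apply/negP => /nmin.
by rewrite ltnn.
Qed.

Lemma banach_ultra (V : lmodType K) (N : V -> Rl) : banach_space v N -> ultranorm N.
Proof.
move=> [N0 Neq0 NZ ND _]; split=> // [|x].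
  by rewrite -(scale0r (0 : V)) NZ abs0 mul0r.
by rewrite -scaleN1r NZ absN1 mul1r.
Qed.
End NonarchField.

Section BanachSpace.
Variables (Rl : realType) (K : fieldType) (v : K -> Rl) (pi : K).
Hypotheses (hv : nonarch_abs v) (v_complete : complete_for v).
Hypothesis hpi : 0 < v pi <= 2^-1.
Variables (V : lmodType K) (N : V -> Rl).
Hypothesis hN : banach_space v N.
Let uN := banach_ultra hv hN.

Definition is_subspace (X : set V) :=
  X 0 /\ forall (a : K) x y, X x -> X y -> X (a *: x + y).

Lemma is_subspaceB X x y : is_subspace X -> X x -> X y -> X (x - y).
Proof. by move=> [_ XL] Xx Xy; rewrite addrC -scaleN1r; exact: XL. Qed.
Lemma is_subspaceZ X a x : is_subspace X -> X x -> X (a *: x).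
Proof. by move=> [X0 XL] Xx; rewrite -[_ *: _]addr0; exact: XL. Qed.
Lemma is_subspaceD X x y : is_subspace X -> X x -> X y -> X (x + y).
Proof. by move=> [_ XL] Xx Xy; rewrite -[x]scale1r; exact: XL. Qed.
Lemma is_subspaceN X x : is_subspace X -> X x -> X (- x).
Proof. by move=> hX Xx; rewrite -scaleN1r; exact: is_subspaceZ. Qed.
Lemma is_subspace_sum X (I : Type) (s : seq I) (P : pred I) (F : I -> V) :
  is_subspace X -> (forall i, P i -> X (F i)) -> X (\sum_(i <- s | P i) F i).
Proof.
move=> hX XF; elim/big_ind: _ => //; first by case: hX.
by move=> x y; exact: is_subspaceD.
Qed.

Lemma norm_closureZ (X : set V) a x : is_subspace X ->
  norm_closure N X x -> norm_closure N X (a *: x).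
Proof.
move=> hX Xx e e0; have [->|a0] := eqVneq a 0.
  by exists 0; [case: hX|rewrite scale0r subrr (ultra_0 uN)].
have va0 : 0 < v a by rewrite abs_gt0.
have [y Xy ye] := Xx _ (divr_gt0 e0 va0).
exists (a *: y); first exact: is_subspaceZ.
by rewrite -scalerBr (normZ hN) mulrC -ltr_pdivlMr.
Qed.

Lemma norm_closure_subspace X : is_subspace X -> is_subspace (norm_closure N X).
Proof.
move=> hX; split=> [|a x y cx cy]; first by apply: (norm_closure_id uN); case: hX.
rewrite -[y]opprK; apply: (norm_closureB uN); first by move=> ? ?; exact: is_subspaceB.
  exact: norm_closureZ.
by rewrite -scaleN1r; exact: norm_closureZ.
Qed.

(** By [baire], the [T i] are uniformly bounded on some ball of [Y], hence, by
    translation and rescaling, on the unit ball. *)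
Lemma uniform_boundedness (Y : set V) (I : Type) (T : I -> {linear V -> V}) :
  is_subspace Y -> norm_closed N Y ->
  (forall i, exists c, forall x, N (T i x) <= c * N x) ->
  (forall y, Y y -> exists c, forall i, N (T i y) <= c) ->
  exists2 C, 0 <= C & forall i y, Y y -> N (T i y) <= C * N y.
Proof.
move=> hY Ycl Tb Tp.
pose C k : set V := [set y | forall i, N (T i y) <= k%:R].
have [||k [y0 [e [Yy0 e0 he]]]] := baire uN (norm_complete hN) (C := C) (y0 := 0) Ycl.
- by case: hY.
- move=> y /Tp[c hc]; exists (Num.bound c) => // i; apply: (le_trans (hc i)).
  apply: (le_trans (ler_norm c)); apply: ltW.
  by have := archi_boundP (normr_ge0 c); rewrite /Num.bound normr_id.
have Ck z i : norm_closure N (C k) z -> N (T i z) <= k.+1%:R.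
  move=> cz; have [c hc] := Tb i.
  have c1 : 0 < Num.max c 1 by rewrite lt_max ltr01 orbT.
  have [w Cw wz] := cz _ (divr_gt0 (ltr01) c1).
  rewrite -(subrK w z) linearD; apply: (ultra_addle uN).
    apply: le_trans (hc _) _; apply: (@le_trans _ _ (Num.max c 1 * N (z - w))).
      by rewrite ler_wpM2r ?(ultra_ge0 uN)// le_max lexx.
    rewrite mulrC -ler_pdivlMr// (ultra_distC uN).
    apply: le_trans (ltW wz) _; rewrite ler_wpM2r ?invr_ge0 ?(ltW c1)//.
    by rewrite ler1n.
  by apply: le_trans (Cw i) _; rewrite ler_nat.
have small i z : Y z -> N z < e -> N (T i z) <= k.+1%:R.
  move=> Yz ze; rewrite -[z](addrK y0) linearB; apply: (ultra_suble uN); apply: Ck.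
    by apply: he; [exact: is_subspaceD|rewrite addrK].
  by apply: he => //; rewrite subrr (ultra_0 uN).
have [pi0 _] := andP hpi.
exists (k.+1%:R / (v pi * e)).
  by rewrite divr_ge0// ltW// mulr_gt0.
move=> i y Yy; have [->|y0'] := eqVneq y 0.
  by rewrite linear0 !(ultra_0 uN) mulr0.
have Ny : 0 < N y.
  rewrite lt_neqAle (ultra_ge0 uN) andbT eq_sym; apply: contra y0' => /eqP Ny.
  by apply/eqP/(ultra_eq0 uN).
have [c [c0 ce ec]] := scalar_between hv hpi Ny e0.
have := small i (c *: y) (is_subspaceZ c hY Yy); rewrite linearZ /= !(normZ hN).
move=> /(_ ce) h; have vc : 0 < v c by rewrite abs_gt0.
rewrite -mulrA -(ler_pM2l vc); apply: le_trans h _.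
by rewrite mulrCA ler_peMr// mulrCA mulrC ler_pdivlMr ?mulr_gt0// mul1r.
Qed.

(** * Coordinates on finite-dimensional subspaces *)

Definition bounded_coords (X : set V) (I : finType) (x : I -> V) (xi : I -> V -> K) :=
  [/\ forall i, X (x i),
      forall i a y z, X y -> X z -> xi i (a *: y + z) = a * xi i y + xi i z,
      forall i, exists C, forall y, X y -> v (xi i y) <= C * N y &
      forall y, X y -> y = \sum_i xi i y *: x i].

(** Bounded coordinates map Cauchy sequences to Cauchy sequences, which converge as
    the scalars are complete. *)
Lemma bounded_coords_closed X (I : finType) x xi : is_subspace X ->
  @bounded_coords X I x xi -> norm_closed N X.
Proof.
move=> hX [Xx xiL xiB xiE] z cz.
have /choice[y yP] k : exists y, X y /\ N (y - z) < k.+1%:R^-1.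
  by have [|y] := cz k.+1%:R^-1; [rewrite invr_gt0 ltr0Sn|exists y].
have xiBE i a b : X a -> X b -> xi i (a - b) = xi i a - xi i b.
  by move=> Xa Xb; rewrite addrC -scaleN1r xiL// mulN1r addrC.
have yz : seq_lim N y z.
  move=> e e0; have [n ne] := exists_inv_lt e0; exists n => m nm.
  have [_ h] := yP m; apply: lt_trans h _; apply: le_lt_trans ne.
  by rewrite lef_pV2 ?posrE ?ltr0Sn// ler_nat.
have /choice[c cP] i : exists c, seq_lim v (fun k => xi i (y k)) c.
  have [C hC] := xiB i; apply: v_complete => e e0.
  have C1 : 0 < Num.max C 1 by rewrite lt_max ltr01 orbT.
  have [n0 h] := yz _ (divr_gt0 e0 C1); exists n0 => m n hm hn.
  have [Xm _] := yP m; have [Xn _] := yP n.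
  rewrite -xiBE//; apply: le_lt_trans (hC _ (is_subspaceB hX Xm Xn)) _.
  apply: (@le_lt_trans _ _ (Num.max C 1 * N (y m - y n))).
    by rewrite ler_wpM2r ?(ultra_ge0 uN)// le_max lexx.
  rewrite mulrC -ltr_pdivlMr// -(subrK z (y m)) -addrA; apply: (ultra_addlt uN).
    exact: h.
  by rewrite (ultra_distC uN); exact: h.
have -> : z = \sum_i c i *: x i; last first.
  by apply: is_subspace_sum => // i _; exact: is_subspaceZ.
apply/eqP; rewrite -subr_eq0; apply/eqP/(ultra_small_eq0 uN) => e e0.
have /choice[n0 hn0] i : exists n0, forall n, (n0 <= n)%N ->
    v (xi i (y n) - c i) * N (x i) <= e.
  have N1 : 0 < Num.max (N (x i)) 1 by rewrite lt_max ltr01 orbT.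
  have [n0 h] := cP i _ (divr_gt0 e0 N1); exists n0 => n /h/ltW {}h.
  apply: (@le_trans _ _ (v (xi i (y n) - c i) * Num.max (N (x i)) 1)).
    by rewrite ler_wpM2l ?(abs_ge0 hv)// le_max lexx.
  by rewrite -ler_pdivlMr.
have [n1 hn1] := yz e e0; pose n := maxn n1 (\max_i n0 i).
have [Xn _] := yP n.
rewrite -(subrK (y n) z) -addrA; apply: (ultra_addle uN).
  by rewrite (ultra_distC uN) ltW// hn1// leq_maxl.
rewrite {1}(xiE _ Xn) -sumrB; apply: (ultra_sumle uN) => [|i _]; first exact: ltW.
rewrite -scalerBl (normZ hN) hn0// leq_max; apply/orP; right.
exact: (leq_bigmax i).
Qed.

(** By induction the span of the first generators is closed; if the last one lies
    outside, then it is at a positive distance from that span, which bounds its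
    coordinate. *)
Lemma fin_dim_bounded_coords (r : nat) (g : 'I_r -> V) :
  exists (I : finType) x xi,
    @bounded_coords [set y | exists c : 'I_r -> K, y = \sum_i c i *: g i] I x xi.
Proof.
elim: r g => [|r IHr] g.
  exists 'I_0, (fun=> 0), (fun _ => fun=> 0).
  by split=> [[]|[]|[]|y /= [c ->]] //; rewrite !big_ord0.
pose g' i := g (widen_ord (leqnSn r) i).
have [I [x [xi xP]]] := IHr g'.
set X := [set y | exists c : 'I_r.+1 -> K, y = \sum_i c i *: g i].
set X' := [set y | exists c : 'I_r -> K, y = \sum_i c i *: g' i] in xP.
have hX' : is_subspace X'.
  split=> [|a _ _ [c ->] [c' ->]].
    by exists (fun=> 0); rewrite big1// => i _; rewrite scale0r.
  exists (fun i => a * c i + c' i); rewrite scaler_sumr -big_split /=.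
  by apply: eq_bigr => i _; rewrite scalerDl scalerA.
have XE y : X y <-> exists a, X' (y - a *: g ord_max).
  split=> [[c ->]|[a [c /eqP]]].
    exists (c ord_max), (fun i => c (widen_ord (leqnSn r) i)).
    by rewrite big_ord_recr /= addrK.
  rewrite subr_eq => /eqP ->.
  exists (fun i => if unlift ord_max i is Some k then c k else a).
  rewrite big_ord_recr /= unlift_none; congr (_ + _); apply: eq_bigr => i _.
  have -> : widen_ord (leqnSn r) i = lift ord_max i.
    by apply: val_inj; rewrite /= /bump leqNgt ltn_ord.
  rewrite liftK /g'; congr (_ *: g _).
  by apply: val_inj; rewrite /= /bump leqNgt ltn_ord.
have [gX'|gX'] := pselect (X' (g ord_max)).
  suff -> : X = X' by exists I, x, xi.
  apply/seteqP; split=> y; last by move=> X'y; apply/XE; exists 0; rewrite scale0r subr0.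
  move=> /XE[a X'y]; rewrite -(subrK (a *: g ord_max) y); apply: is_subspaceD => //.
  exact: is_subspaceZ.
have X'cl := bounded_coords_closed hX' xP.
have [e e0 he] : exists2 e, 0 < e & forall y, X' y -> e <= N (y + g ord_max).
  apply: contrapT => ne; apply: gX'; rewrite -[g _]opprK; apply: is_subspaceN => //.
  apply: X'cl => e e0; apply: contrapT => ny; apply: ne; exists e => // y X'y.
  by rewrite leNgt; apply/negP => ye; apply: ny; exists y; rewrite ?opprK.
have /choice[gam gamP] y : exists a, X y -> X' (y - a *: g ord_max).
  have [/XE[a h]|nX] := pselect (X y); first by exists a.
  by exists 0.
have gamE y a : X' (y - a *: g ord_max) -> gam y = a.
  move=> h; have Xy : X y by apply/XE; exists a.
  have h' := gamP y Xy; apply/eqP/negPn/negP => ne; apply: gX'.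
  have h2 := is_subspaceB hX' h' h.
  rewrite opprB addrC addrA subrK -scalerBl in h2.
  have := is_subspaceZ (a - gam y)^-1 hX' h2.
  by rewrite scalerA mulVf ?scale1r// subr_eq0 eq_sym.
have [Xx xiL xiB xiE] := xP.
have gamL a y z : X y -> X z -> gam (a *: y + z) = a * gam y + gam z.
  move=> Xy Xz; apply: gamE.
  rewrite scalerDl opprD addrACA -scalerA -scalerBr.
  by have [_ h] := hX'; apply: h; exact: gamP.
have gamB y : X y -> v (gam y) <= e^-1 * N y.
  move=> Xy; have [->|gy0] := eqVneq (gam y) 0.
    by rewrite (abs0 hv) mulr_ge0 ?(ultra_ge0 uN)// invr_ge0 ltW.
  have := he _ (is_subspaceZ (gam y)^-1 hX' (gamP _ Xy)).
  rewrite scalerBr scalerA mulVf// scale1r subrK (normZ hN) absV// => h.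
  have gy : 0 < v (gam y) by rewrite abs_gt0.
  by rewrite mulrC ler_pdivlMr// mulrC -ler_pdivlMr// mulrC.
exists (I + 'I_1)%type, (fun i => match i with inl i => x i | inr _ => g ord_max end).
exists (fun i y => match i with
  | inl i => xi i (y - gam y *: g ord_max) | inr _ => gam y end).
split.
- case=> [i|_]; first by apply/XE; exists 0; rewrite scale0r subr0.
  by apply/XE; exists 1; rewrite scale1r subrr; case: hX'.
- case=> [i|_] a y z Xy Xz; last exact: gamL.
  rewrite -xiL; [|exact: gamP|exact: gamP]; congr (xi _ _).
  by rewrite gamL// scalerDl opprD addrACA -scalerA -scalerBr.
- case=> [i|_]; last by exists e^-1.
  have [C hC] := xiB i.
  exists (Num.max C 0 * Num.max 1 (e^-1 * N (g ord_max))) => y Xy.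
  apply: le_trans (hC _ (gamP _ Xy)) _.
  apply: (@le_trans _ _ (Num.max C 0 * N (y - gam y *: g ord_max))).
    by rewrite ler_wpM2r ?(ultra_ge0 uN)// le_max lexx.
  rewrite -mulrA ler_wpM2l ?le_max ?lexx ?orbT//.
  apply: (ultra_suble uN).
    by rewrite ler_peMl ?(ultra_ge0 uN)// le_max lexx.
  rewrite (normZ hN); apply: (@le_trans _ _ ((e^-1 * N y) * N (g ord_max))).
    by rewrite ler_wpM2r ?(ultra_ge0 uN)// gamB.
  rewrite mulrAC ler_wpM2r ?(ultra_ge0 uN)// le_max lexx orbT//.
- move=> y Xy; rewrite big_sumType /= big_ord1.
  by rewrite -(xiE _ (gamP _ Xy)) subrK.
Qed.

End BanachSpace.

(** * Submodules of finite modules over a noetherian Banach algebra are closed *)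

Section BanachAlgebra.
Variables (Rl : realType) (K : fieldType) (v : K -> Rl) (pi : K).
Hypotheses (hv : nonarch_abs v) (hpi : 0 < v pi <= 2^-1).
Variables (RB : algType K) (N : RB -> Rl).
Hypothesis hB : banach_algebra v N.
Let bN : banach_space v N. Proof. by case: hB. Qed.
Let uN := banach_ultra hv bN.

Lemma banach_mul_bound : exists2 C, 0 < C & forall x y, N (x * y) <= C * N x * N y.
Proof.
have [_ [C hC]] := hB; exists (Num.max C 1).
  by rewrite lt_max ltr01 orbT.
move=> x y; apply: le_trans (hC x y) _; rewrite -!mulrA ler_wpM2r//.
  by rewrite mulr_ge0 ?(ultra_ge0 uN).
by rewrite le_max lexx.
Qed.

(** [U] is shown to be closed when its closure is spanned by finitely many [u i], each
    with its own set [S i] of coefficients, and each [u i] is a limit of elements [w]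
    with [S i] multiples in [U]. Distinct coefficient sets are needed for the kernel
    of a presentation, which is spanned over the whole algebra. *)
Section Perturbation.
Variables (V : lmodType RB) (NV : V -> Rl).
Hypotheses (uV : ultranorm NV) (V_complete : complete_for NV).
Hypothesis NVZ : exists2 C, 0 < C & forall a x, NV (a *: x) <= C * N a * NV x.
Hypothesis NVZK : forall (c : K) x, NV (c%:A *: x) = v c * NV x.
Variables (U : set V) (I : finType) (S : I -> set RB) (u : I -> V).
Hypothesis U_sub : forall x y, U x -> U y -> U (x - y).
Hypothesis U0 : U 0.
Hypothesis UZ : forall (c : K) x, U x -> U (c%:A *: x).
Hypothesis S0 : forall i, S i 0.
Hypothesis S_sub : forall i x y, S i x -> S i y -> S i (x - y).
Hypothesis SZ : forall i (c : K) x, S i x -> S i (c *: x).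
Hypothesis S_closed : forall i, norm_closed N (S i).
Hypothesis U_span : forall y, norm_closure NV U y ->
  exists x : I -> RB, (forall i, S i (x i)) /\ y = \sum_i x i *: u i.
Hypothesis u_approx : forall i (e : Rl), 0 < e ->
  exists2 w, NV (u i - w) < e & forall a, S i a -> U (a *: w).

Let Y := norm_closure NV U.

Let SD i x y : S i x -> S i y -> S i (x + y).
Proof.
move=> Sx Sy; rewrite -[y]opprK; apply: S_sub => //.
by rewrite -[- y]sub0r; apply: S_sub => //; exact: S0.
Qed.

Let YB x y : Y x -> Y y -> Y (x - y).
Proof. exact: (norm_closureB uV). Qed.

Let YZ (c : K) x : Y x -> Y (c%:A *: x).
Proof.
move=> Yx e e0; have [->|c0] := eqVneq c 0.
  by exists 0; rewrite // scale0r scale0r subrr (ultra_0 uV).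
have vc : 0 < v c by rewrite abs_gt0.
have [w Uw we] := Yx _ (divr_gt0 e0 vc).
by exists (c%:A *: w); [exact: UZ|rewrite -scalerBr NVZK mulrC -ltr_pdivlMr].
Qed.

(** By Baire, the combinations of the [u i] with coefficients of some bounded size
    are dense in a ball of [Y]; rescale. *)
Let coarse (t : Rl) : 0 < t -> exists2 C, 0 < C & forall y, Y y ->
  exists x : I -> RB, [/\ forall i, S i (x i), forall i, N (x i) <= C * NV y &
    NV (y - \sum_i x i *: u i) <= t * NV y].
Proof.
move=> t0; pose C k : set V := [set y | exists x : I -> RB, [/\ forall i, S i (x i),
  forall i, N (x i) <= k%:R & y = \sum_i x i *: u i]].
have [|||k [y0 [e [Yy0 e0 he]]]] := baire uV V_complete (Y := Y) (C := C) (y0 := 0).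
- exact: (norm_closureK uV).
- exact: (norm_closure_id uV).
- move=> y /U_span[x [Sx ->]]; exists (Num.bound (\big[Num.max/0]_i N (x i))) => //.
  exists x; split=> // i; set b := \big[_/_]_i _.
  have : N (x i) <= b by exact: le_bigmax.
  move/le_trans; apply; apply: ltW; apply: archi_boundP.
  exact: bigmax_ge_id.
have CB x y : C k x -> C k y -> C k (x - y).
  move=> [a [Sa aN ->]] [b [Sb bN' ->]]; exists (fun i => a i - b i); split=> [i|i|].
  - exact: S_sub.
  - exact: (ultra_suble uN).
  - by rewrite -sumrB; apply: eq_bigr => i _; rewrite scalerBl.
have small y : Y y -> NV y < e -> norm_closure NV (C k) y.
  move=> Yy ye; rewrite -[y](addrK y0); apply: (norm_closureB uV) => //.
    apply: he; last by rewrite addrK.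
    by rewrite -[y0]opprK; apply: YB => //; rewrite -sub0r; apply: YB => //;
      exact: (norm_closure_id uV).
  by apply: he => //; rewrite subrr (ultra_0 uV).
have [pi0 _] := andP hpi.
have pe : 0 < v pi * e by rewrite mulr_gt0.
exists (k.+1%:R / (v pi * e)) => [|y Yy]; first by rewrite divr_gt0// ltr0Sn.
have [->|y0'] := eqVneq y 0.
  exists (fun=> 0); split=> [i|i|]; first exact: S0.
    by rewrite (ultra_0 uN) (ultra_0 uV) mulr0.
  by rewrite big1 ?subr0 ?(ultra_0 uV) ?mulr0// => i _; rewrite scale0r.
have Ny : 0 < NV y.
  rewrite lt_neqAle (ultra_ge0 uV) andbT eq_sym; apply: contra y0' => /eqP Ny.
  by apply/eqP/(ultra_eq0 uV).
have [c [c0 ce ec]] := scalar_between hv hpi Ny e0.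
have vc : 0 < v c by rewrite abs_gt0.
have tpe : 0 < t * (v pi * e) by rewrite mulr_gt0.
have [|_ [x [Sx xk ->]] xy] := small (c%:A *: y) (YZ c Yy) _ _ tpe.
  by rewrite NVZK.
exists (fun i => c^-1 *: x i); split=> [i|i|]; first exact: SZ.
  rewrite (normZ bN) absV// mulrC ler_pdivrMr//; apply: le_trans (xk i) _.
  apply: (@le_trans _ _ (k.+1%:R)); first by rewrite ler_nat.
  rewrite -!mulrA ler_peMr// mulrC ler_pdivlMr// mul1r.
  by rewrite [leRHS]mulrC.
rewrite -(ler_pM2l vc) -NVZK scalerBr (ultra_distC uV).
have -> : c%:A *: (\sum_i (c^-1 *: x i) *: u i) = \sum_i x i *: u i.
  rewrite scaler_sumr; apply: eq_bigr => i _.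
  by rewrite scalerA -scalerAl mul1r scalerA mulfV// scale1r.
by apply: le_trans (ltW xy) _; rewrite [leRHS]mulrCA ler_pM2l.
Qed.

(** Successive approximation with the generators replaced by elements of [U] close
    to them. *)
Lemma perturbed_generators : norm_closed NV U.
Proof.
have half0 : 0 < 2^-1 :> Rl by rewrite invr_gt0 ltr0Sn.
have [C C0 hC] := coarse half0; have [D D0 hD] := NVZ.
have CD0 : 0 < C * D by rewrite mulr_gt0.
have /choice[w wP] i : exists w, NV (u i - w) < 2^-1 / (C * D) /\
    forall a, S i a -> U (a *: w).
  by have [w] := u_approx i (divr_gt0 half0 CD0); exists w.
have step y : exists x : I -> RB, Y y -> [/\ forall i, S i (x i),
    forall i, N (x i) <= C * NV y & NV (y - \sum_i x i *: w i) <= 2^-1 * NV y].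
  have [Yy|nY] := pselect (Y y); last by exists (fun=> 0).
  have [x [Sx xC xy]] := hC _ Yy; exists x => _; split=> //.
  rewrite (_ : y - _ = y - \sum_i x i *: u i +
    (\sum_i x i *: u i - \sum_i x i *: w i)); last by rewrite addrA subrK.
  apply: (ultra_addle uV) => //.
  rewrite -sumrB; apply: (ultra_sumle uV) => [|i _].
    by rewrite mulr_ge0 ?(ultra_ge0 uV)// ltW.
  rewrite -scalerBr; apply: le_trans (hD _ _) _.
  have [wi _] := wP i.
  apply: (@le_trans _ _ (D * (C * NV y) * (2^-1 / (C * D)))).
    apply: ler_pM; rewrite ?(ultra_ge0 uV)// ?mulr_ge0 ?(ultra_ge0 uN)// ?(ltW D0)//.
      by rewrite ler_pM2l.
    exact: ltW.
  rewrite le_eqVlt; apply/orP; left; apply/eqP; field.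
  by rewrite !gt_eqF.
have [X XP] := choice step.
move=> y Yy; pose z := fix z k := if k is k'.+1 then
  z k' - \sum_i X (z k') i *: w i else y.
have UXw y' : Y y' -> U (\sum_i X y' i *: w i).
  move=> /XP[SX _ _]; elim/big_ind: _ => // [a b Ua Ub|i _].
    by rewrite -[b]opprK; apply: U_sub => //; rewrite -[- b]sub0r; exact: U_sub.
  by have [_] := wP i; apply.
have Yz k : Y (z k).
  elim: k => //= k IH; apply: YB => //; apply: (norm_closure_id uV).
  exact: UXw.
have zN k : NV (z k) <= 2^-1 ^+ k * NV y.
  elim: k => [|k IH]; first by rewrite expr0 mul1r.
  have [_ _ h] := XP _ (Yz k); apply: le_trans h _.
  by rewrite exprS -mulrA ler_pM2l.
have /choice[x xP] i : exists x, seq_lim N (fun n => \sum_(k < n) X (z k) i) x.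
  apply: (@cauchy_series _ _ _ uN (norm_complete bN) (fun k => X (z k) i) (C * NV y) 2^-1).
  - by rewrite mulr_ge0 ?(ultra_ge0 uV)// ltW.
  - by [].
  - exact: ltW.
  - move=> k; have [_ h _] := XP _ (Yz k); apply: le_trans (h i) _.
    rewrite -mulrA ler_pM2l// mulrC; exact: zN.
have Sx i : S i (x i).
  apply: S_closed; apply: (seq_lim_closure (n1 := 0%N)) (xP i) => n _.
  elim/big_ind: _ => // [|k _]; first exact: SD.
  by have [+ _ _] := XP _ (Yz k); apply.
have yz n : y = \sum_i (\sum_(k < n) X (z k) i) *: w i + z n.
  elim: n => [|n IH].
    by rewrite big1 ?add0r// => i _; rewrite big_ord0 scale0r.
  rewrite {1}IH /=; under [X in _ = X + _]eq_bigr do rewrite big_ord_recr /= scalerDl.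
  by rewrite big_split /= -addrA; congr (_ + _); rewrite addrC subrK.
suff -> : y = \sum_i x i *: w i.
  elim/big_ind: _ => // [a b Ua Ub|i _].
    by rewrite -[b]opprK; apply: U_sub => //; rewrite -[- b]sub0r; exact: U_sub.
  by have [_] := wP i; apply.
apply/eqP; rewrite -subr_eq0; apply/eqP/(ultra_small_eq0 uV) => e e0.
have /choice[n0 hn0] i : exists n0, forall n, (n0 <= n)%N ->
    NV ((\sum_(k < n) X (z k) i - x i) *: w i) <= e.
  have N1 : 0 < Num.max (NV (w i)) 1 by rewrite lt_max ltr01 orbT.
  have [n0 h] := xP i _ (divr_gt0 e0 (mulr_gt0 D0 N1)); exists n0 => n /h/ltW {}h.
  apply: le_trans (hD _ _) _; rewrite -mulrA.
  apply: (@le_trans _ _ (D * (N (\sum_(k < n) X (z k) i - x i) * Num.max (NV (w i)) 1))).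
    by rewrite ler_pM2l// ler_wpM2l ?(ultra_ge0 uN)// le_max lexx.
  by rewrite mulrCA -ler_pdivlMr ?mulr_gt0.
have [n1 hn1] : exists n1, forall n, (n1 <= n)%N -> NV (z n) <= e.
  have y1 : 0 < Num.max (NV y) 1 by rewrite lt_max ltr01 orbT.
  exists (Num.bound (Num.max (NV y) 1 / e)) => n hn; apply: le_trans (zN n) _.
  apply: (@le_trans _ _ (2^-1 ^+ n * Num.max (NV y) 1)).
    by rewrite ler_wpM2l ?exprn_ge0 ?(ltW half0)// le_max lexx.
  rewrite exprVn mulrC ler_pdivrMr ?exprn_gt0// mulrC -ler_pdivrMr//.
  by apply/ltW/upper_nthrootP.
pose n := maxn n1 (\max_i n0 i).
rewrite {1}(yz n) addrAC; apply: (ultra_addle uV); last exact/hn1/leq_maxl.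
rewrite -sumrB; apply: (ultra_sumle uV) => [|i _]; first exact: ltW.
rewrite -scalerBl; apply: hn0; rewrite leq_max; apply/orP; right.
exact: (leq_bigmax i).
Qed.

End Perturbation.

Section RowNorm.
Variable r : nat.
Implicit Types x y : 'rV[RB]_r.

Definition row_norm x : Rl := \big[Num.max/0]_(i < r) N (x 0 i).

Lemma row_norm_ge x i : N (x 0 i) <= row_norm x.
Proof. exact: le_bigmax. Qed.

Lemma row_norm_le x e : 0 <= e -> (forall i, N (x 0 i) <= e) -> row_norm x <= e.
Proof. by move=> e0 xe; apply: bigmax_le. Qed.

Lemma row_norm_lt x e : 0 < e -> (forall i, N (x 0 i) < e) -> row_norm x < e.
Proof. by move=> e0 xe; apply: bigmax_lt. Qed.

Lemma row_norm_ge0 x : 0 <= row_norm x.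
Proof. exact: bigmax_ge_id. Qed.

Lemma row_norm_ultra : ultranorm row_norm.
Proof.
split=> [||x x0|x|x y].
- exact: row_norm_ge0.
- apply/eqP; rewrite eq_le row_norm_ge0 andbT; apply: row_norm_le => // i.
  by rewrite mxE (ultra_0 uN).
- apply/rowP => i; rewrite mxE; apply: (ultra_eq0 uN); apply/eqP.
  by rewrite eq_le (ultra_ge0 uN) andbT -x0; exact: row_norm_ge.
- by apply: eq_bigr => i _; rewrite mxE (ultraN uN).
- apply: row_norm_le => [|i]; first by rewrite le_max row_norm_ge0.
  rewrite mxE; apply: le_trans (ultraD uN _ _) _.
  by rewrite ge_max !le_max !row_norm_ge orbT.
Qed.

Lemma row_norm_complete : complete_for row_norm.
Proof.
move=> u u_cauchy.
have /choice[l lP] i : exists l, seq_lim N (fun k => u k 0 i) l.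
  apply: (norm_complete bN) => e /u_cauchy[n0 h]; exists n0 => m n hm hn.
  apply: le_lt_trans (h m n hm hn).
  by have := row_norm_ge (u m - u n) i; rewrite !mxE.
exists (\row_i l i) => e e0.
have /choice[n0 hn0] i := lP i e e0.
exists (\max_i n0 i) => n hn; apply: row_norm_lt => // i.
by rewrite !mxE; apply: hn0; apply: leq_trans hn; exact: (leq_bigmax i).
Qed.

Lemma row_normZ : exists2 C, 0 < C &
  forall a x, row_norm (a *: x) <= C * N a * row_norm x.
Proof.
have [C C0 hC] := banach_mul_bound; exists C => // a x; apply: row_norm_le => [|i].
  by rewrite !mulr_ge0 ?row_norm_ge0 ?(ultra_ge0 uN)// ltW.
rewrite mxE; apply: le_trans (hC _ _) _; rewrite ler_wpM2l ?row_norm_ge//.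
by rewrite mulr_ge0 ?(ultra_ge0 uN)// ltW.
Qed.

Lemma row_normZK (c : K) x : row_norm (c%:A *: x) = v c * row_norm x.
Proof.
rewrite /row_norm (big_morph (fun t => v c * t) (id1 := 0) (op1 := Num.max)).
- by apply: eq_bigr => i _; rewrite mxE -scalerAl mul1r (normZ bN).
- by move=> a b; rewrite maxr_pMr ?abs_ge0.
- by rewrite mulr0.
Qed.

End RowNorm.

(** The closure of the preimage of [Z] is generated by finitely many elements over
    [S], together with the kernel of the presentation, which is finite over [RB]. *)
Lemma submod_closed (S : set RB) (M : lmodType RB) (Z : set M) :
  left_noetherian RB ->
  is_subring S -> (forall c : K, S c%:A) -> norm_closed N S ->
  left_noetherian_over S -> fin_gen_over S M -> is_submod_over S Z ->
  forall r (f : {linear 'rV[RB]_r -> M}), (forall m, exists x, f x = m) ->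
  norm_closed (@row_norm r) [set x | Z (f x)].
Proof.
move=> RB_noeth hS SK Scl S_noeth [s [g gS]] hZ r f f_surj.
have [Z0 ZB ZZ] := hZ; have uR := row_norm_ultra r.
have [D D0 hD] := row_normZ r.
set U := [set x | Z (f x)].
have UB x y : U x -> U y -> U (x - y) by move=> Ux Uy; rewrite /U /= linearB; exact: ZB.
pose Y := norm_closure (@row_norm r) U.
have YB x y : Y x -> Y y -> Y (x - y) by exact: (norm_closureB uR).
have YZ a x : S a -> Y x -> Y (a *: x).
  move=> Sa Yx e e0; have a1 : 0 < Num.max (N a) 1 by rewrite lt_max ltr01 orbT.
  have [w Uw wx] := Yx _ (divr_gt0 e0 (mulr_gt0 D0 a1)).
  exists (a *: w); first by rewrite /U /= linearZ; exact: ZZ.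
  rewrite -scalerBr; apply: le_lt_trans (hD _ _) _.
  apply: (@le_lt_trans _ _ (D * Num.max (N a) 1 * row_norm (w - x))).
    by rewrite ler_wpM2r ?row_norm_ge0// ler_pM2l// le_max lexx.
  by rewrite mulrC -ltr_pdivlMr ?mulr_gt0.
pose P : set M := [set m | exists2 y, Y y & f y = m].
have hP : is_submod_over S P.
  split=> [|_ _ [x Yx <-] [y Yy <-]|a _ Sa [x Yx <-]].
  - by exists 0; rewrite ?linear0//; apply: (norm_closure_id uR); rewrite /U /= linear0.
  - by exists (x - y); [exact: YB|rewrite linearB].
  - by exists (a *: x); [exact: YZ|rewrite linearZ].
have [|k [m [Pm mP]]] := noetherian_fin_gen_submod hS (g := g) S_noeth hP.
  by move=> x _; exact: gS.
have /choice[y yP] i : exists y, Y y /\ f y = m i by have [y] := Pm i; exists y.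
have hT : is_subring [set: RB] by [].
have [||l [q [kerq qker]]] := noetherian_fin_gen_submod (S := setT) (r := r) hT
    (g := fun i => delta_mx 0 i) (U := [set x | f x = 0]) RB_noeth.
- split=> [|x x' /= fx fx'|a x _ /= fx]; first exact: linear0.
    by rewrite linearB fx fx' subr0.
  by rewrite linearZ /= fx scaler0.
- by move=> x _; exists (fun i => x 0 i); split=> //; exact: row_sum_delta.
pose I := ('I_k + 'I_l)%type.
apply: (@perturbed_generators _ _ uR (@row_norm_complete r) (row_normZ r)
  (@row_normZK r) U I (fun i => if i is inl _ then S else setT)
  (fun i => match i with inl i => y i | inr j => q j end)).
- exact: UB.
- by rewrite /U /= linear0.
- by move=> c x Ux; rewrite /U /= linearZ; apply: ZZ.
- by case=> // _; exact: subring0.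
- by case=> // _ a b; exact: subringB.
- case=> // _ c a Sa; rewrite -[a]mul1r scalerAl; apply: subringM => //.
- by case=> // _; exact: Scl.
- move=> x Yx; have [|a [Sa fx]] := mP (f x); first by exists x.
  have [|b [_ xE]] := qker (x - \sum_i a i *: y i).
    rewrite /= linearB fx linear_sum /=; apply/eqP; rewrite subr_eq0; apply/eqP.
    by apply: eq_bigr => i _; rewrite linearZ /=; have [_ ->] := yP i.
  exists (fun i => match i with inl i => a i | inr j => b j end); split=> [[]//|].
  by rewrite big_sumType /= -xE addrC subrK.
- case=> i e e0; last first.
    exists (q i); first by rewrite subrr (ultra_0 uR).
    by move=> a _; rewrite /U /= linearZ /= kerq scaler0.
  have [Yy _] := yP i; have [w Uw wy] := Yy e e0.
  exists w; first by rewrite (ultra_distC uR).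
  by move=> a Sa; rewrite /U /= linearZ; exact: ZZ.
Qed.

End BanachAlgebra.

(** * Separating approximate eigenvectors *)

Lemma exists_expr_lt (Rl : realType) (q e : Rl) : 0 <= q < 1 -> 0 < e ->
  exists k, q ^+ k < e.
Proof.
move=> /andP[q0 q1] e0; have [->|qn0] := eqVneq q 0.
  by exists 1%N; rewrite expr1.
have {}q0 : 0 < q by rewrite lt_neqAle eq_sym qn0.
pose h := q^-1 - 1; have h0 : 0 < h by rewrite subr_gt0 invf_gt1.
have bern n : 1 + n%:R * h <= (q^-1) ^+ n.
  elim: n => [|n IH]; first by rewrite mul0r addr0.
  rewrite exprS; have qE : q^-1 = 1 + h by rewrite addrC subrK.
  apply: (@le_trans _ _ (q^-1 * (1 + n%:R * h))).
    have -> : q^-1 * (1 + n%:R * h) = 1 + n.+1%:R * h + n%:R * h * h.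
      by rewrite qE -natr1; ring.
    by rewrite lerDl !mulr_ge0 ?ler0n// ltW.
  by rewrite ler_pM2l ?invr_gt0.
exists (Num.bound (e^-1 / h)).
have := bern (Num.bound (e^-1 / h)); set n := Num.bound _ => bn.
rewrite -[q]invrK exprVn invf_plt ?posrE ?exprn_gt0 ?invr_gt0//.
apply: lt_le_trans bn; apply: (@lt_le_trans _ _ (n%:R * h)); last by rewrite lerDr.
rewrite -ltr_pdivrMr//; apply: archi_boundP.
by rewrite divr_ge0 ?invr_ge0 ?ltW.
Qed.

(** The set [sm c] stands for the ball of radius [c] of an ultrametric seminorm: for a
    quotient of a normed space such balls are available without computing the
    infimum that defines the seminorm. *)
Section Separation.
Variables (Rl : realType) (K : fieldType) (v : K -> Rl).
Hypothesis hv : nonarch_abs v.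
Variables (X : lmodType K) (sm : Rl -> set X).
Hypothesis sm0 : forall c, 0 <= c -> sm c 0.
Hypothesis smD : forall c x y, sm c x -> sm c y -> sm c (x + y).
Hypothesis smZ : forall c a x, sm c x -> sm (v a * c) (a *: x).
Hypothesis sm_le : forall c c' x, c <= c' -> sm c x -> sm c' x.
Variables (T : {linear X -> X}) (W : set X).
Hypothesis hW : is_subspace W.
Hypothesis TW : forall x, W x -> W (T x).
Hypothesis W_closed :
  forall x, (forall e, 0 < e -> exists2 w, W w & sm e (x - w)) -> W x.

Definition shift (nu : K) (x : X) := T x - nu *: x.

Lemma shift_linear nu : linear (shift nu).
Proof.
move=> a x y; rewrite /shift linearP scalerDr opprD addrACA !scalerA mulrC.
by rewrite -scalerA -scalerBr.
Qed.
HB.instance Definition _ nu :=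
  GRing.isLinear.Build K X X _ (shift nu) (shift_linear nu).

Lemma iter_shiftD nu j x y :
  iter j (shift nu) (x + y) = iter j (shift nu) x + iter j (shift nu) y.
Proof. by elim: j => //= j ->; rewrite linearD. Qed.

Lemma iter_shiftZ nu j a x : iter j (shift nu) (a *: x) = a *: iter j (shift nu) x.
Proof. by elim: j => //= j ->; rewrite linearZ. Qed.

Variable eps : Rl.
Hypothesis eps0 : 0 < eps.

(** The vectors on which [T - nu] has spectral radius at most [eps]. *)
Definition near_eigen (nu : K) (C : Rl) : set X :=
  [set y | forall j, sm (C * eps ^+ j) (iter j (shift nu) y)].

(** [P] has operator norm at most [c] for the gauge of [near_eigen nu]. *)
Definition op_bound (nu : K) (c : Rl) (P : X -> X) := 0 <= c /\
  forall C y, 0 <= C -> near_eigen nu C y -> near_eigen nu (c * C) (P y).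

Let op_comp nu c c' P Q : op_bound nu c P -> op_bound nu c' Q ->
  op_bound nu (c * c') (fun x => P (Q x)).
Proof.
move=> [c0 hP] [c'0 hQ]; split=> [|C y C0 hy]; first exact: mulr_ge0.
by rewrite -mulrA; apply: hP; [exact: mulr_ge0|exact: hQ].
Qed.

Let op_add nu c P Q : op_bound nu c P -> op_bound nu c Q ->
  op_bound nu c (fun x => P x + Q x).
Proof.
move=> [c0 hP] [_ hQ]; split=> // C y C0 hy j.
by rewrite iter_shiftD; apply: smD; [exact: hP|exact: hQ].
Qed.

Let op_scale nu c a P : op_bound nu c P -> op_bound nu (v a * c) (fun x => a *: P x).
Proof.
move=> [c0 hP]; split=> [|C y C0 hy j]; first by rewrite mulr_ge0 ?abs_ge0.
by rewrite iter_shiftZ -!mulrA; apply: smZ; rewrite mulrA; exact: hP.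
Qed.

Let op_le nu c c' P : c <= c' -> op_bound nu c P -> op_bound nu c' P.
Proof.
move=> cc' [c0 hP]; split=> [|C y C0 hy j]; first exact: le_trans cc'.
apply: sm_le (hP _ _ C0 hy j); rewrite ler_wpM2r ?exprn_ge0 ?(ltW eps0)//.
by rewrite ler_wpM2r.
Qed.

Let op_id nu : op_bound nu 1 id.
Proof. by split=> // C y C0 hy; rewrite mul1r. Qed.

Let op_iter nu c P n : op_bound nu c P -> op_bound nu (c ^+ n) (iter n P).
Proof.
move=> hP; elim: n => [|n IH]; first exact: op_id.
by rewrite exprS; exact: (op_comp hP IH).
Qed.

Let op_sub nu c P Q : op_bound nu c P -> op_bound nu c Q ->
  op_bound nu c (fun x => P x - Q x).
Proof.
move=> hP hQ; have := op_scale (-1) hQ; rewrite (absN1 hv) mul1r => hQ'.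
have := op_add hP hQ'; congr (op_bound _ _ _); apply/funext => x.
by rewrite scaleN1r.
Qed.

Let op_shift nu mu c : v (nu - mu) <= c -> eps <= c -> op_bound nu c (shift mu).
Proof.
move=> nmc ec; have c0 : 0 <= c := le_trans (ltW eps0) ec.
split=> // C y C0 hy j.
have -> : shift mu y = shift nu y + (nu - mu) *: y.
  by rewrite /shift scalerBl addrA subrK.
rewrite iter_shiftD iter_shiftZ -iterSr; apply: smD.
  apply: sm_le (hy j.+1); rewrite exprS mulrCA -!mulrA.
  by rewrite ler_wpM2r// mulr_ge0// exprn_ge0// ltW.
apply: (@sm_le (v (nu - mu) * (C * eps ^+ j))); last exact: smZ.
by rewrite -mulrA ler_wpM2r// mulr_ge0// exprn_ge0// ltW.
Qed.

(** The operators generated by [T] below, which act on [W] and are bounded near every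
    centre. *)
Definition admissible (P : X -> X) := [/\ forall x y, P (x + y) = P x + P y,
  forall x, W x -> W (P x) & forall nu, exists c, op_bound nu c P].

Let adm_id : admissible id.
Proof. by split=> // nu; exists 1; exact: op_id. Qed.

Let adm_comp P Q : admissible P -> admissible Q -> admissible (fun x => P (Q x)).
Proof.
move=> [PD PW Pb] [QD QW Qb]; split=> [x y|x Wx|nu].
- by rewrite QD PD.
- exact/PW/QW.
- have [c hc] := Pb nu; have [c' hc'] := Qb nu.
  by exists (c * c'); exact: op_comp.
Qed.

Let adm_iter P n : admissible P -> admissible (iter n P).
Proof.
by move=> hP; elim: n => [|n IH]; [exact: adm_id|exact: adm_comp].
Qed.

Let adm_sub P Q : admissible P -> admissible Q -> admissible (fun x => P x - Q x).
Proof.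
move=> [PD PW Pb] [QD QW Qb]; split=> [x y|x Wx|nu].
- by rewrite QD PD opprD addrACA.
- by apply: is_subspaceB => //; [exact: PW|exact: QW].
- have [c hc] := Pb nu; have [c' hc'] := Qb nu.
  exists (Num.max c c'); apply: op_sub.
    by apply: op_le hc; rewrite le_max lexx.
  by apply: op_le hc'; rewrite le_max lexx orbT.
Qed.

Let adm_shift a mu : admissible (fun x => a *: shift mu x).
Proof.
split=> [x y|x Wx|nu]; first by rewrite -scalerDr -linearD.
  apply: is_subspaceZ => //; apply: is_subspaceB => //; [exact: TW|exact: is_subspaceZ].
exists (v a * Num.max (v (nu - mu)) eps).
by apply: op_scale; apply: op_shift; rewrite le_max lexx ?orbT.
Qed.

Variable mu : K.

(** The operator is [(1 - ((T - mu) / (nu - mu)) ^ k) ^ k] for large [k]: the quotient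
    is small near [mu] and close to [1] near [nu]. *)
Let kill nu eta : eps < v (nu - mu) -> 0 < eta -> exists P, [/\ admissible P,
  op_bound mu eta (fun x => P x - x), op_bound nu eta P &
  forall nu', v (nu' - mu) <= v (nu - mu) -> op_bound nu' 1 P].
Proof.
move=> enu eta0; pose rho := v (nu - mu); have rho0 : 0 < rho := lt_trans eps0 enu.
pose theta := eps / rho.
have th0 : 0 <= theta by rewrite divr_ge0 ?ltW.
have th1 : theta < 1 by rewrite ltr_pdivrMr// mul1r.
have [|k hk] := @exists_expr_lt _ theta _ _ eta0; first by rewrite th0.
have thk : theta ^+ k <= 1 by rewrite exprn_ile1// ltW.
pose a := (nu - mu)^-1; have va : v a = rho^-1 by rewrite absV.
have numu : nu - mu != 0 by rewrite -(abs_gt0 hv).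
pose Y x := a *: shift mu x.
have Yb nu' : v (nu' - mu) <= rho -> op_bound nu' 1 Y.
  move=> h; have := op_scale a (op_shift h (ltW enu)).
  by rewrite va mulVf// gt_eqF.
have Ymu : op_bound mu theta Y.
  rewrite /theta mulrC -va; apply: op_scale; apply: op_shift => //.
  by rewrite subrr (abs0 hv) ltW.
have Ynu : op_bound nu theta (fun x => x - Y x).
  have -> : (fun x => x - Y x) = (fun x => (- a) *: shift nu x).
    apply/funext => x; rewrite /Y.
    have -> : shift nu x = shift mu x - (nu - mu) *: x.
      by rewrite /shift scalerBl opprB addrA subrK.
    by move: (shift mu x) => s; rewrite scaleNr scalerBr scalerA mulVf// scale1r opprB.
  rewrite /theta mulrC -va -(absN hv); apply: op_scale; apply: op_shift => //.
  by rewrite subrr (abs0 hv) ltW.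
pose Z x := x - iter k Y x.
have Zb nu' : v (nu' - mu) <= rho -> op_bound nu' 1 Z.
  by move=> h; apply: op_sub (op_id _) _; have := op_iter k (Yb _ h); rewrite expr1n.
have YD x y : Y (x - y) = Y x - Y y by rewrite /Y -scalerBr -linearB.
have Znu n : op_bound nu theta (fun x => x - iter n Y x).
  elim: n => [|n IH] /=.
    have := op_le th0; apply; split=> // C y C0 hy j.
    rewrite subrr mul0r mul0r -[0 in X in sm _ X](scale0r (0 : X)) iter_shiftZ.
    by rewrite scale0r; exact: sm0.
  have -> : (fun x => x - Y (iter n Y x)) =
      (fun x => (x - Y x) + Y (x - iter n Y x)).
    by apply/funext => x; rewrite YD addrA subrK.
  apply: op_add Ynu _; have := op_comp (Yb _ (lexx _)) IH.
  by rewrite mul1r.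
have Zmu n : op_bound mu (theta ^+ k) (fun x => iter n Z x - x).
  elim: n => [|n IH] /=.
    have := op_le (exprn_ge0 k th0); apply; split=> // C y C0 hy j.
    rewrite subrr mul0r mul0r -[0 in X in sm _ X](scale0r (0 : X)) iter_shiftZ.
    by rewrite scale0r; exact: sm0.
  have -> : (fun x => Z (iter n Z x) - x) =
      (fun x => (iter n Z x - x) - iter k Y (iter n Z x)).
    by apply/funext => x; rewrite /Z addrAC.
  apply: op_sub IH _; have mumu : v (mu - mu) <= rho by rewrite subrr (abs0 hv) ltW.
  by have := op_comp (op_iter k Ymu) (op_iter n (Zb _ mumu)); rewrite expr1n mulr1.
exists (iter k Z); split.
- apply/adm_iter/adm_sub; first exact: adm_id.
  exact/adm_iter/adm_shift.
- by apply: op_le (Zmu k); exact: ltW.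
- by apply: op_le (op_iter k (Znu k)); exact: ltW.
- by move=> nu' h; have := op_iter k (Zb _ h); rewrite expr1n.
Qed.

(** The farthest centre is removed last: the operator that removes it does not
    enlarge the components at the other centres. *)
Let kill_all (s : seq K) eta : 0 < eta -> {in s, forall nu, eps < v (nu - mu)} ->
  sorted (fun nu nu' => v (nu' - mu) <= v (nu - mu)) s ->
  exists P, [/\ admissible P, op_bound mu eta (fun x => P x - x) &
    {in s, forall nu, op_bound nu eta P}].
Proof.
elim: s eta => [|nu s IH] eta eta0 s_far s_sorted.
  exists id; split=> //; split=> [|C y C0 hy j]; first exact: ltW.
  rewrite subrr -[0](scale0r (0 : X)) iter_shiftZ scale0r; apply: sm0.
  by rewrite mulr_ge0 ?exprn_ge0 ?mulr_ge0 ?(ltW eps0) ?(ltW eta0).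
have s_nu : {in s, forall nu', v (nu' - mu) <= v (nu - mu)}.
  apply/allP; apply: order_path_min s_sorted => x y z /= yx zy.
  exact: le_trans zy yx.
have [||P [admP Pmu Ps]] := IH eta eta0.
- by move=> nu' hnu'; apply: s_far; rewrite inE hnu' orbT.
- exact: path_sorted s_sorted.
have [PD PW Pb] := admP; have [c hc] := Pb nu; have c0 : 0 <= c by case: hc.
have c1 : 0 < c + 1 by rewrite ltr_wpDl.
have eta'0 : 0 < Num.min eta (eta / (c + 1)) by rewrite lt_min eta0 divr_gt0.
have [|Q [admQ Qmu Qnu Qs]] := @kill nu _ _ eta'0.
  by apply: s_far; rewrite inE eqxx.
exists (fun x => Q (P x)); split; first exact: adm_comp.
- have [QD _ _] := admQ.
  have -> : (fun x => Q (P x) - x) = (fun x => Q (P x - x) + (Q x - x)).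
    by apply/funext => x; rewrite addrA -QD subrK.
  apply: op_add; last by apply: op_le Qmu; rewrite ge_min lexx.
  have := op_comp (Qs mu _) Pmu; rewrite mul1r; apply.
  by rewrite subrr (abs0 hv) abs_ge0.
- move=> nu'; rewrite inE => /predU1P[->|nu's]; last first.
    by have := op_comp (Qs _ (s_nu _ nu's)) (Ps _ nu's); rewrite mul1r.
  apply: op_le (op_comp Qnu hc).
  apply: (@le_trans _ _ (eta / (c + 1) * c)).
    by rewrite ler_wpM2r// ge_min lexx orbT.
  by rewrite mulrAC ler_pdivrMr// ler_pM2l// lerDl.
Qed.

Lemma near_eigen_le nu C C' y : C <= C' -> near_eigen nu C y -> near_eigen nu C' y.
Proof.
by move=> CC' hy j; apply: sm_le (hy j); rewrite ler_wpM2r// exprn_ge0// ltW.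
Qed.

(** An admissible operator that is close to [1] near [mu] and small near the other
    centres maps the sum to an element of [W] close to [x0]. *)
Lemma near_eigen_separation (I : finType) (nu : I -> K) x0 (x : I -> X) :
  (exists2 C, 0 <= C & near_eigen mu C x0) ->
  (forall i, x i = 0 \/
    eps < v (nu i - mu) /\ exists2 C, 0 <= C & near_eigen (nu i) C (x i)) ->
  W (x0 + \sum_i x i) -> W x0.
Proof.
move=> [C0 C0_ge0 hx0] hx Wx.
have /choice[C CP] i : exists C, 0 <= C /\ (x i = 0 \/
    eps < v (nu i - mu) /\ near_eigen (nu i) C (x i)).
  by case: (hx i) => [->|[h [C c0 hC]]]; [exists 0; split=> //; left|exists C; split=> //; right].
pose D := \big[Num.max/C0]_i C i.
have D0 : 0 <= D by apply: le_trans C0_ge0 _; exact: bigmax_ge_id.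
have CD i : C i <= D by exact: le_bigmax.
have D1 : 0 < D + 1 by rewrite ltr_wpDl.
apply: W_closed => e e0; pose eta := e / (D + 1).
have eta0 : 0 < eta by rewrite divr_gt0.
pose far := [seq nu i | i <- enum I & eps < v (nu i - mu)].
pose lr (a b : K) := v (b - mu) <= v (a - mu).
have [||P [[PD PW _] Pmu Ps]] := kill_all (s := sort lr far) eta0.
- by move=> a; rewrite mem_sort => /mapP[i]; rewrite mem_filter => /andP[h _] ->.
- by apply: sort_sorted => a b; exact: le_total.
have P0 : P 0 = 0 by apply: (addrI (P 0)); rewrite -PD !addr0.
have PN a : P (- a) = - P a.
  by apply: (addrI (P a)); rewrite -PD !subrr P0.
exists (P (x0 + \sum_i x i)); first exact: PW.
have etaD : eta * D <= e.
  by rewrite /eta mulrAC ler_pdivrMr// ler_pM2l// lerDl.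
have smN c a : sm c a -> sm c (- a).
  by move=> /(smZ (-1)); rewrite (absN1 hv) mul1r scaleN1r.
have -> : x0 - P (x0 + \sum_i x i) = - (P x0 - x0) + - (\sum_i P (x i)).
  rewrite opprB PD opprD addrA; congr (_ - _).
  by apply: (big_morph P).
apply: smD; apply: smN.
  apply: sm_le etaD _; have [_ h] := Pmu.
  have := h D x0 D0 (near_eigen_le _ hx0) 0%N; rewrite expr0 mulr1; apply.
  exact: bigmax_ge_id.
elim/big_ind: _ => [|a b|i _]; [exact/sm0/ltW|exact: smD|].
have [_ [->|[hi xi]]] := CP i; first by rewrite P0; exact/sm0/ltW.
apply: sm_le etaD _; have [|_ h] := Ps (nu i).
  by rewrite mem_sort; apply/mapP; exists i; rewrite // mem_filter hi mem_enum.
have := h D _ D0 (near_eigen_le (CD i) xi) 0%N.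
by rewrite expr0 mulr1.
Qed.

End Separation.

(** * Convergent families *)

Section Summable.
Variables (Rl : realType) (K : fieldType) (v : K -> Rl).
Hypothesis hv : nonarch_abs v.
Variables (V : lmodType K) (N : V -> Rl).
Hypothesis hN : banach_space v N.
Let uN := banach_ultra hv hN.
Local Open Scope fset_scope.
Local Open Scope ring_scope.

(** The family [c] is indexed by all scalars, so that a weight vector of weight
    [l] is placed at the index [l]. *)
Definition has_sum (c : K -> V) (x : V) := forall e, 0 < e ->
  exists F0 : {fset K}, forall F : {fset K}, F0 `<=` F ->
    N (\sum_(l <- F) c l - x) < e.

Lemma has_sum_tail c x : has_sum c x -> forall e, 0 < e ->
  exists F0 : {fset K}, forall l, l \notin F0 -> N (c l) < e.
Proof.
move=> cx e e0; have [F0 h] := cx e e0; exists F0 => l lF0.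
have h1 := h _ (fsubset_refl F0); have h2 := h _ (fsubsetUr [fset l] F0).
rewrite big_fsetU1//= in h2; have := ultra_sublt uN h2 h1.
by rewrite opprB addrA subrK addrK.
Qed.

Lemma has_sum_bound c x C : 0 <= C -> has_sum c x -> (forall l, N (c l) <= C) ->
  N x <= C.
Proof.
move=> C0 cx cC; apply/ler_addgt0Pr => e e0; have [F0 h] := cx e e0.
have := h _ (fsubset_refl F0); set s := \sum_(l <- F0) c l => sx.
have sC : N s <= C by apply: (ultra_sumle uN).
rewrite -(subrK s x); apply: (ultra_addle uN).
  by rewrite (ultra_distC uN) (le_trans (ltW sx))// lerDr.
by apply: le_trans sC _; rewrite lerDl ltW.
Qed.

Lemma has_sum_family_bound c x : has_sum c x ->
  exists2 C, 0 <= C & forall l, N (c l) <= C.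
Proof.
move=> /has_sum_tail/(_ _ ltr01)[F0 h].
exists (\big[Num.max/1]_(l <- F0) N (c l)).
  by apply: le_trans (ler01) _; exact: bigmax_ge_id.
move=> l; have [lF|lF] := boolP (l \in F0); first exact: le_bigmax_seq.
by apply: le_trans (ltW (h l lF)) _; exact: bigmax_ge_id.
Qed.

Lemma has_sumB c c' x x' : has_sum c x -> has_sum c' x' ->
  has_sum (fun l => c l - c' l) (x - x').
Proof.
move=> cx cx' e e0; have [F0 h] := cx e e0; have [F1 h'] := cx' e e0.
exists (F0 `|` F1) => F; rewrite fsubUset => /andP[F0F F1F].
rewrite sumrB (_ : _ - _ - _ = (\sum_(l <- F) c l - x) - (\sum_(l <- F) c' l - x')).
  by apply: (ultra_sublt uN); [exact: h|exact: h'].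
by rewrite !opprB addrACA [RHS]addrACA; congr (_ + _)%R; rewrite addrC.
Qed.

Lemma has_sum0 : has_sum (fun=> 0) 0.
Proof. by move=> e e0; exists fset0 => F _; rewrite big1// subrr (ultra_0 uN). Qed.

Lemma has_sum_unique c x x' : has_sum c x -> has_sum c x' -> x = x'.
Proof.
move=> cx cx'; apply/eqP; rewrite -subr_eq0; apply/eqP/(ultra_small_eq0 uN) => e e0.
apply: has_sum_bound (ltW e0) (has_sumB cx cx') _ => l.
by rewrite subrr (ultra_0 uN) ltW.
Qed.

Lemma has_sumD c c' x x' : has_sum c x -> has_sum c' x' ->
  has_sum (fun l => c l + c' l) (x + x').
Proof.
move=> cx cx'; have := has_sumB cx (has_sumB has_sum0 cx'); rewrite sub0r opprK.
by congr has_sum; apply/funext => l; rewrite sub0r opprK.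
Qed.

Lemma has_sum_sum (I : finType) (c : I -> K -> V) x : (forall i, has_sum (c i) (x i)) ->
  has_sum (fun l => \sum_i c i l) (\sum_i x i).
Proof.
move=> cx.
rewrite (_ : (fun l => _) = fun l => \sum_(i <- enum I) c i l); last first.
  by apply/funext => l; rewrite big_enum.
rewrite -[X in has_sum _ X]big_enum /=.
elim: (enum I) => [|i s IH].
  rewrite big_nil (_ : (fun l => _) = fun=> 0); first exact: has_sum0.
  by apply/funext => l; rewrite big_nil.
rewrite big_cons (_ : (fun l => _) = fun l => c i l + \sum_(i <- s) c i l).
  exact: has_sumD.
by apply/funext => l; rewrite big_cons.
Qed.

Lemma has_sum_linear (f : {linear V -> V}) c x : (exists C, forall y, N (f y) <= C * N y) ->
  has_sum c x -> has_sum (fun l => f (c l)) (f x).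
Proof.
move=> [C hC] cx e e0; have C1 : 0 < Num.max C 1 by rewrite lt_max ltr01 orbT.
have [F0 h] := cx _ (divr_gt0 e0 C1); exists F0 => F /h {}h.
rewrite -linear_sum -linearB; apply: le_lt_trans (hC _) _.
apply: (@le_lt_trans _ _ (Num.max C 1 * N (\sum_(l <- F) c l - x))).
  by rewrite ler_wpM2r ?(ultra_ge0 uN)// le_max lexx.
by rewrite mulrC -ltr_pdivlMr.
Qed.

Lemma has_sum1 a x : has_sum (fun l => if l == a then x else 0) x.
Proof.
move=> e e0; exists [fset a] => F; rewrite fsub1set => aF.
rewrite (big_fsetD1 a)//= eqxx big_seq big1 ?addr0 ?subrr ?(ultra_0 uN)// => l.
by rewrite !inE => /andP[/negPf ->].
Qed.

(** In an ultrametric space a family is summable as soon as it tends to zero. *)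
Lemma has_sum_sub c x (P : set K) : has_sum c x ->
  exists y, has_sum (fun l => if `[< P l >] then c l else 0) y.
Proof.
move=> cx; pose c' l := if `[< P l >] then c l else 0.
change (exists y, has_sum c' y); have c'c l : N (c' l) <= N (c l).
  by rewrite /c'; case: ifP; rewrite ?(ultra_0 uN) ?(ultra_ge0 uN).
have /choice[F0 F0P] k : exists F0 : {fset K}, forall l, l \notin F0 -> N (c l) < k.+1%:R^-1.
  by apply: has_sum_tail cx _ _; rewrite invr_gt0 ltr0Sn.
have tail k (F : {fset K}) : F0 k `<=` F ->
    N (\sum_(l <- F) c' l - \sum_(l <- F0 k) c' l) < k.+1%:R^-1.
  move=> F0F; rewrite (big_fsetID _ (mem (F0 k)) F)/=.
  rewrite (_ : [fset x in F | x \in F0 k] = F0 k); last first.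
    apply/fsetP => l; rewrite !inE /= andbC.
    by case: (boolP (l \in F0 k)) => //= /(fsubsetP F0F) ->.
  rewrite addrAC subrr add0r big_seq; apply: (ultra_sumlt uN) => [|l].
    by rewrite invr_gt0 ltr0Sn.
  by rewrite !inE /= => /andP[_ /F0P h]; exact: le_lt_trans (c'c l) h.
pose G k := \bigcup_(i <- iota 0 k.+1) F0 i.
have F0G k m : (k <= m)%N -> F0 k `<=` G m.
  by move=> km; apply: (bigfcup_sup F0 (j := k)); rewrite // mem_iota.
have [y yP] : exists y, seq_lim N (fun k => \sum_(l <- G k) c' l) y.
  apply: (norm_complete hN) => e e0; have [k ke] := exists_inv_lt e0.
  exists k => m n km kn; apply: lt_trans ke.
  rewrite -(subrK (\sum_(l <- F0 k) c' l) (\sum_(l <- G m) c' l)) -addrA.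
  apply: (ultra_addlt uN); first by apply: tail; exact: F0G.
  by rewrite (ultra_distC uN); apply: tail; exact: F0G.
exists y => e e0; have [k ke] := exists_inv_lt e0; have [n0 hn0] := yP e e0.
exists (F0 k) => F F0F.
pose n := maxn k n0.
rewrite -(subrK (\sum_(l <- F0 k) c' l) (\sum_(l <- F) c' l)) -addrA.
apply: (ultra_addlt uN); first by apply: lt_trans ke; exact: tail.
rewrite -(subrK (\sum_(l <- G n) c' l) (\sum_(l <- F0 k) c' l)) -addrA.
apply: (ultra_addlt uN); last exact/hn0/leq_maxr.
by rewrite (ultra_distC uN); apply: lt_trans ke; apply: tail; exact/F0G/leq_maxl.
Qed.
End Summable.

Section AlgebraScalars.
Variables (Rl : realType) (K : fieldType) (v : K -> Rl).
Hypothesis hv : nonarch_abs v.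
Variables (RB : algType K) (N : RB -> Rl).
Hypothesis hB : banach_algebra v N.
Let bN : banach_space v N. Proof. by case: hB. Qed.
Let uN := banach_ultra hv bN.

Definition adjoint (d x : RB) := d * x - x * d.

Lemma adjoint_linear d : linear (adjoint d).
Proof.
move=> a x y; rewrite /adjoint mulrDr mulrDl opprD addrACA.
by rewrite -scalerAr -scalerAl scalerBr.
Qed.
HB.instance Definition _ d :=
  GRing.isLinear.Build K RB RB _ (adjoint d) (adjoint_linear d).

Lemma adjoint_bounded d : exists C, forall x, N (adjoint d x) <= C * N x.
Proof.
have [C C0 hC] := banach_mul_bound hv hB; exists (C * N d) => x.
apply: (ultra_suble uN); first exact: hC.
by apply: le_trans (hC _ _) _; rewrite mulrAC.
Qed.

Lemma shift_bounded (f : {linear RB -> RB}) nu :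
  (exists C, forall x, N (f x) <= C * N x) ->
  exists C, forall x, N (shift f nu x) <= C * N x.
Proof.
move=> [C hC]; exists (Num.max C (v nu)) => x; rewrite /shift.
apply: (ultra_suble uN).
  by apply: le_trans (hC x) _; rewrite ler_wpM2r ?(ultra_ge0 uN)// le_max lexx.
by rewrite (normZ bN) ler_wpM2r ?(ultra_ge0 uN)// le_max lexx orbT.
Qed.

(** [(f - t) ^ j] multiplies the term of eigenvalue [l] by [(l - t) ^ j]. *)
Lemma has_sum_near_eigen (f : {linear RB -> RB}) c x t (e C : Rl) :
  (exists C, forall x, N (f x) <= C * N x) ->
  (forall l, f (c l) = l *: c l) -> has_sum N c x ->
  0 < e -> 0 <= C -> (forall l, N (c l) <= C) ->
  (forall l, v (l - t) <= e \/ c l = 0) ->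
  forall j, N (iter j (shift f t) x) <= C * e ^+ j.
Proof.
move=> fb fc cx e0 C0 cC ct j.
have h : has_sum N (fun l => (l - t) ^+ j *: c l) (iter j (shift f t) x).
  elim: j => [|j IH].
    rewrite (_ : (fun l => _) = c)//; apply/funext => l.
    by rewrite expr0 scale1r.
  rewrite iterS (_ : (fun l => _) = fun l => shift f t ((l - t) ^+ j *: c l)).
    exact: (has_sum_linear hv bN) (shift_bounded t fb) IH.
  apply/funext => l; rewrite /shift linearZ /= fc !scalerA -scalerBl.
  by rewrite exprSr mulrBr [t * _]mulrC.
apply: (has_sum_bound hv bN _ h) => [|l].
  by apply: mulr_ge0 => //; exact/exprn_ge0/ltW.
rewrite (normZ bN) absX//.
have [lt|->] := ct l; last first.
  by rewrite (ultra_0 uN) mulr0; apply: mulr_ge0 => //; exact/exprn_ge0/ltW.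
by rewrite mulrC ler_pM ?exprn_ge0 ?(ultra_ge0 uN) ?abs_ge0// lerXn2r// nnegrE ?abs_ge0// ltW.
Qed.
End AlgebraScalars.

(** * Weight components of relations *)

Section WeightComponents.
Variables (Rl : realType) (K : fieldType) (v : K -> Rl) (p : nat).
Hypotheses (hv : nonarch_abs v) (hp : 0 < v p%:R <= 2^-1).
Hypothesis K_char0 : forall n, n.+1%:R != 0 :> K.

Lemma natr_inj_char0 (m n : nat) : m%:R = n%:R :> K -> m = n.
Proof.
wlog mn : m n / (m <= n)%N => [h|].
  by case: (leqP m n) => [/h//|/ltnW/h h' /esym/h' ->].
move=> /eqP; rewrite eq_sym -subr_eq0 -natrB//.
case E : (n - m)%N => [|k]; last by rewrite (negPf (K_char0 k)).
by move=> _; apply/eqP; rewrite eqn_leq mn -subn_eq0 E.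
Qed.

Lemma exists_nat_small (e : Rl) : 0 < e -> exists q, (0 < q)%N /\ v q%:R <= e.
Proof.
move=> e0; have [p0 p2] := andP hp.
have p1 : v p%:R < 1.
  by apply: le_lt_trans p2 _; rewrite invf_lt1 ?ltr1n.
have [|k hk] := @exists_expr_lt _ (v p%:R) e _ e0; first by rewrite ltW.
exists (p ^ k)%N; split; last by rewrite natrX absX// ltW.
by rewrite expn_gt0 lt0n; case: eqP p0 => // ->; rewrite (abs0 hv) ltxx.
Qed.

Variables (RB : algType K) (N : RB -> Rl).
Hypothesis hB : banach_algebra v N.
Let bN : banach_space v N. Proof. by case: hB. Qed.
Let uN := banach_ultra hv bN.

Variables (M : lmodType RB) (r : nat) (f : {linear 'rV[RB]_r -> M}).
Hypothesis f_surj : forall m, exists x, f x = m.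
Variables (d : RB).

Local Notation X := (restrict_scalars (in_alg RB) M).

Definition act (m : X) : X := d *: (m : M).
Fact act_linear : linear act.
Proof.
move=> a x y; rewrite /act scalerDr; congr (_ + _).
rewrite -[a *: x]/(a%:A *: (x : M)) -[RHS]/(a%:A *: (d *: (x : M))).
by rewrite !scalerA -scalerAl mul1r -scalerAr mulr1.
Qed.
HB.instance Definition _ := GRing.isLinear.Build K X X _ act act_linear.

(** The balls of the quotient norm of the presentation [f]. *)
Definition size_le (c : Rl) : set X := [set m | exists2 x, f x = m & row_norm N x <= c].

Let uR := row_norm_ultra hv hB r.

Lemma size_le0 c : 0 <= c -> size_le c 0.
Proof. by move=> c0; exists 0; rewrite ?linear0// (ultra_0 uR). Qed.
Lemma size_leD c x y : size_le c x -> size_le c y -> size_le c (x + y).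
Proof.
move=> [x' <- xc] [y' <- yc]; exists (x' + y'); first by rewrite linearD.
exact: (ultra_addle uR).
Qed.
Lemma size_leZ c a x : size_le c x -> size_le (v a * c) (a *: x).
Proof.
move=> [x' <- xc]; exists (a%:A *: x'); first by rewrite linearZ.
by rewrite (row_normZK hv hB) ler_wpM2l ?abs_ge0.
Qed.
Lemma size_le_mono c c' x : c <= c' -> size_le c x -> size_le c' x.
Proof. by move=> cc' [x' fx xc]; exists x' => //; exact: le_trans cc'. Qed.
Lemma size_le_scale (m : M) :
  exists2 D, 0 <= D & forall b, size_le (D * N b) (b *: m).
Proof.
have [C C0 hC] := row_normZ hv hB r; have [x <-] := f_surj m.
exists (C * row_norm N x) => [|b]; first by rewrite mulr_ge0 ?(ultra_ge0 uR)// ltW.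
exists (b *: x); first by rewrite linearZ.
by apply: le_trans (hC _ _) _; rewrite mulrAC.
Qed.

(** By the Leibniz rule, [act - (lam + t)] maps [b *: m] to the sum of the products in
    which [ad d - t] is applied to [b] or [act - lam] is applied to [m]; the latter
    operator is nilpotent on [m]. *)
Lemma near_eigen_product (eps : Rl) (t lam : K) k (m : X) : 0 < eps ->
  iter k (shift act lam) m = 0 ->
  exists2 D, 0 <= D & forall b C, 0 <= C ->
    (forall l, N (iter l (shift (adjoint d) t) b) <= C * eps ^+ l) ->
    near_eigen size_le act eps (lam + t) (D * C) (b *: (m : M) : X).
Proof.
move=> eps0; elim: k m => [|k IH] m.
  move=> /= ->; exists 0 => // b C _ _ j; rewrite mul0r mul0r.
  have -> : (b *: (0 : M) : X) = 0 by exact: (scaler0 M b).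
  by rewrite -(scale0r (0 : X)) iter_shiftZ scale0r; exact: size_le0.
rewrite iterSr => /IH[D' D'0 hD']; have [D1 D10 hD1] := size_le_scale m.
exists (Num.max D1 (D' / eps)); first by rewrite le_max D10.
move=> b C C0 hb j; elim: j b C C0 hb => [|j IHj] b C C0 hb.
  rewrite expr0 mulr1 /=; apply: size_le_mono (hD1 b).
  apply: (@le_trans _ _ (D1 * C)); last by rewrite ler_wpM2r// le_max lexx.
  by rewrite ler_wpM2l//; have := hb 0%N; rewrite expr0 mulr1.
have leib : shift act (lam + t) (b *: (m : M) : X) =
    ((shift (adjoint d) t b) *: (m : M) : X) + (b *: (shift act lam m : M) : X).
  rewrite /shift /act /adjoint.
  rewrite -[(lam + t) *: (_ : X)]/((lam + t)%:A *: (b *: (m : M))).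
  rewrite -[lam *: m]/(lam%:A *: (m : M)).
  have E : d * b - (lam + t) *: b = (d * b - b * d - t *: b) + b * (d - lam%:A).
    rewrite mulrBr -scalerAr mulr1 scalerDl opprD [in RHS]addrA.
    by rewrite [_ - t *: b + _]addrAC subrK addrA addrAC.
  transitivity ((d * b - (lam + t) *: b) *: (m : M)).
    rewrite [RHS]scalerBl !scalerA -scalerAl mul1r; congr (_ - _).
    exact: (scalerA d b m).
  by rewrite E scalerDl; congr (_ + _); rewrite -scalerA; congr (b *: _); rewrite scalerBl.
rewrite iterSr leib iter_shiftD; apply: size_leD.
  have -> : Num.max D1 (D' / eps) * C * eps ^+ j.+1 =
      Num.max D1 (D' / eps) * (C * eps) * eps ^+ j by rewrite exprS !mulrA.
  apply: IHj => [|l]; first by rewrite mulr_ge0// ltW.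
  by rewrite -iterSr -mulrA -exprS; exact: hb.
apply: size_le_mono (hD' b C C0 hb j).
rewrite exprS mulrA ler_wpM2r ?exprn_ge0 ?(ltW eps0)// mulrAC ler_wpM2r//.
by rewrite -ler_pdivrMr// le_max lexx orbT.
Qed.

Variable W : set M.
Hypothesis hW : is_submod W.
Hypothesis W_closed : norm_closed (@row_norm _ _ RB N r) [set x | W (f x)].
Variables (I : finType) (e : I -> M) (lam : I -> K).
Hypothesis he : forall i, exists k, iter k (shift act (lam i)) (e i) = 0.
Variables (c : I -> K -> RB) (a : I -> RB).
Hypothesis c_eigen : forall i t, adjoint d (c i t) = t *: c i t.
Hypothesis c_nat : forall i t, c i t = 0 \/ exists n : nat, t = n%:R.
Hypothesis c_sum : forall i, has_sum N (c i) (a i).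

Let W_small (m : M) :
  (forall t, 0 < t -> exists2 w, W w & size_le t (m - w)) -> W m.
Proof.
move=> hm; have [x xm] := f_surj m; rewrite -xm; apply: W_closed => t t0.
have [|w Ww [y fy yt]] := hm (t / 2); first by rewrite divr_gt0.
exists (x - y).
  by rewrite /= linearB xm fy opprB addrC subrK.
rewrite addrC addKr (ultraN uR); apply: le_lt_trans yt _.
by rewrite ltr_pdivrMr// ltr_pMr// ltr1n.
Qed.

Let WK : is_subspace (W : set X).
Proof.
have [W0 WD WZ] := hW; split=> // b x y Wx Wy; apply: (WD) => //; exact: WZ.
Qed.

(** The near part and the far parts of the [a i], the latter split according to
    the residue of the weight modulo a number [q] of small absolute value. *)
Let near_component mu (eps : Rl) : 0 < eps -> W (\sum_i a i *: e i) ->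
  forall b, (forall i, has_sum N
    (fun t => if `[< v (lam i + t - mu) <= eps >] then c i t else 0) (b i)) ->
  W (\sum_i b i *: e i).
Proof.
move=> eps0 Wa b b_sum; have [q [q0 vq]] := exists_nat_small eps0.
pose far i (s : 'I_q) t := eps < v (lam i + t - mu) /\
  exists n : nat, t = n%:R /\ (n %% q = s)%N.
have /choice[b' b'P] (z : I * 'I_q) : exists b', has_sum N
    (fun t => if `[< far z.1 z.2 t >] then c z.1 t else 0) b'.
  exact: (has_sum_sub hv bN).
have aE i : a i = b i + \sum_(s < q) b' (i, s).
  apply: (has_sum_unique hv bN (c_sum i)).
  have := has_sumD hv bN (b_sum i) (has_sum_sum hv bN (fun s => b'P (i, s))).
  congr has_sum; apply/funext => t /=.
  have [->|[n tn]] := c_nat i t.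
    by rewrite if_same add0r big1// => s _; rewrite if_same.
  case: (leP (v (lam i + t - mu)) eps) => h.
    rewrite asboolT// big1 ?addr0// => s _; rewrite asboolF// => -[].
    by rewrite ltNge h.
  rewrite asboolF ?add0r//.
  rewrite (bigD1 (Ordinal (ltn_pmod n q0)))//= asboolT; last by split=> //; exists n.
  rewrite big1 ?addr0// => s sn; rewrite asboolF// => -[_ [n' [tn' n's]]].
  move: sn; rewrite -val_eqE /= -n's; rewrite tn in tn'.
  by rewrite (natr_inj_char0 tn') eqxx.
have cb i : exists2 C, 0 <= C & forall t, N (c i t) <= C.
  exact: (has_sum_family_bound hv bN (c_sum i)).
have near_eigen_term i t0 (P : set K) b0 :
    has_sum N (fun t => if `[< P t >] then c i t else 0) b0 ->
    (forall t, P t -> c i t != 0 -> v (t - t0) <= eps) ->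
    exists2 C, 0 <= C & near_eigen size_le act eps (lam i + t0) C (b0 *: e i : X).
  move=> b0_sum Pt0; have [C C0 hC] := cb i; have [k hk] := he i.
  have [D D0 hD] := near_eigen_product t0 eps0 hk.
  exists (D * C); first exact: mulr_ge0.
  apply: hD => // l; apply: (has_sum_near_eigen hv hB _ _ b0_sum) => //.
  - exact: (adjoint_bounded hv hB d).
  - by move=> t; case: ifP => _ /=; rewrite ?c_eigen // /adjoint mulr0 mul0r subrr scaler0.
  - by move=> t; case: ifP => // _; rewrite (ultra_0 uN).
  - move=> t; case: (asboolP (P t)) => [Pt|_]; last by right.
    by have [->|h] := eqVneq (c i t) 0; [right|left; exact: Pt0].
pose x0 : X := \sum_i b i *: e i.
pose x (z : I * 'I_q) : X := b' z *: e z.1.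
pose nu (z : I * 'I_q) := lam z.1 + z.2%:R.
apply: (@near_eigen_separation _ _ v hv X size_le size_le0 size_leD size_leZ
  size_le_mono act W WK _ W_small eps eps0 mu _ nu x0 x).
- by move=> m Wm; have [_ _ WZ] := hW; exact: WZ.
- have /choice[C CP] i : exists C, 0 <= C /\
      near_eigen size_le act eps mu C (b i *: e i : X).
    have [|C C0 hC] := near_eigen_term i (mu - lam i) _ _ (b_sum i).
      by move=> t h _; rewrite opprB addrCA addrA.
    by exists C; rewrite addrC subrK in hC.
  exists (\big[Num.max/0]_i C i); first exact: bigmax_ge_id.
  move=> j; rewrite /x0.
  rewrite (big_morph (iter j (shift act mu)) (iter_shiftD act mu j) (id1 := 0)); last first.
    by have := iter_shiftZ act mu j 0 0; rewrite !scale0r.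
  elim/big_ind: _ => [|y y' hy hy'|i _].
  + apply: size_le0; rewrite mulr_ge0 ?exprn_ge0 ?(ltW eps0)//; exact: bigmax_ge_id.
  + exact: size_leD.
  + have [_ h] := CP i; apply: size_le_mono (h j).
    by rewrite ler_wpM2r ?exprn_ge0 ?(ltW eps0)//; exact: le_bigmax.
- case=> i s; rewrite /nu /x /=.
  have close t : far i s t -> v (t - s%:R) <= eps.
    move=> [_ [n [-> <-]]]; rewrite {1}(divn_eq n q) natrD addrK natrM.
    by rewrite (absM hv) -[leRHS]mul1r ler_pM ?abs_ge0// abs_nat.
  have [h|h] := ltP eps (v (lam i + s%:R - mu)).
    right; split=> //; apply: near_eigen_term (b'P (i, s)) _ => t ft _.
    exact: close ft.
  left; rewrite (_ : b' (i, s) = 0) ?scale0r//.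
  apply: (has_sum_unique hv bN (b'P (i, s))).
  rewrite (_ : (fun t => _) = fun=> 0); first exact: (has_sum0 hv bN).
  apply/funext => t /=; case: asboolP => // ft.
  have := close _ ft; have [ft1 _] := ft; move=> h'.
  have : v (lam i + t - mu) <= eps.
    rewrite (_ : _ - mu = (lam i + s%:R - mu) + (t - s%:R)).
      exact: (ultra_addle (abs_ultra hv)).
    by ring.
  by rewrite leNgt ft1.
- rewrite /x0 /x; suff <- : \sum_i a i *: e i =
      \sum_i b i *: e i + \sum_(z : I * 'I_q) b' z *: e z.1 by [].
  have -> : \sum_(z : I * 'I_q) b' z *: e z.1 =
      \sum_i \sum_(s < q) b' (i, s) *: e i.
    by rewrite pair_big; apply: eq_bigr => -[].
  rewrite -big_split /=; apply: eq_bigr => i _.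
  by rewrite {1}aE scalerDl scaler_suml.
Qed.

(** The main analytic step: a closed submodule contains the weight components of its
    elements, although infinitely many weights occur, which may accumulate at [mu].
    The terms whose weights are [eps]-close to [mu] sum to an approximate weight
    vector, and the other terms fall into finitely many approximate weight vectors,
    as the weights are natural numbers shifted by the [lam i] and natural numbers in
    the same class modulo [q] are [eps]-close; [near_component] separates them. As
    [eps] tends to zero, the near part tends to the component of weight [mu]. *)
Lemma weight_component mu :
  W (\sum_i a i *: e i) -> W (\sum_i c i (mu - lam i) *: e i).
Proof.
move=> Wa; apply: W_small => t t0.
have /choice[D DP] i : exists D, 0 <= D /\ forall b, size_le (D * N b) (b *: e i).
  by have [D D0 hD] := size_le_scale (e i); exists D.
pose D1 := \big[Num.max/1]_i D i.
have D10 : 0 < D1 by apply: lt_le_trans ltr01 _; exact: bigmax_ge_id.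
have eta0 : 0 < t / D1 by rewrite divr_gt0.
have /choice[F FP] i : exists F : {fset K}, forall l, l \notin F -> N (c i l) < t / D1.
  exact: (has_sum_tail hv bN (c_sum i) eta0).
pose eps := 2^-1 * \big[Num.min/1]_i \big[Num.min/1]_(l <- F i | l != mu - lam i)
  v (lam i + l - mu).
have dist0 i l : l != mu - lam i -> 0 < v (lam i + l - mu).
  move=> h; rewrite abs_gt0//; apply: contra h; rewrite subr_eq0 => /eqP <-.
  by rewrite addrC addKr.
have eps0 : 0 < eps.
  rewrite mulr_gt0 ?invr_gt0// lt_bigmin// => i _.
  by rewrite lt_bigmin// => l; exact: dist0.
have epsP i l : l \in F i -> l != mu - lam i -> eps < v (lam i + l - mu).
  move=> lF lmu; set u := v _; have u0 : 0 < u by exact: dist0.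
  apply: (@le_lt_trans _ _ (2^-1 * u)).
    rewrite ler_wpM2l ?invr_ge0//; apply: (bigmin_inf i) => //.
    exact: ge_bigmin_seq.
  by rewrite mulrC ltr_pdivrMr// ltr_pMr// ltr1n.
have /choice[b bP] i : exists b, has_sum N
    (fun t => if `[< v (lam i + t - mu) <= eps >] then c i t else 0) b.
  exact: (has_sum_sub hv bN).
exists (\sum_i b i *: e i); first exact: near_component bP.
rewrite -sumrB; elim/big_ind: _ => [|x y|i _]; first exact/size_le0/ltW.
  exact: size_leD.
rewrite -scalerBl; have [Di0 hD] := DP i; apply: size_le_mono (hD _).
apply: (@le_trans _ _ (D1 * (t / D1))); last by rewrite mulrCA mulfV ?mulr1 ?gt_eqF.
apply: ler_pM => //; [exact: (ultra_ge0 uN)|exact: le_bigmax|].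
have h := has_sumB hv bN (has_sum1 hv bN (mu - lam i) (c i (mu - lam i))) (bP i).
apply: (has_sum_bound hv bN _ h) => [|l]; first exact: ltW.
have [->|lmu] := eqVneq l (mu - lam i).
  rewrite asboolT; first by rewrite subrr (ultra_0 uN) ltW.
  by rewrite addrCA subrr addr0 subrr (abs0 hv) ltW.
rewrite sub0r (ultraN uN); case: asboolP => [le|_]; last by rewrite (ultra_0 uN) ltW.
have [lF|/FP/ltW//] := boolP (l \in F i).
by have := epsP i l lF lmu; rewrite ltNge le.
Qed.

End WeightComponents.

(** * Homogeneous components of convergent sums *)

Section GradedCoefficients.
Variables (Rl : realType) (K : fieldType) (v : K -> Rl) (pi : K).
Hypotheses (hv : nonarch_abs v) (v_complete : complete_for v).
Hypothesis hpi : 0 < v pi <= 2^-1.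
Hypothesis K_char0 : forall n, n.+1%:R != 0 :> K.
Variables (V : lmodType K) (N : V -> Rl).
Hypothesis hN : banach_space v N.
Let uN := banach_ultra hv hN.
Variable f : {linear V -> V}.
Hypothesis f_bounded : exists C, forall x, N (f x) <= C * N x.

(** The binomial polynomial [X (X - 1) .. (X - k + 1) / k!] at [X = f - t]. *)
Fixpoint binomial_op (t : K) (k : nat) (y : V) : V :=
  if k is k'.+1 then k%:R^-1 *: shift f (t + k'%:R) (binomial_op t k' y) else y.

Lemma binomial_op_linear t k : linear (binomial_op t k).
Proof.
elim: k => [//|k IH] a x y; rewrite [LHS]/= IH.
by rewrite (shift_linear f) scalerDr !scalerA mulrC.
Qed.
HB.instance Definition _ t k :=
  GRing.isLinear.Build K V V _ (binomial_op t k) (binomial_op_linear t k).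

Lemma binomial_op_bounded t k : exists C, forall x, N (binomial_op t k x) <= C * N x.
Proof.
elim: k => [|k [C hC]]; first by exists 1 => x; rewrite mul1r.
have [D hD] := f_bounded.
have D0 : 0 <= Num.max (Num.max D (v (t + k%:R))) 0 by rewrite le_max lexx orbT.
exists (v k.+1%:R^-1 * (Num.max (Num.max D (v (t + k%:R))) 0 * C)) => x /=.
rewrite (normZ hN) -mulrA ler_wpM2l ?abs_ge0// -mulrA.
apply: le_trans (_ : Num.max (Num.max D (v (t + k%:R))) 0 * N (binomial_op t k x) <= _).
  rewrite /shift; apply: (ultra_suble uN).
    by apply: le_trans (hD _) _; rewrite ler_wpM2r ?(ultra_ge0 uN)// !le_max lexx.
  by rewrite (normZ hN) ler_wpM2r ?(ultra_ge0 uN)// !le_max lexx orbT.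
by rewrite ler_wpM2l.
Qed.

Lemma binomial_op_eigen t k m y : f y = (t + m%:R) *: y ->
  binomial_op t k y = 'C(m, k)%:R *: y.
Proof.
move=> fy; elim: k => [|k IH]; first by rewrite bin0 scale1r.
rewrite /= IH /shift linearZ /= fy !scalerA -scalerBl scalerA; congr (_ *: _).
have k0 := K_char0 k; apply: (mulfI k0); rewrite mulrA mulfV// mul1r -natrM mul_bin_left.
case: (leqP k m) => km; first by rewrite natrM natrB//; ring.
by rewrite bin_small// muln0; ring.
Qed.

Lemma binomial_op_eigenN1 t k y : f y = (t - 1) *: y ->
  binomial_op t k y = (-1) ^+ k *: y.
Proof.
move=> fy; elim: k => [|k IH]; first by rewrite expr0 scale1r.
rewrite /= IH /shift linearZ /= fy !scalerA -scalerBl scalerA; congr (_ *: _).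
have k0 := K_char0 k; apply: (mulfI k0); rewrite mulrA mulfV// mul1r exprS -natr1.
by ring.
Qed.

Variables (X : set V) (Xn : nat -> set V).
Hypotheses (hX : is_subspace X) (X_closed : norm_closed N X).
Hypothesis hXn : forall n, is_subspace (Xn n).
Hypothesis XnX : forall n, Xn n `<=` X.
Hypothesis f_Xn : forall n x, Xn n x -> f x = n%:R *: x.

Definition graded_sum (c : K -> V) (x : V) := [/\ has_sum N c x,
  forall n : nat, Xn n (c n%:R) & forall l, c l = 0 \/ exists n : nat, l = n%:R].

Hypothesis X_sum : forall x, X x -> exists c, graded_sum c x.

(** Equals [1] up to sign on weight [n], [0] on the other weights up to [n + s],
    and is an integer on all larger weights. *)
Let extract n s : {linear V -> V} := binomial_op n.+1%:R s \o binomial_op 0 n.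

Let extract_lt n s m y : Xn m y -> m != n -> (m <= n + s)%N -> extract n s y = 0.
Proof.
move=> /f_Xn fy mn ms; rewrite /extract /=.
rewrite (@binomial_op_eigen 0 n m) ?add0r//.
case: (ltnP m n) => mn'; first by rewrite bin_small// scale0r linear0.
have {mn mn'} nm : (n < m)%N by rewrite ltn_neqAle eq_sym mn.
rewrite linearZ /= (@binomial_op_eigen n.+1%:R s (m - n.+1)); last first.
  by rewrite -natrD subnKC.
rewrite (@bin_small (m - n.+1) s) ?scale0r ?scaler0//.
by rewrite -(ltn_add2l n.+1) subnKC// addSn ltnS.
Qed.

Let extract_eq n s y : Xn n y -> extract n s y = (-1) ^+ s *: y.
Proof.
move=> /f_Xn fy; rewrite /extract /= (@binomial_op_eigen 0 n n) ?add0r//.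
rewrite binn scale1r binomial_op_eigenN1// fy; congr (_ *: _).
by rewrite -natr1 addrK.
Qed.

Let extract_le n s m y : Xn m y -> N (extract n s y) <= N y.
Proof.
move=> Xy; have fy := f_Xn Xy.
have [mn|mn] := eqVneq m n.
  rewrite mn in Xy; rewrite extract_eq// (normZ hN) absX// absN1// expr1n.
  by rewrite mul1r.
case: (leqP m (n + s)) => ms.
  by rewrite (extract_lt Xy)// (ultra_0 uN) (ultra_ge0 uN).
rewrite /extract /= (@binomial_op_eigen 0 n m) ?add0r// linearZ /=.
rewrite (@binomial_op_eigen n.+1%:R s (m - n.+1)); last first.
  by rewrite -natrD subnKC// (leq_ltn_trans _ ms)// leq_addr.
rewrite scalerA -natrM (normZ hN) ler_piMl ?(ultra_ge0 uN)//.
exact: abs_nat.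
Qed.

(** The operators [extract n s] do not enlarge the terms of an expansion, as binomial
    coefficients are integers; so they are pointwise bounded in [s], hence uniformly
    bounded, and for large [s] the value of [extract n s] at [x] is the term of
    weight [n] up to sign and a small error. *)
Lemma graded_coefficient_bound n : exists2 C, 0 <= C &
  forall c x, X x -> graded_sum c x -> N (c n%:R) <= C * N x.
Proof.
have terms s c x l : graded_sum c x -> N (extract n s (c l)) <= N (c l).
  move=> [_ cn c0]; case: (c0 l) => [->|[m ->]]; first by rewrite linear0.
  exact: extract_le (cn m).
have eb s : exists C, forall y, N (extract n s y) <= C * N y.
  have [C hC] := binomial_op_bounded n.+1%:R s.
  have [D hD] := binomial_op_bounded 0 n.
  exists (Num.max C 0 * D) => y; rewrite /extract /= -mulrA.
  apply: le_trans (hC _) _; apply: le_trans (_ : Num.max C 0 * N (binomial_op 0 n y) <= _).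
    by rewrite ler_wpM2r ?(ultra_ge0 uN)// le_max lexx.
  by rewrite ler_wpM2l// le_max lexx orbT.
have [|C C0 hC] := uniform_boundedness hv hpi hN (T := extract n) hX X_closed eb.
  move=> x /X_sum[c gs]; have [cx _ _] := gs.
  have [C C0 hC] := has_sum_family_bound hv hN cx.
  exists C => s; apply: (has_sum_bound hv hN C0 (has_sum_linear hv hN (eb s) cx)) => l.
  exact: le_trans (terms s c x l gs) (hC l).
exists C => // c x Xx gs; have [cx cn c0] := gs.
apply/ler_addgt0Pr => e e0; have [F FP] := has_sum_tail hv hN cx e0.
have /choice[deg degP] (l : K) : exists m, forall n' : nat, l = n'%:R -> m = n'.
  have [[m ->]|nl] := pselect (exists m : nat, l = m%:R).
    by exists m => n'; exact: natr_inj_char0.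
  by exists 0%N => n' ln'; case: nl; exists n'.
pose s := (\max_(l <- F) deg l)%N.
have hs := has_sumB hv hN (has_sum1 hv hN n%:R ((-1) ^+ s *: c n%:R))
  (has_sum_linear hv hN (eb s) cx).
have : N ((-1) ^+ s *: c n%:R - extract n s x) <= e.
  apply: (has_sum_bound hv hN (ltW e0) hs) => l.
  have [->|ln] := eqVneq l n%:R.
    by rewrite extract_eq// subrr (ultra_0 uN) ltW.
  rewrite sub0r (ultraN uN); have [lF|/FP/ltW] := boolP (l \in F); last first.
    exact: le_trans (terms _ _ _ _ gs).
  case: (c0 l) => [->|[m lm]]; first by rewrite linear0 (ultra_0 uN) ltW.
  rewrite lm (extract_lt (cn m)) ?(ultra_0 uN) ?(ltW e0)//.
    by apply: contra ln => /eqP <-; rewrite lm.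
  rewrite (leq_trans _ (leq_addl _ _))// -(degP l m lm).
  exact: leq_bigmax_seq.
move=> le; have -> : N (c n%:R) = N ((-1) ^+ s *: c n%:R).
  by rewrite (normZ hN) absX// absN1// expr1n mul1r.
rewrite -(subrK (extract n s x) (_ *: _)); apply: (ultra_addle uN).
  by apply: le_trans le _; rewrite lerDr mulr_ge0// (ultra_ge0 uN).
by apply: le_trans (hC _ _ Xx) _; rewrite lerDl ltW.
Qed.

Let coef x := if pselect (X x) is left Xx then sval (cid (X_sum Xx)) else fun=> 0.
Let coefP x : X x -> graded_sum (coef x) x.
Proof. by rewrite /coef => Xx; case: pselect => // Xx'; exact: (svalP (cid (X_sum Xx'))). Qed.

Let graded_sum_unique c c' x n : X x -> graded_sum c x -> graded_sum c' x ->
  c n%:R = c' n%:R.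
Proof.
move=> Xx [cx cn c0] [cx' cn' c0']; have [C C0 hC] := graded_coefficient_bound n.
apply/eqP; rewrite -subr_eq0; apply/eqP/(ultra_eq0 uN)/eqP.
rewrite eq_le (ultra_ge0 uN) andbT.
have := hC (fun l => c l - c' l) 0; rewrite (ultra_0 uN) mulr0; apply.
  by case: hX.
split=> [|m|l]; first by have := has_sumB hv hN cx cx'; rewrite subrr.
  exact: is_subspaceB.
case: (c0 l) => [->|]; last by right.
by case: (c0' l) => [->|]; [left; rewrite subrr|right].
Qed.

Lemma graded_sum_homogeneous m y : Xn m y ->
  graded_sum (fun l => if l == m%:R then y else 0) y.
Proof.
move=> Xy; split=> [|n|l]; first exact: (has_sum1 hv hN).
  case: eqP => [/(natr_inj_char0 K_char0) ->//|_].
  by case: (hXn n).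
by case: eqP => [->|_]; [right; exists m|left].
Qed.

(** The homogeneous components are bounded by [graded_coefficient_bound], and lie in
    finite-dimensional spaces, on which [fin_dim_bounded_coords] applies. *)
Lemma graded_coordinates n :
  (forall m, exists r (g : 'I_r -> V), Xn m =
    [set y | exists c : 'I_r -> K, y = \sum_i c i *: g i]) ->
  exists (I : finType) (x : I -> V) (xi : I -> V -> K),
  [/\ forall i, exists m, Xn m (x i),
      forall i a y z, X y -> X z -> xi i (a *: y + z) = a * xi i y + xi i z,
      forall i, exists C, forall y, X y -> v (xi i y) <= C * N y,
      forall m y, (m <= n)%N -> Xn m y -> y = \sum_i xi i y *: x i &
      forall m y, (n < m)%N -> Xn m y -> forall i, xi i y = 0].
Proof.
move=> Xn_fin.
have coefE m m' y : Xn m' y -> coef y m%:R = if m == m' then y else 0.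
  move=> Xy; have Xy' := XnX Xy.
  rewrite (graded_sum_unique m Xy' (coefP Xy') (graded_sum_homogeneous Xy)).
  have [->|mm'] := eqVneq m m'; first by rewrite eqxx.
  by case: eqP => // /(natr_inj_char0 K_char0) mm'E; rewrite mm'E eqxx in mm'.
have coefL m a y z : X y -> X z -> coef (a *: y + z) m%:R = a *: coef y m%:R + coef z m%:R.
  move=> Xy Xz; have Xayz : X (a *: y + z) by have [_] := hX; apply.
  apply: (@graded_sum_unique _ (fun l => a *: coef y l + coef z l) _ m Xayz (coefP Xayz)).
  have [ys yn y0] := coefP Xy; have [zs zn z0] := coefP Xz.
  split=> [|k|l].
  - have aB : exists C, forall x, N (a *: x) <= C * N x.
      by exists (v a) => x; rewrite (normZ hN).
    exact: (has_sumD hv hN (has_sum_linear hv hN (f := *:%R a) aB ys) zs).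
  - by have [_] := hXn k; apply.
  - case: (y0 l) => [->|]; last by right.
    by case: (z0 l) => [->|]; [left; rewrite scaler0 addr0|right].
have one m : exists (I : finType) (x : I -> V) (xi : I -> V -> K),
  [/\ forall i, exists m, Xn m (x i),
      forall i a y z, X y -> X z -> xi i (a *: y + z) = a * xi i y + xi i z,
      forall i, exists C, forall y, X y -> v (xi i y) <= C * N y,
      forall y, Xn m y -> y = \sum_i xi i y *: x i &
      forall m' y, m' != m -> Xn m' y -> forall i, xi i y = 0].
  have [r [g gE]] := Xn_fin m.
  have [I [x [xi]]] := fin_dim_bounded_coords hv v_complete hN g.
  rewrite -gE => -[xX xiL xiB xiE].
  have Xm y : X y -> Xn m (coef y m%:R) by move=> Xy; have [_ + _] := coefP Xy; apply.
  have xi0 i : xi i 0 = 0.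
    have X0 : Xn m 0 by case: (hXn m).
    by have := xiL i (-1) _ _ X0 X0; rewrite scaler0 add0r mulN1r addNr.
  exists I, x, (fun i y => xi i (coef y m%:R)); split.
  - by move=> i; exists m.
  - by move=> i a y z Xy Xz; rewrite coefL// xiL//; exact: Xm.
  - move=> i; have [C hC] := xiB i; have [D D0 hD] := graded_coefficient_bound m.
    exists (Num.max C 0 * D) => y Xy; apply: le_trans (hC _ (Xm _ Xy)) _.
    rewrite -mulrA; apply: le_trans (_ : Num.max C 0 * N (coef y m%:R) <= _).
      by rewrite ler_wpM2r ?(ultra_ge0 uN)// le_max lexx.
    rewrite ler_wpM2l ?le_max ?lexx ?orbT//.
    exact: hD (coefP Xy).
  - move=> y Xy; rewrite {1}(xiE _ Xy); apply: eq_bigr => i _.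
    by rewrite (coefE _ _ _ Xy) eqxx.
  - move=> m' y mm' Xy i.
    by rewrite (coefE _ _ _ Xy) eq_sym (negPf mm').
elim: n => [|n [I [x [xi [xX xiL xiB xiE xi0]]]]].
  have [I [x [xi [xX xiL xiB xiE xi0]]]] := one 0%N.
  exists I, x, xi; split=> // [m y|m y m0 Xy].
    by rewrite leqn0 => /eqP ->; exact: xiE.
  by apply: xi0 Xy; rewrite -lt0n.
have [I' [x' [xi' [xX' xiL' xiB' xiE' xi0']]]] := one n.+1.
exists (I + I')%type, (fun i => match i with inl i => x i | inr i => x' i end).
exists (fun i => match i with inl i => xi i | inr i => xi' i end); split.
- by case.
- by case.
- by case.
- move=> m y; rewrite leq_eqVlt big_sumType /= => /predU1P[->|mn] Xy.
    rewrite big1 ?add0r => [|i _]; first exact: xiE'.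
    by rewrite (xi0 n.+1) ?scale0r.
  rewrite [X in _ + X]big1 ?addr0 => [|i _]; first exact: xiE Xy.
  by rewrite (xi0' m) ?scale0r// neq_ltn mn.
- move=> m y nm Xy [i|i]; first by apply: xi0 Xy _; exact: ltnW.
  by apply: xi0' Xy _; rewrite neq_ltn nm orbT.
Qed.

End GradedCoefficients.

(** * Generalized eigenvectors *)

Section Sums.
Variable V : zmodType.

Lemma sums0 (X : set V) : sums X 0.
Proof. by exists [::]; rewrite ?big_nil. Qed.

Lemma sums1 (X : set V) x : X x -> sums X x.
Proof.
by move=> Xx; exists [:: x]; rewrite ?big_seq1// => y; rewrite inE => /eqP ->.
Qed.

Lemma sumsD (X : set V) x y : sums X x -> sums X y -> sums X (x + y).
Proof.
move=> [s sX ->] [t tX ->]; exists (s ++ t); last by rewrite big_cat.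
by move=> z; rewrite mem_cat => /orP[/sX|/tX].
Qed.

Lemma sums_sum (X : set V) (I : Type) (s : seq I) (P : pred I) (F : I -> V) :
  (forall i, P i -> sums X (F i)) -> sums X (\sum_(i <- s | P i) F i).
Proof.
move=> XF; apply: (big_ind (sums X)) => //; first exact: sums0.
by move=> x y; exact: sumsD.
Qed.

Lemma sums_ord (X : set V) x : sums X x ->
  exists k (y : 'I_k -> V), (forall i, X (y i)) /\ x = \sum_i y i.
Proof.
move=> [s sX ->]; exists (size s), (fun i => tnth (in_tuple s) i); split=> [i|].
  by apply: sX; exact: mem_tnth.
by rewrite -(big_tuple _ _ _ predT id).
Qed.

End Sums.

Lemma sums_bind (V W : zmodType) (X : set V) (Y : set W) (f : V -> W) x :
  f 0 = 0 -> (forall a b, f (a + b) = f a + f b) ->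
  sums X x -> (forall y, X y -> sums Y (f y)) -> sums Y (f x).
Proof.
move=> f0 fD [s sX ->] XY; elim: s sX => [|y s IH] sX.
  by rewrite big_nil f0; exact: sums0.
rewrite big_cons fD; apply: sumsD; first by apply/XY/sX; rewrite inE eqxx.
by apply: IH => z zs; apply: sX; rewrite inE zs orbT.
Qed.

Lemma sums_sub (V : zmodType) (X Y : set V) x : (forall y, X y -> sums Y y) -> sums X x -> sums Y x.
Proof. by move=> XY Xx; exact: (@sums_bind _ _ X Y id). Qed.

Section GeneralizedEigenspaces.
Variables (K : fieldType) (V : lmodType K) (T : {linear V -> V}).

Definition gen_eigen (nu : K) : set V := [set x | exists k, iter k (shift T nu) x = 0].

Lemma iter_shift0 nu k : iter k (shift T nu) 0 = 0.
Proof. by have := iter_shiftZ T nu k 0 0; rewrite !scale0r. Qed.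

Lemma iter_shift_ge nu k l x : (k <= l)%N -> iter k (shift T nu) x = 0 ->
  iter l (shift T nu) x = 0.
Proof. by move=> /subnK <- h; rewrite iterD h iter_shift0. Qed.

Lemma gen_eigenP nu x : gen_eigen nu x <-> exists n0, forall n, (n0 <= n)%N ->
  iter n (fun y => T y - nu *: y) x = 0.
Proof.
split=> [[k hk]|[n0 h]]; first by exists k => n kn; exact: iter_shift_ge hk.
by exists n0; exact: h.
Qed.

Lemma gen_eigen_subspace nu : is_subspace (gen_eigen nu).
Proof.
split=> [|a x y [k hk] [l hl]]; first by exists 0%N.
exists (k + l)%N; rewrite iter_shiftD iter_shiftZ.
by rewrite (iter_shift_ge (leq_addr _ _) hk) (iter_shift_ge (leq_addl _ _) hl)
  scaler0 addr0.
Qed.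

Lemma shiftC nu mu x : shift T nu (shift T mu x) = shift T mu (shift T nu x).
Proof.
have -> : shift T mu x = T x - mu *: x by [].
rewrite addrC -scaleNr shift_linear scaleNr addrC.
have -> : shift T mu (shift T nu x) = T (shift T nu x) - mu *: shift T nu x by [].
by congr (_ - _); rewrite /shift linearB [in RHS]linearZ /=.
Qed.

Lemma iter_shiftC nu mu k x :
  iter k (shift T nu) (shift T mu x) = shift T mu (iter k (shift T nu) x).
Proof. by elim: k => //= k ->; rewrite shiftC. Qed.

Lemma gen_eigen_shift nu mu x : gen_eigen nu x -> gen_eigen nu (shift T mu x).
Proof. by move=> [k hk]; exists k; rewrite iter_shiftC hk linear0. Qed.

Lemma shift_diff nu mu x : shift T mu x = shift T nu x + (nu - mu) *: x.
Proof. by rewrite /shift scalerBl addrA subrK. Qed.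

Lemma gen_eigen_solve nu mu y : nu != mu -> gen_eigen nu y ->
  exists2 x, gen_eigen nu x & shift T mu x = y.
Proof.
move=> numu [k]; elim: k y => [|k IH] y /=.
  by move=> ->; exists 0; [exists 0%N|exact: linear0].
rewrite -iterS iterSr => hk.
have numu0 : nu - mu != 0 by rewrite subr_eq0.
have [|x hx xE] := IH (- (nu - mu)^-1 *: shift T nu y).
  by rewrite iter_shiftZ hk scaler0.
exists ((nu - mu)^-1 *: y + x).
  have hy : gen_eigen nu y by exists k.+1; rewrite iterSr.
  by have [_] := gen_eigen_subspace nu; apply.
rewrite shift_linear xE (shift_diff nu mu y); move: (shift T nu y) => z.
rewrite scalerDr scalerA mulVf// scale1r.
by rewrite scaleNr addrAC subrr add0r.
Qed.

Lemma gen_eigen_inj nu mu x : nu != mu -> gen_eigen nu x -> shift T mu x = 0 -> x = 0.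
Proof.
move=> numu [k hk] Tx0; have numu0 : nu - mu != 0 by rewrite subr_eq0.
have E : shift T nu x = (mu - nu) *: x by rewrite (shift_diff mu) Tx0 add0r.
have {hk} : (mu - nu) ^+ k *: x = 0.
  rewrite -[RHS]hk; elim: k {hk} => [|k IH]; first by rewrite expr0 scale1r.
  by rewrite iterSr E iter_shiftZ -IH scalerA exprS.
move/eqP; rewrite scaler_eq0 expf_eq0 subr_eq0 [mu == _]eq_sym (negPf numu) andbF.
by move/eqP.
Qed.

(** A power of [T - nu i] removes the term [y i]; it is injective on the weight space
    of [mu]. *)
Lemma gen_eigen_direct mu x (I : finType) (P : pred I) (nu : I -> K) (y : I -> V) :
  gen_eigen mu x -> (forall i, P i -> gen_eigen (nu i) (y i) /\ nu i != mu) ->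
  x = \sum_(i | P i) y i -> x = 0.
Proof.
move=> hx hy; elim: (index_enum I) x hx y hy => [|i s IH] x hx y hy.
  by rewrite big_nil.
have [Pi|nPi] := boolP (P i); last first.
  by rewrite big_cons (negPf nPi); exact: IH.
have [[k hk] numu] := hy i Pi.
rewrite big_cons Pi => xE.
have x0 : iter k (shift T (nu i)) x = 0.
  apply: (IH _ _ (fun j => iter k (shift T (nu i)) (y j))).
  - by elim: (k) => //= l; exact: gen_eigen_shift.
  - move=> j Pj; have [hj jmu] := hy j Pj; split=> //.
    by elim: (k) => //= l; exact: gen_eigen_shift.
  - rewrite xE iter_shiftD hk add0r.
    by rewrite (big_morph _ (iter_shiftD T (nu i) k) (iter_shift0 (nu i) k)).
elim: k x0 {hk} => [//|k IHk] /= hk; apply: IHk.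
apply: gen_eigen_inj hk; first by rewrite eq_sym; exact: numu.
by elim: (k) => //= l; exact: gen_eigen_shift.
Qed.

(** One factor [T - c] at a time: it is onto on the weight spaces other than that of
    [c], so that [x] differs from a sum of weight vectors by an element killed by a
    power of [T - c]. *)
Lemma split_gen_eigen (s : seq K) x : foldl (fun y c => shift T c y) x s = 0 ->
  sums [set y | exists nu, gen_eigen nu y] x.
Proof.
elim: s x => [|c s IH] x /=; first by move=> ->; exact: sums0.
move=> /IH/sums_ord[k [y [/choice[nu yP] xE]]].
have /choice[u uP] i : exists u, (exists nu, gen_eigen nu u) /\
    gen_eigen c (y i - shift T c u).
  have [nuc|nuc] := eqVneq (nu i) c.
    exists 0; split; first by exists c, 0%N.
    by rewrite linear0 subr0 -nuc.
  have [u hu uE] := gen_eigen_solve nuc (yP i).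
  by exists u; split; [exists (nu i)|rewrite uE subrr; exists 0%N].
rewrite -(subrK (\sum_i u i) x); apply: sumsD; last first.
  by apply: sums_sum => i _; apply: sums1; have [] := uP i.
apply: sums1; exists c.
have [l hl] : gen_eigen c (shift T c (x - \sum_i u i)).
  rewrite -scaleN1r addrC shift_linear scaleN1r addrC xE.
  rewrite (big_morph (shift T c) (iter_shiftD T c 1) (iter_shift0 c 1)) -sumrB.
  apply: is_subspace_sum => [|i _]; first exact: gen_eigen_subspace.
  by have [] := uP i.
by exists l.+1; rewrite iterSr.
Qed.
End GeneralizedEigenspaces.

Section RefineGenerators.
Variables (R : nzRingType) (S : set R) (M : lmodType R).
Hypothesis S_ring : is_subring S.

Lemma refine_generators (J : finType) (x : J -> M) (Y : set M) :
  (forall j, sums Y (x j)) ->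
  exists (I : finType) (e : I -> M), (forall i, Y (e i)) /\
    span_over S x `<=` span_over S e.
Proof.
move=> xY; have /choice[ky kyP] j : exists ky : {k & 'I_k -> M},
    (forall i, Y (projT2 ky i)) /\ x j = \sum_i projT2 ky i.
  by have [k [y h]] := sums_ord (xY j); exists (existT _ k y).
pose Jk := {j : J & 'I_(projT1 (ky j))}.
pose e (i : Jk) := projT2 (ky (tag i)) (tagged i).
exists Jk, e; split=> [i|]; first by have [h _] := kyP (tag i); exact: h.
apply: span_over_min; first exact: span_over_submod.
move=> j; have [_ ->] := kyP j; apply: submod_over_sum => [|i _].
  exact: span_over_submod.
exact: (mem_span_over S_ring e (Tagged (fun j => 'I_(projT1 (ky j))) i)).
Qed.
End RefineGenerators.

(** * Weights in the algebraic category O *)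

Section TriangularAlgebra.
Variables (K : fieldType) (R : algType K) (G : int -> set R) (A B H : set R) (d : R).
Hypothesis tri : triangular_decomposition G A B H d.

Let G_sub n : subspace (G n). Proof. by case: (tri_grading tri). Qed.
Let G_mul m n x y : G m x -> G n y -> G (m + n) (x * y).
Proof. by have [_ _ h _ _] := tri_grading tri; exact: h. Qed.
Let A_alg : subalgebra A. Proof. by case: (tri_A tri). Qed.
Let B_alg : subalgebra B. Proof. by case: (tri_B tri). Qed.
Let H_alg : subalgebra H. Proof. by case: (tri_H tri). Qed.

Lemma subalgebraZ (X : set R) (c : K) x : subalgebra X -> X x -> X (c *: x).
Proof. by move=> [[X0 XL] _ _] Xx; rewrite -[_ *: _]addr0; exact: XL. Qed.
Lemma subalgebraB (X : set R) x y : subalgebra X -> X x -> X y -> X (x - y).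
Proof. by move=> [[_ XL] _ _] Xx Xy; rewrite addrC -scaleN1r; exact: XL. Qed.

Let A_deg n x : A x -> G n x -> x != 0 -> exists k : nat, n = k%:Z.
Proof.
move=> Ax Gx x0; case: n Gx => [k _|k Gx]; first by exists k.
have := @tri_A_ge0 _ _ _ _ _ _ _ tri (Negz k) isT x (conj Ax Gx).
by move=> /= xE; rewrite xE eqxx in x0.
Qed.

Let B_deg n x : B x -> G n x -> x != 0 -> exists k : nat, n = - k%:Z.
Proof.
move=> Bx Gx x0; case: (ltP 0 n) => [n0|].
  have := @tri_B_le0 _ _ _ _ _ _ _ tri n n0 x (conj Bx Gx).
  by move=> /= xE; rewrite xE eqxx in x0.
case: n Gx => [[|k]|k] Gx; rewrite ?oppr_ge0//; first by exists 0%N; rewrite oppr0.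
by exists k.+1; rewrite NegzE.
Qed.

(** The components of the right-hand side of degree other than [n] vanish. *)
Lemma homogeneous_part n x (I : finType) (deg : I -> int) (y : I -> R) :
  G n x -> (forall i, G (deg i) (y i)) -> x = \sum_i y i ->
  x = \sum_(i | deg i == n) y i.
Proof.
move=> Gx Gy xE; have [_ _ _ _ indep] := tri_grading tri.
pose s := undup (n :: [seq deg i | i <- enum I]).
pose z m := \sum_(i | deg i == m) y i - (if m == n then x else 0).
have ns : n \in s by rewrite mem_undup inE eqxx.
have := indep s z (undup_uniq _) _ _ n ns.
rewrite /z eqxx => h; apply/eqP; rewrite -subr_eq0 -oppr_eq0 opprB; apply/eqP/h.
  move=> m; rewrite -scaleN1r addrC; have [G0 GL] := G_sub m; apply: (GL).
    by case: eqP => [->|].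
  elim/big_ind: _ => // [a b Ga Gb|i /eqP <- //].
  by rewrite -[a]scale1r; exact: GL.
rewrite sumrB [X in _ - X](_ : _ = x); last first.
  by rewrite (bigD1_seq n)//= ?undup_uniq// eqxx big1 ?addr0// => m /negPf ->.
rewrite (exchange_big_dep predT)//=; apply/eqP; rewrite subr_eq0; apply/eqP.
rewrite [RHS]xE; apply: eq_bigr => i _.
have ins : deg i \in s by rewrite mem_undup inE map_f ?orbT// mem_enum.
rewrite big_mkcond (bigD1_seq (deg i))//= ?undup_uniq// eqxx big1 ?addr0// => m.
by rewrite eq_sym => /negPf ->.
Qed.

Definition products (X Y Z : set R) : set R :=
  [set r | exists a h b, [/\ X a, Y h, Z b & r = a * h * b]].

Definition A_ n := A `&` G n%:Z.
Definition B_ n := B `&` G (- n%:Z).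

Lemma A_sums a : A a -> sums (\bigcup_n A_ n) a.
Proof.
move=> Aa; have [_ /(_ a Aa)] := tri_A tri; apply: sums_sub => x [n _ [Ax Gx]].
have [->|x0] := eqVneq x 0; first exact: sums0.
by have [k nk] := A_deg Ax Gx x0; apply: sums1; exists k => //; rewrite /A_ -nk.
Qed.

Lemma B_sums b : B b -> sums (\bigcup_n B_ n) b.
Proof.
move=> Bb; have [_ /(_ b Bb)] := tri_B tri; apply: sums_sub => x [n _ [Bx Gx]].
have [->|x0] := eqVneq x 0; first exact: sums0.
by have [k nk] := B_deg Bx Gx x0; apply: sums1; exists k => //; rewrite /B_ -nk.
Qed.

Definition homogeneous_products : set R :=
  \bigcup_(kl in [set: nat * nat]) products (A_ kl.1) H (B_ kl.2).

Let products_sums a h b : A a -> H h -> B b -> sums homogeneous_products (a * h * b).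
Proof.
move=> /A_sums Aa Hh /B_sums Bb.
apply: (@sums_bind _ _ (\bigcup_n A_ n) _ (fun a => a * h * b)) Aa _.
- by rewrite !mul0r.
- by move=> x y; rewrite !mulrDl.
move=> x [k _ Ax]; apply: (@sums_bind _ _ (\bigcup_n B_ n) _ (fun b => x * h * b)) Bb _.
- by rewrite mulr0.
- by move=> y z; rewrite mulrDr.
by move=> y [l _ By]; apply: sums1; exists (k, l) => //; exists x, h, y.
Qed.

(** The projection of [R] modulo the span of the products and the zero map agree on
    the products, so that they are equal. *)
Lemma triangular_span r : sums homogeneous_products r.
Proof.
have hZ : is_submod (sums homogeneous_products : set R).
  split=> [|x y|c x]; [exact: sums0|exact: sumsD|].
  move=> hx; apply: (sums_bind (f := fun x => c *: x)) hx _.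
  - by rewrite scaler0.
  - by move=> a b; rewrite scalerDr.
  move=> y [kl _ [a [h [b [[Aa Ga] Hh Bb ->]]]]]; apply: sums1; exists kl => //.
  exists (c *: a), h, b; split=> //; last by rewrite -!scalerAl.
  split; first exact: subalgebraZ.
  by have [G0 GL] := G_sub kl.1; rewrite -[_ *: _]addr0; exact: GL.
have lin0 (X : set R) : linear_on X (fun=> 0 : quot_type hZ).
  by move=> a x y _ _; rewrite scaler0 addr0.
have [g _ g_uniq] := tri_tensor tri (f := fun _ _ _ => 0 : quot_type hZ)
  (And3 (fun _ _ _ _ => lin0 A) (fun _ _ _ _ => lin0 H) (fun _ _ _ _ => lin0 B)).
have q0 : quot_proj hZ =1 g.
  apply: g_uniq => a h b Aa Hh Bb; apply/quot_proj_eq0.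
  exact: products_sums.
have z0 : (\0 : R -> quot_type hZ) =1 g by apply: (g_uniq \0).
by apply/(quot_proj_eq0 hZ r); rewrite q0 -z0.
Qed.

Lemma triangular_span_ord r : exists (n : nat) (a h b : 'I_n -> R) (k l : 'I_n -> nat),
  [/\ forall i, A_ (k i) (a i), forall i, H (h i), forall i, B_ (l i) (b i) &
    r = \sum_i a i * h i * b i].
Proof.
have [n [y [Xy rE]]] := sums_ord (triangular_span r).
have /choice[t tP] i : exists t : R * R * R * (nat * nat),
    [/\ A_ t.2.1 t.1.1.1, H t.1.1.2, B_ t.2.2 t.1.2 & y i = t.1.1.1 * t.1.1.2 * t.1.2].
  have [[k l] _ [a [h [b [Aa Hh Bb yE]]]]] := Xy i.
  by exists ((a, h, b), (k, l)).
exists n, (fun i => (t i).1.1.1), (fun i => (t i).1.1.2), (fun i => (t i).1.2).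
exists (fun i => (t i).2.1), (fun i => (t i).2.2).
split=> [i|i|i|]; try by have [] := tP i.
by rewrite rE; apply: eq_bigr => i _; have [] := tP i.
Qed.

Let H0 h : H h -> G 0 h. Proof. exact: (tri_H0 tri). Qed.

(** The constant term. The scalars are the elements of degree [0] of [A] and [B], and
    the parts of different degrees are independent. *)
Let augmentation (X : set R) : graded_subalgebra G X -> X `&` G 0 = [set c%:A | c in [set: K]] ->
  exists eps : R -> K, [/\ forall c x y, X x -> X y -> eps (c *: x + y) = c * eps x + eps y,
    eps 1 = 1 & forall n x, n != 0 -> X x -> G n x -> eps x = 0].
Proof.
move=> [X_alg Xs] X0; have [[X_0 XL] X1 XM] := X_alg.
pose Y : set R := \bigcup_(n in [set n : int | n != 0]) (X `&` G n).
have YZ c x : sums Y x -> sums Y (c *: x).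
  move=> hx; apply: (sums_bind (f := fun x => c *: x)) hx _.
  - by rewrite scaler0.
  - by move=> a b; rewrite scalerDr.
  move=> y [n n0 [Xy Gy]]; apply: sums1; exists n => //; split.
    exact: subalgebraZ.
  by have [G0 GL] := G_sub n; rewrite -[_ *: _]addr0; exact: GL.
have ex x : exists c, X x -> sums Y (x - c%:A).
  have [Xx|nX] := pselect (X x); last by exists 0.
  have [k [y [Xy ->]]] := sums_ord (Xs x Xx).
  have /choice[n nP] i : exists n, (X `&` G n) (y i) by have [n _ h] := Xy i; exists n.
  have [c _ cE] : [set c%:A | c in [set: K]] (\sum_(i | n i == 0) y i).
    rewrite -X0; split; apply: is_subspace_sum => [|i /eqP ni].
    - by split.
    - by have [] := nP i.
    - exact: G_sub.
    - by rewrite -ni; have [] := nP i.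
  exists c => _; rewrite cE [X in X - _](bigID (fun i => n i == 0)) /= addrAC subrr add0r.
  by apply: sums_sum => i ni; apply: sums1; exists (n i).
have [eps epsP] := choice ex.
have uniq c : sums Y c%:A -> c = 0.
  move=> /sums_ord[k [y [Yy cE]]].
  have /choice[n nP] i : exists n, n != 0 /\ (X `&` G n) (y i).
    by have [n n0 h] := Yy i; exists n.
  have nG i : G (n i) (y i) by have [_ []] := nP i.
  have G0c : G 0 c%:A.
    have [G00 GL] := G_sub 0; rewrite -[_ *: _]addr0; apply: GL => //.
    by have [_ h _ _ _] := tri_grading tri.
  have := homogeneous_part G0c nG cE; rewrite big1.
    by move/eqP; rewrite scaler_eq0 oner_eq0 orbF => /eqP.
  by move=> i /eqP ni; have [] := nP i; rewrite ni eqxx.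
have epsE x c : X x -> sums Y (x - c%:A) -> eps x = c.
  move=> Xx h; apply/eqP; rewrite -subr_eq0; apply/eqP/uniq.
  have := sumsD (YZ (-1) _ (epsP x Xx)) h.
  by rewrite scaleN1r opprB addrA subrK scalerBl.
exists eps; split=> [c x y Xx Xy||n x n0 Xx Gx].
- apply: epsE; first exact: XL.
  have := sumsD (YZ c _ (epsP x Xx)) (epsP y Xy).
  by rewrite scalerBr scalerA addrACA -opprD -scalerDl.
- by apply: epsE => //; rewrite scale1r subrr; exact: sums0.
- by apply: epsE => //; rewrite scale0r subr0; apply: sums1; exists n.
Qed.

(** The projection onto [H] in [A \otimes H \otimes B], by the constant terms of the
    outer factors. *)
Let H_projection : exists g : {linear R -> R}, (forall h, H h -> g h = h) /\
  forall a h b k l, A_ k a -> H h -> B_ l b -> (0 < k + l)%N -> g (a * h * b) = 0.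
Proof.
have [ea [eaL ea1 ea0]] := augmentation (tri_A tri) (tri_A0 tri).
have [eb [ebL eb1 eb0]] := augmentation (tri_B tri) (tri_B0 tri).
have [|g gE _] := tri_tensor tri (f := fun a h b => (ea a * eb b) *: h).
  split=> [h b Hh Bb c x y Ax Ay|a b Aa Bb c x y Hx Hy|a h Aa Hh c x y Bx By].
  - by rewrite eaL// mulrDl scalerDl scalerA mulrA.
  - by rewrite scalerDr !scalerA mulrC.
  - by rewrite ebL// mulrDr scalerDl scalerA mulrCA.
exists g; split=> [h Hh|a h b k l [Aa Ga] Hh [Bb Gb] kl].
  have [_ A1 _] := A_alg; have [_ B1 _] := B_alg.
  by have := gE 1 h 1 A1 Hh B1; rewrite mul1r mulr1 ea1 eb1 mulr1 scale1r.
rewrite gE//; case: (posnP k) kl => [->|k0 _]; last first.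
  by rewrite (ea0 k%:Z)// ?mul0r ?scale0r// eqz_nat -lt0n.
by rewrite add0n => l0; rewrite (eb0 (- l%:Z))// ?mulr0 ?scale0r// oppr_eq0 eqz_nat -lt0n.
Qed.

Let BH_exchange l b h : B_ l b -> H h -> sums [set h' * b' | h' in H & b' in B_ l] (b * h).
Proof.
move=> [Bb Gb] Hh; have /sums_ord[n [y [Xy yE]]] : span_prod H B (b * h).
  by rewrite -(tri_BH tri); apply: sums1; exists b => //; exists h.
have /sums_ord[m [w [Xw wE]]] :
    sums (\bigcup_k [set h' * b' | h' in H & b' in B_ k]) (b * h).
  rewrite yE; apply: sums_sum => i _; have [h' Hh' [b' Bb' <-]] := Xy i.
  apply: (sums_bind (f := fun b => h' * b)) (B_sums Bb') _.
  - by rewrite mulr0.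
  - by move=> u w; rewrite mulrDr.
  by move=> u [k _ Bu]; apply: sums1; exists k => //; exists h' => //; exists u.
have /choice[k kP] i : exists k, [set h' * b' | h' in H & b' in B_ k] (w i).
  by have [k _ hk] := Xw i; exists k.
have Gw i : G (- (k i)%:Z) (w i).
  have [h' Hh' [b' [_ Gb'] <-]] := kP i.
  by rewrite -[- _]add0r; apply: G_mul => //; exact: H0.
have Gbh : G (- l%:Z) (b * h) by rewrite -[- _]addr0; apply: G_mul => //; exact: H0.
rewrite (homogeneous_part Gbh Gw wE); apply: sums_sum => i /eqP /oppr_inj [<-].
exact/sums1/kP.
Qed.

Let HA_exchange k h a : H h -> A_ k a -> sums [set a' * h' | a' in A_ k & h' in H] (h * a).
Proof.
move=> Hh [Aa Ga]; have /sums_ord[n [y [Xy yE]]] : span_prod A H (h * a).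
  by rewrite -(tri_HA tri); apply: sums1; exists h => //; exists a.
have /sums_ord[m [w [Xw wE]]] :
    sums (\bigcup_k [set a' * h' | a' in A_ k & h' in H]) (h * a).
  rewrite yE; apply: sums_sum => i _; have [a' Aa' [h' Hh' <-]] := Xy i.
  apply: (sums_bind (f := fun a => a * h')) (A_sums Aa') _.
  - by rewrite mul0r.
  - by move=> u w; rewrite mulrDl.
  by move=> u [l _ Au]; apply: sums1; exists l => //; exists u => //; exists h'.
have /choice[l lP] i : exists l, [set a' * h' | a' in A_ l & h' in H] (w i).
  by have [l _ hl] := Xw i; exists l.
have Gw i : G (l i)%:Z (w i).
  have [a' [_ Ga'] [h' Hh' <-]] := lP i.
  by rewrite -[(l i)%:Z]addr0; apply: G_mul => //; exact: H0.
have Gha : G k%:Z (h * a) by rewrite -[k%:Z]add0r; apply: G_mul => //; exact: H0.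
rewrite (homogeneous_part Gha Gw wE); apply: sums_sum => i /eqP [<-].
exact/sums1/lP.
Qed.

Let positive_products : set R :=
  \bigcup_(k in [set k | (0 < k)%N]) products (A_ k) H (B_ k).

(** The component [z] of [d] in [H] is central because [d] commutes with [H] and the
    complement of [H] in [R] is stable under multiplication by [H]. *)
Lemma Cartan_part : exists z, [/\ H z, forall h, H h -> z * h = h * z &
  sums positive_products (d - z)].
Proof.
have [n [a [h [b [k [l [Aa Hh Bb dE]]]]]]] := triangular_span_ord d.
have Gy i : G ((k i)%:Z - (l i)%:Z) (a i * h i * b i).
  have [_ Ga] := Aa i; have [_ Gb] := Bb i; apply: G_mul => //.
  by rewrite -[(k i)%:Z]addr0; apply: G_mul => //; exact: H0.
have {}dE := homogeneous_part (tri_d tri) Gy dE.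
have kl i : (k i)%:Z - (l i)%:Z == 0 -> l i = k i.
  by rewrite subr_eq0 => /eqP [->].
have [[_ HL] _ HM] := H_alg.
pose z := \sum_(i | ((k i)%:Z - (l i)%:Z == 0) && (k i == 0%N)) a i * h i * b i.
have Hz : H z.
  rewrite /z; elim/big_ind: _ => [|x y Hx Hy|i /andP[/kl lk /eqP k0]].
  - by have [[]] := H_alg.
  - by rewrite -[x]scale1r; exact: HL.
  have : [set c%:A | c in [set: K]] (a i).
    by rewrite -(tri_A0 tri); have := Aa i; rewrite /A_ k0.
  have : [set c%:A | c in [set: K]] (b i).
    by rewrite -(tri_B0 tri); have := Bb i; rewrite /B_ lk k0 oppr0.
  move=> [cb _ <-] [ca _ <-]; rewrite -scalerAl mul1r -scalerAr mulr1.
  by do 2!apply: subalgebraZ => //.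
have hu : sums positive_products (d - z).
  rewrite dE (bigID (fun i => k i == 0%N)) /= -/z addrAC subrr add0r.
  apply: sums_sum => i /andP[/kl lk k0]; apply: sums1; exists (k i).
    by rewrite /= lt0n.
  by exists (a i), (h i), (b i); split=> //; rewrite -lk.
exists z; split=> // h' Hh'; have [g [gH g0]] := H_projection.
have comm0 : d * h' - h' * d = 0.
  by have := H0 Hh'; rewrite (tri_ad tri) /= scale0r.
have gu1 : g ((d - z) * h') = 0.
  have [m [w [Xw ->]]] := sums_ord hu.
  rewrite mulr_suml linear_sum big1// => i _.
  have [k' k'0 [a' [h1 [b' [Aa' Hh1 Bb' ->]]]]] := Xw i; rewrite -mulrA.
  have [m' [w' [Xw' ->]]] := sums_ord (BH_exchange Bb' Hh').
  rewrite mulr_sumr linear_sum big1// => j _; have [h2 Hh2 [b2 Bb2 <-]] := Xw' j.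
  rewrite mulrA -[a' * h1 * h2]mulrA; apply: g0 Aa' _ Bb2 _; first exact: HM.
  by rewrite ltn_addr.
have gu2 : g (h' * (d - z)) = 0.
  have [m [w [Xw ->]]] := sums_ord hu.
  rewrite mulr_sumr linear_sum big1// => i _.
  have [k' k'0 [a' [h1 [b' [Aa' Hh1 Bb' ->]]]]] := Xw i; rewrite !mulrA.
  have [m' [w' [Xw' ->]]] := sums_ord (HA_exchange Hh' Aa').
  rewrite -mulrA mulr_suml linear_sum big1// => j _; have [a2 Aa2 [h2 Hh2 <-]] := Xw' j.
  rewrite mulrA -[a2 * h2 * h1]mulrA; apply: g0 Aa2 _ Bb' _; first exact: HM.
  by rewrite ltn_addr.
have : g (z * h' - h' * z) = 0.
  have -> : z * h' - h' * z = (d * h' - h' * d) - ((d - z) * h' - h' * (d - z)).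
    by rewrite mulrBl mulrBr opprB addrA addrA subrK opprB addrC addrA subrK.
  by rewrite comm0 sub0r linearN linearB /= gu1 gu2 subrr oppr0.
rewrite gH; last by apply: subalgebraB => //; exact: HM.
by move/eqP; rewrite subr_eq0 => /eqP.
Qed.

Fixpoint split_product (z : R) (s : seq K) : R :=
  if s is c :: s' then split_product z s' * (z - c%:A) else 1.

(** A central element of [H] acts as a scalar in each matrix block. *)
Lemma Cartan_part_split z : H z -> (forall h, H h -> z * h = h * z) ->
  exists s, split_product z s = 0.
Proof.
move=> Hz z_central; have [[H_0 HL] H1 HM] := H_alg.
have [r [n [phi [phiL phi1 phiM phi0 phi_surj]]]] := tri_H_split tri.
have /choice[c cP] i : exists c : K, phi i z = c%:M.
  suff comm m : phi i z *m m = m *m phi i z.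
    exists (phi i z 0 0); apply/matrixP => k l.
    have /matrixP/(_ k 0) := comm (delta_mx l 0).
    rewrite !mxE (bigD1 l)//= big1 => [|q ql]; last first.
      by rewrite mxE (negPf ql) mulr0.
    rewrite mxE !eqxx mulr1 addr0 => ->.
    rewrite (bigD1 0)//= big1 => [|q q0]; last by rewrite mxE (negPf q0) andbF mul0r.
    by rewrite mxE eqxx andbT addr0 mulr_natl.
  have [x Hx xm] := phi_surj (fun j =>
    match i =P j with ReflectT e => ecast j 'M_((n j).+1) e m | _ => 0 end).
  have {xm} xm : phi i x = m.
    by rewrite xm; case: eqP => // e; rewrite eq_axiomK.
  by rewrite -xm !mulmxE -!phiM// z_central.
have HzA a : H (z - a%:A) by apply: subalgebraB => //; exact: subalgebraZ.
have Hs s : H (split_product z s) by elim: s => //= a s IH; exact: HM.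
exists [seq c i | i <- enum 'I_r]; apply: phi0 => // i.
have: i \in enum 'I_r by rewrite mem_enum.
elim: (enum _) => //= j s IH; rewrite inE phiM// => /predU1P[<-|/IH ->]; last first.
  by rewrite mul0r.
have -> : z - (c i)%:A = (- c i) *: 1 + z by rewrite scaleNr addrC.
by rewrite phiL// phi1 cP scaleNr scalemx1 addNr mulr0.
Qed.

Section ModulesO.
Variable M : lmodType R.
Local Notation X := (restrict_scalars (in_alg R) M).

Local Notation alg_act := (@act K R M d).

Definition killed_above n (m : M) := forall k b, (n < k)%N -> B_ k b -> b *: m = 0.

Lemma upper_part_killed n (m : M) :
  (forall b, upper_part G B n b -> b *: m = 0) <-> killed_above n m.
Proof.
split=> [h k b nk Bb|h b].
  by apply: h; apply: sums1; exists k.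
by move=> [s sX ->]; rewrite scaler_suml big_seq big1// => x /sX[k nk Bx]; exact: h Bx.
Qed.

Lemma shift_actE c (m : M) : shift alg_act c m = (d - c%:A) *: m.
Proof. by rewrite scalerBl. Qed.

Lemma shift_act_lower k b c (m : M) : B_ k b ->
  b *: (shift alg_act c m : M) = shift alg_act (c - k%:R) (b *: m) :> M.
Proof.
move=> [_ Gb]; rewrite !shift_actE !scalerA; congr (_ *: _).
move: Gb; rewrite (tri_ad tri) /= => /eqP; rewrite subr_eq => /eqP dbE.
rewrite mulrBr -scalerAr mulr1 mulrBl dbE -scalerAl mul1r scalerBl mulrNz scaleNr.
by rewrite opprB addrACA addNr add0r.
Qed.

(** A split polynomial that kills the vectors annihilated by [B_ k] for [k > n]: by
    induction on [n], as [B_ n.+1] lowers the weight by [n.+1]. *)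
Lemma killed_above_split n : exists s : seq K, forall m : M, killed_above n m ->
  foldl (fun y c => shift alg_act c y) (m : X) s = 0.
Proof.
have [z [Hz z_central du]] := Cartan_part.
have [s0 s0E] := Cartan_part_split Hz z_central.
have base (m : M) : killed_above 0 m -> foldl (fun y c => shift alg_act c y) (m : X) s0 = 0.
  move=> m0; have dz y : killed_above 0 y -> d *: y = z *: y.
    move=> hy; apply/eqP; rewrite -subr_eq0 -scalerBl; apply/eqP.
    have [k [w [Xw ->]]] := sums_ord du; rewrite scaler_suml big1// => i _.
    have [l l0 [a [h [b [_ _ Bb ->]]]]] := Xw i.
    by rewrite -scalerA (hy _ _ l0 Bb) scaler0.
  have stable y c : killed_above 0 y -> killed_above 0 (shift alg_act c y).
    by move=> hy k b k0 Bb; rewrite (shift_act_lower _ _ Bb) (hy _ _ k0 Bb) linear0.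
  suff E s : foldl (fun y c => shift alg_act c y) (m : X) s = split_product z s *: (m : M).
    by rewrite E s0E scale0r.
  elim: s m m0 => [|c s IH] m m0 /=; first by rewrite scale1r.
  rewrite IH; last exact: stable.
  by rewrite shift_actE scalerBl dz// -scalerBl scalerA.
have move_b k b s (m : M) : B_ k b ->
    b *: (foldl (fun y c => shift alg_act c y) (m : X) s : M) =
    foldl (fun y c => shift alg_act c y) (b *: m : X) [seq c - k%:R | c <- s].
  by move=> Bb; elim: s m => //= c s IH m; rewrite IH (shift_act_lower _ _ Bb).
elim: n => [|n [s hs]]; first by exists s0.
exists ([seq c + n.+1%:R | c <- s0] ++ s) => m hm; rewrite foldl_cat; apply: hs.
move=> k b nk Bb; rewrite (move_b k)//.
have [->|kn] := eqVneq k n.+1.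
  rewrite -map_comp (eq_map (g := id)) ?map_id => [|c /=]; last by rewrite addrK.
  apply: base => k' b' k'0 Bb'; rewrite scalerA; apply: (hm (k' + k)%N).
    by apply: leq_ltn_trans nk _; rewrite -{1}[k]add0n ltn_add2r.
  have [Bb1 Gb1] := Bb'; have [Bb2 Gb2] := Bb; have [_ _ BM] := B_alg.
  by split; [exact: BM|rewrite PoszD opprD; exact: G_mul].
rewrite (hm k)//; last by rewrite ltn_neqAle eq_sym kn.
by elim: [seq _ | c <- _] => //= c t IH; rewrite linear0.
Qed.

Lemma A_subring : is_subring A.
Proof.
have [_ A1 AM] := A_alg; split=> // x y Ax Ay; exact: subalgebraB.
Qed.

(** The vectors [h * b *: g], with [g] in a finite set of generators and [h], [b] in
    finite bases, generate over [A], since [B] lowers each [g] to zero in finitely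
    many degrees; each of them is a sum of weight vectors by [killed_above_split]. *)
Lemma categoryO_generators : categoryO G B (M : LMod R) ->
  exists (I : finType) (e : I -> M) (lam : I -> K),
    (forall i, gen_eigen alg_act (lam i) (e i)) /\ span_over A e = setT.
Proof.
move=> [[r [g gM]] M_nil].
have nil m : exists n, killed_above n m.
  by have [n h] := M_nil m; exists n; apply/upper_part_killed.
have /choice[ng ngP] i := nil (g i).
pose n := \max_i ng i.
have gn i k b : (n < k)%N -> B_ k b -> b *: g i = 0.
  move=> nk; apply: ngP; apply: leq_ltn_trans nk; exact: (leq_bigmax i).
have [t [hb [_ hbP]]] := tri_H_fin tri.
have /choice[bb bbP] l : exists bb : {k & 'I_k -> R}, forall x, B_ l x ->
    exists c : 'I_(projT1 bb) -> K, x = \sum_i c i *: projT2 bb i.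
  have [k [bb [_ h]]] := tri_B_fin tri (- l%:Z).
  by exists (existT _ k bb).
pose Lb := {l : 'I_n.+1 & 'I_(projT1 (bb l))}.
pose J := ('I_r * 'I_t * Lb)%type.
pose x (j : J) : M := (hb j.1.2 * projT2 (bb (tag j.2)) (tagged j.2)) *: g j.1.1.
have AR := A_subring; have hx := span_over_submod AR x.
have AZ c a : A a -> A (c *: a) by exact: subalgebraZ.
have [[A0 _] A1 _] := A_alg.
have xM m : span_over A x m.
  have [ra [_ ->]] := gM m; apply: (submod_over_sum _ hx) => i _.
  have [k [a [h [b [da [db [Aa Hh Bb ->]]]]]]] := triangular_span_ord (ra i).
  rewrite scaler_suml; apply: (submod_over_sum _ hx) => j _.
  have [ab Gb] := Bb j; case: (leqP (db j) n) => dn; last first.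
    by rewrite -scalerA (gn _ _ _ dn (Bb j)) scaler0; case: hx.
  have [ch ->] := hbP (h j) (Hh j).
  have [cb ->] := bbP (db j) (b j) (Bb j).
  rewrite mulr_sumr scaler_suml; apply: (submod_over_sum _ hx) => u _.
  rewrite mulr_sumr mulr_suml scaler_suml; apply: (submod_over_sum _ hx) => q _.
  set bu := projT2 (bb (db j)) u.
  have -> : a j * (ch q *: hb q) * (cb u *: bu) =
      ((cb u * ch q) *: a j) * (hb q * bu).
    by rewrite -!scalerAr -!scalerAl scalerA mulrA.
  rewrite -[X in span_over _ _ X]scalerA /bu.
  have [_ _ hZ] := hx; apply: hZ; first by apply: AZ; have [] := Aa j.
  pose l : 'I_n.+1 := Ordinal (dn : (db j < n.+1)%N).
  exact: (mem_span_over AR x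
    ((i, q), Tagged (fun l : 'I_n.+1 => 'I_(projT1 (bb l))) (i := l) u)).
have xs j : sums [set y : M | exists nu, gen_eigen alg_act nu y] (x j).
  have [nj hj] := nil (x j); have [s hs] := killed_above_split nj.
  exact: split_gen_eigen (hs _ hj).
have [I [e [eP eM]]] := refine_generators AR xs.
have [lam lamP] := choice eP; exists I, e, lam; split=> //.
by apply/seteqP; split=> // m _; exact: eM.
Qed.

End ModulesO.
End TriangularAlgebra.

(** * Expansions in a Banach algebra with a triangular decomposition *)

(** On the rational numbers the absolute value of [K] is the [p]-adic one. *)
Lemma padic_scalars (Rl : realType) (p : nat) (K : fieldType) (v : K -> Rl) :
  prime p -> complete_dv_extension_of_Qp p v ->
  0 < v p%:R <= 2^-1 /\ forall n, n.+1%:R != 0 :> K.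
Proof.
move=> p_prime [hv _ _ [Q [w [i [[_ _ wQ _] vw]]]]].
have ratr_nat' (n : nat) : ratr n%:R = n%:R :> Q by rewrite ratr_nat.
have vn n : v n%:R = padic_abs Rl p n%:R.
  by rewrite -wQ -vw ratr_nat' rmorph_nat.
have p0 : 0 < p%:R :> Rl by rewrite ltr0n prime_gt0.
split=> [|n].
  have pE : p%:R = p%:Q :> rat by [].
  rewrite vn /padic_abs pE intr_eq0 eqz_nat (gtn_eqF (prime_gt0 p_prime)).
  rewrite numq_int denq_int /= logn1 sub0r lognE p_prime prime_gt0// dvdnn divnn.
  rewrite prime_gt0//= logn1 /= exprN1 invr_gt0 p0 /=.
  by rewrite lef_pV2 ?posrE// ler_nat prime_gt1.
have : v n.+1%:R != 0.
  rewrite vn /padic_abs pnatr_eq0 /=.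
  by rewrite gt_eqF// exprz_gt0.
by apply: contra => /eqP ->; rewrite (abs0 hv).
Qed.

Section BanachTriangular.
Variables (Rl : realType) (p : nat) (K : fieldType) (v : K -> Rl)
  (RB : algType K) (N : RB -> Rl) (R : algType K) (j : {lrmorphism R -> RB})
  (G : int -> set R) (A B H : set R) (d : R).
Hypothesis hv : nonarch_abs v.
Hypothesis v_complete : complete_for v.
Hypothesis hp : 0 < v p%:R <= 2^-1.
Hypothesis K_char0 : forall n, n.+1%:R != 0 :> K.
Hypothesis hB : banach_algebra v N.
Hypothesis RB_noeth : left_noetherian RB.
Hypothesis btri : banach_triangular_decomposition v N j G A B H d.
Let bN : banach_space v N. Proof. by case: hB. Qed.
Let uN := banach_ultra hv bN.
Let tri := btri_alg btri.
Let j_inj := btri_inj btri.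

Definition closure_of (X : set R) := norm_closure N (j @` X).

Let image_subspace (X : set R) : subspace X -> is_subspace (j @` X).
Proof.
move=> [X0 XL]; split=> [|a _ _ [x Xx <-] [y Xy <-]].
  by exists 0; rewrite ?linear0.
by exists (a *: x + y); [exact: XL|rewrite linearP].
Qed.

Lemma closure_of_subspace X : subspace X -> is_subspace (closure_of X).
Proof. by move=> /image_subspace; exact: (norm_closure_subspace hv bN). Qed.

Lemma closure_of_closed X : norm_closed N (closure_of X).
Proof. exact: (norm_closureK uN). Qed.

Lemma closure_of_mem (X : set R) x : X x -> closure_of X (j x).
Proof. by move=> Xx; apply: (norm_closure_id uN); exists x. Qed.

Lemma closure_of_subring X : subalgebra X -> is_subring (closure_of X).
Proof.
move=> X_alg; have [X_sub X1 XM] := X_alg; have hX := closure_of_subspace X_sub.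
split=> [|x y|x y hx hy]; first by rewrite -(rmorph1 j); exact: closure_of_mem.
  exact: is_subspaceB.
have [C C0 hC] := banach_mul_bound hv hB; move=> e e0.
have D0 : 0 < Num.max 1 (Num.max (N x) (N y)) by rewrite lt_max ltr01.
pose D := Num.max 1 (Num.max (N x) (N y)).
have e'0 : 0 < Num.min 1 (e / (C * D)) by rewrite lt_min ltr01 divr_gt0 ?mulr_gt0.
have [_ [x' Xx' <-] xx'] := hx _ e'0; have [_ [y' Xy' <-] yy'] := hy _ e'0.
exists (j x' * j y'); first by exists (x' * y'); [exact: XM|rewrite rmorphM].
have -> : j x' * j y' - x * y = (j x' - x) * j y' + x * (j y' - y).
  by rewrite mulrBl mulrBr addrA subrK.
have small a b : N a < Num.min 1 (e / (C * D)) -> N b <= D -> C * N a * N b < e.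
  move=> ha hb; apply: (@le_lt_trans _ _ (C * N a * D)).
    by rewrite ler_wpM2l// mulr_ge0 ?(ultra_ge0 uN)// ltW.
  rewrite mulrAC -ltr_pdivlMl ?mulr_gt0// mulrC.
  by apply: lt_le_trans ha _; rewrite ge_min lexx orbT.
apply: (ultra_addlt uN).
  apply: le_lt_trans (hC _ _) _; apply: small => //.
  rewrite -(subrK y (j y')); apply: (ultra_addle uN).
    by apply: le_trans (ltW yy') _; rewrite ge_min /D le_max lexx.
  by rewrite /D !le_max lexx !orbT.
apply: le_lt_trans (hC _ _) _; rewrite mulrAC; apply: small => //.
by rewrite /D !le_max lexx !orbT.
Qed.

(** The components of an eigenvector of [ad d] are eigenvectors of distinct weights.
    The sign [sg] serves to treat [A], graded by [n], and [B], graded by [- n]. *)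
Let homogeneous_eigen (X : nat -> set R) (sg : K) x l :
  sg * sg = 1 -> (forall n, subspace (X n)) ->
  (forall n y, X n y -> adjoint d y = (sg * n%:R) *: y) ->
  sums (\bigcup_n X n) x -> adjoint d x = (sg * l) *: x ->
  x = 0 \/ exists2 n : nat, l = n%:R & X n x.
Proof.
move=> sg2 X_sub Xd /sums_ord[k [y [Xy xE]]] xl.
have /choice[n nP] i : exists n, X n (y i) by have [n _ h] := Xy i; exists n.
have eig t z : adjoint d z = t *: z -> gen_eigen (adjoint d) t z.
  by move=> E; exists 1%N; change (adjoint d z - t *: z = 0); rewrite E subrr.
have x0 : x = \sum_(i | (n i)%:R == l) y i.
  apply/eqP; rewrite -subr_eq0; apply/eqP.
  apply: (@gen_eigen_direct _ _ (adjoint d) (sg * l) _ _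
    (fun i => (n i)%:R != l) (fun i => sg * (n i)%:R) y).
  - apply: is_subspaceB; [exact: gen_eigen_subspace|exact: eig|].
    apply: is_subspace_sum => [|i /eqP <-]; first exact: gen_eigen_subspace.
    by apply: eig; exact: Xd.
  - move=> i nl; split; first by apply: eig; exact: Xd.
    apply: contra nl => /eqP/(congr1 ( *%R sg)); rewrite !mulrA sg2 !mul1r.
    by move=> ->.
  - by rewrite [in LHS]xE (bigID (fun i => (n i)%:R == l)) /= addrAC subrr add0r.
have [[i /eqP il]|nl] := pselect (exists i, (n i)%:R == l).
  right; exists (n i) => //; rewrite x0; apply: is_subspace_sum => [|i' /eqP i'l].
    exact: X_sub.
  by rewrite -(natr_inj_char0 K_char0 (etrans i'l (esym il))).
left; rewrite x0 big1// => i il; case: nl; by exists i.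
Qed.

(** The terms of the weight decomposition of the closure lie in the image of [X], by
    the description of its weight spaces, and are homogeneous there. *)
Let expansion_of (X : set R) (Xn : nat -> set R) (sg : K) :
  sg * sg = 1 -> (forall n, subspace (Xn n)) ->
  (forall n y, Xn n y -> adjoint d y = (sg * n%:R) *: y) ->
  (forall x, X x -> sums (\bigcup_n Xn n) x) ->
  semisimple_weight_decomposition (norm_open N) (closure_of X) (ad (j d)) ->
  weight_sum (closure_of X) (ad (j d)) = j @` X ->
  forall x, closure_of X x -> exists c, graded_sum N (fun n => j @` Xn n) c x.
Proof.
move=> sg2 Xn_sub Xd X_sums [I [I_weights I_dec] I_ss] wsE x Xx.
have [w wW wx] := I_dec x Xx.
have wl l : I (sg * l) -> w (sg * l) = 0 \/
    exists2 n : nat, l = n%:R & (j @` Xn n) (w (sg * l)).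
  move=> Il; have hw := wW _ Il; have dw := I_ss _ _ Il hw.
  have [y Xy yw] : (j @` X) (w (sg * l)).
    rewrite -wsE; apply: sums1; exists (sg * l) => //; exact: I_weights.
  have yl : adjoint d y = (sg * l) *: y.
    by apply: j_inj; rewrite /adjoint linearB !rmorphM linearZ /= yw -dw.
  have [y0|[n ln Xny]] := homogeneous_eigen sg2 Xn_sub Xd (X_sums y Xy) yl.
    by left; rewrite -yw y0 linear0.
  by right; exists n => //; exists y.
have sgI : injective ( *%R sg).
  by move=> a b /(congr1 ( *%R sg)); rewrite !mulrA sg2 !mul1r.
pose c l := if `[< I (sg * l) >] then w (sg * l) else 0.
exists c; split=> [e e0|n|l]; last 2 first.
- have Xn0 : (j @` Xn n) 0 by exists 0; [case: (Xn_sub n)|exact: linear0].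
  rewrite /c; case: asboolP => // In; case: (wl _ In) => [->//|[m nm]].
  by rewrite (natr_inj_char0 K_char0 nm).
- rewrite /c; case: asboolP => Il; last by left.
  by case: (wl _ Il) => [->|[n ln _]]; [left|right; exists n].
have [||F0 F0I F0P] := wx [set y | N (y - x) < e].
- move=> y ye; exists e => // z ze /=; rewrite -(subrK y z) -addrA.
  exact: (ultra_addlt uN).
- by rewrite /= subrr (ultra_0 uN).
exists [fset sg * l | l in F0]%fset => F F0F.
pose F' := [fset sg * l | l in F & `[< I (sg * l) >]]%fset.
have F'I l : l \in F' -> I l.
  by move=> /imfsetP[l' /=]; rewrite inE => /andP[_ /asboolP h] ->.
have := F0P F' _ F'I; rewrite /= big_imfset /=; last by move=> a b _ _; exact: sgI.
rewrite big_filter /c -big_mkcond /=; apply.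
apply/fsubsetP => l lF0; apply/imfsetP; exists (sg * l); last by rewrite mulrA sg2 mul1r.
rewrite inE /=; apply/andP; split; last by apply/asboolP; rewrite mulrA sg2 mul1r; exact: F0I.
by apply: (fsubsetP F0F); apply/imfsetP; exists l.
Qed.

Let A_sub n : subspace (A_ G A n).
Proof.
have [[[A0 AL] _ _] _] := tri_A tri; have [+ _ _ _ _] := tri_grading tri.
move=> /(_ n%:Z)[G0 GL]; split=> // a x y [Ax Gx] [Ay Gy].
by split; [exact: AL|exact: GL].
Qed.

Let B_sub n : subspace (B_ G B n).
Proof.
have [[[B0 BL] _ _] _] := tri_B tri; have [+ _ _ _ _] := tri_grading tri.
move=> /(_ (- n%:Z))[G0 GL]; split=> // a x y [Bx Gx] [By Gy].
by split; [exact: BL|exact: GL].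
Qed.

Lemma A_adjoint n y : A_ G A n y -> adjoint d y = n%:R *: y.
Proof. by move=> [_]; rewrite (tri_ad tri). Qed.

Lemma B_adjoint n y : B_ G B n y -> adjoint d y = (-1 * n%:R) *: y.
Proof. by move=> [_]; rewrite (tri_ad tri) /= mulN1r mulrNz. Qed.

Lemma A_expansion x : closure_of A x ->
  exists c, graded_sum N (fun n => j @` A_ G A n) c x.
Proof.
apply: (@expansion_of A _ 1) => //; first by rewrite mulr1.
- by move=> n y /A_adjoint ->; rewrite mul1r.
- by move=> a; exact: (A_sums tri).
- exact: btri_A_wsd btri.
- exact: btri_A_ws btri.
Qed.

Lemma B_expansion x : closure_of B x ->
  exists c, graded_sum N (fun n => j @` B_ G B n) c x.
Proof.
apply: (@expansion_of B _ (-1)) => //; first by rewrite mulrNN mulr1.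
- exact: B_adjoint.
- by move=> b; exact: (B_sums tri).
- exact: btri_B_wsd btri.
- exact: btri_B_ws btri.
Qed.

Let image_span (X : set R) : subspace X -> fin_dim X -> exists r (g : 'I_r -> RB),
  j @` X = [set y | exists c : 'I_r -> K, y = \sum_i c i *: g i].
Proof.
move=> X_sub [r [g [Xg gX]]]; exists r, (fun i => j (g i)).
apply/seteqP; split=> [_ [x /gX[c ->] <-]|_ [c ->]].
  by exists c; rewrite linear_sum; apply: eq_bigr => i _; rewrite linearZ.
apply: is_subspace_sum => [|i _]; first exact: image_subspace.
by apply: is_subspaceZ; [exact: image_subspace|exists (g i)].
Qed.

Lemma A_coordinates n : exists (I : finType) (x : I -> R) (xi : I -> RB -> K),
  [/\ forall i a y z, closure_of A y -> closure_of A z ->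
        xi i (a *: y + z) = a * xi i y + xi i z,
      forall i, exists C, forall y, closure_of A y -> v (xi i y) <= C * N y,
      forall m y, (m <= n)%N -> A_ G A m y -> y = \sum_i xi i (j y) *: x i &
      forall m y, (n < m)%N -> A_ G A m y -> forall i, xi i (j y) = 0].
Proof.
have [[A_alg _] A_fin] := (tri_A tri, tri_A_fin tri); have [A_vs _ _] := A_alg.
have [||||||||I [x [xi [xX xiL xiB xiE xi0]]]] := @graded_coordinates _ _ v p%:R
    hv v_complete hp K_char0 _ N bN (adjoint (j d)) _ (closure_of A)
    (fun n => j @` A_ G A n) _ _ _ _ _ _ n _.
- exact: (adjoint_bounded hv hB).
- exact: closure_of_subspace.
- exact: closure_of_closed.
- by move=> m; exact: image_subspace.
- by move=> m _ [y [Ay _] <-]; exact: closure_of_mem.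
- move=> m _ [y Ay <-]; rewrite -linearZ -(A_adjoint Ay) /adjoint.
  by rewrite rmorphB !rmorphM.
- exact: A_expansion.
- by move=> m; exact: (image_span (A_sub m) (A_fin m%:Z)).
have /choice[x' x'P] i : exists x', j x' = x i by have [m [x' _ <-]] := xX i; exists x'.
exists I, x', xi; split=> // [m y mn Ay|m y nm Ay i]; last first.
  by apply: (xi0 m) => //; exists y.
apply: j_inj; rewrite linear_sum {1}(xiE m (j y) mn); last by exists y.
by apply: eq_bigr => i _; rewrite linearZ /= x'P.
Qed.

Lemma B_coordinates n : exists (I : finType) (x : I -> R) (xi : I -> RB -> K),
  [/\ forall i a y z, closure_of B y -> closure_of B z ->
        xi i (a *: y + z) = a * xi i y + xi i z,
      forall i, exists C, forall y, closure_of B y -> v (xi i y) <= C * N y,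
      forall m y, (m <= n)%N -> B_ G B m y -> y = \sum_i xi i (j y) *: x i &
      forall m y, (n < m)%N -> B_ G B m y -> forall i, xi i (j y) = 0].
Proof.
have [[B_alg _] B_fin] := (tri_B tri, tri_B_fin tri); have [B_vs _ _] := B_alg.
have [||||||||I [x [xi [xX xiL xiB xiE xi0]]]] := @graded_coordinates _ _ v p%:R
    hv v_complete hp K_char0 _ N bN (\- adjoint (j d)) _ (closure_of B)
    (fun n => j @` B_ G B n) _ _ _ _ _ _ n _.
- have [C hC] := adjoint_bounded hv hB (j d).
  by exists C => y /=; rewrite (ultraN uN).
- exact: closure_of_subspace.
- exact: closure_of_closed.
- by move=> m; exact: image_subspace.
- by move=> m _ [y [By _] <-]; exact: closure_of_mem.
- move=> m _ [y By <-]; rewrite /= -linearZ.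
  have -> : m%:R *: y = - adjoint d y by rewrite (B_adjoint By) mulN1r scaleNr opprK.
  by rewrite /adjoint rmorphN rmorphB !rmorphM.
- exact: B_expansion.
- by move=> m; exact: (image_span (B_sub m) (B_fin (- m%:Z))).
have /choice[x' x'P] i : exists x', j x' = x i by have [m [x' _ <-]] := xX i; exists x'.
exists I, x', xi; split=> // [m y mn By|m y nm By i]; last first.
  by apply: (xi0 m) => //; exists y.
apply: j_inj; rewrite linear_sum {1}(xiE m (j y) mn); last by exists y.
by apply: eq_bigr => i _; rewrite linearZ /= x'P.
Qed.

Lemma H_coordinates : exists (I : finType) (x : I -> R) (xi : I -> RB -> K),
  [/\ forall i a y z, (j @` H) y -> (j @` H) z -> xi i (a *: y + z) = a * xi i y + xi i z,
      forall i, exists C, forall y, (j @` H) y -> v (xi i y) <= C * N y &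
      forall y, H y -> y = \sum_i xi i (j y) *: x i].
Proof.
have [[H_vs _ _] _] := tri_H tri.
have [r [g gE]] := image_span H_vs (tri_H_fin tri).
have [I [x [xi]]] := fin_dim_bounded_coords hv v_complete bN g.
rewrite -gE => -[xX xiL xiB xiE].
have /choice[x' x'P] i : exists x', j x' = x i by have [x' _ <-] := xX i; exists x'.
exists I, x', xi; split=> // y Hy; apply: j_inj.
rewrite linear_sum {1}(xiE (j y)); last by exists y.
by apply: eq_bigr => i _; rewrite linearZ /= x'P.
Qed.

(** The left ideal generated by the elements of [B] of degree below [- n]. *)
Definition lower_ideal n : set RB :=
  sums [set r | exists s k b, [/\ (n < k)%N, B_ G B k b & r = s * j b]].

Lemma lower_ideal_submod n : is_submod (lower_ideal n : set RB^o).
Proof.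
split=> [|x y|a x hx]; [exact: sums0|exact: sumsD|].
apply: (sums_bind (f := fun x => a * x)) hx _; first by rewrite mulr0.
  by move=> y z; rewrite mulrDr.
move=> _ [s [k [b [nk Bb ->]]]]; apply: sums1.
by exists (a * s), k, b; rewrite mulrA.
Qed.

(** The presentation of the algebra as a module over itself. *)
Definition row1_val (x : 'rV[RB]_1) : RB^o := x 0 0.
Fact row1_val_linear : linear row1_val.
Proof. by move=> a x y; rewrite /row1_val !mxE. Qed.
HB.instance Definition _ :=
  GRing.isLinear.Build RB 'rV[RB]_1 RB^o _ row1_val row1_val_linear.

Lemma lower_ideal_closed n : norm_closed N (lower_ideal n).
Proof.
have [I0 ID IZ] := lower_ideal_submod n.
have hI : is_submod_over setT (lower_ideal n : set RB^o).
  split=> // [x y Ix Iy|a x _ Ix]; first exact: (submodB (lower_ideal_submod n)).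
  exact: IZ.
have fg : fin_gen_over setT (RB^o : lmodType RB).
  exists 1%N, (fun=> 1) => x; exists (fun=> x); split=> //.
  by rewrite big_ord1; exact: (esym (mulr1 x)).
have surj (m : RB^o) : exists x, row1_val x = m.
  by exists (\row_i m); rewrite /row1_val mxE.
have hT : is_subring [set: RB] by [].
have Tcl : norm_closed N [set: RB] by [].
have cl := submod_closed hv hp hB RB_noeth hT (fun _ => I) Tcl RB_noeth fg hI surj.
move=> x xI; have rE (y : RB) : row1_val (\row_i y) = y by rewrite /row1_val mxE.
rewrite -(rE x); apply: cl => e e0; have [y Iy yx] := xI e e0.
exists (\row_i y); first by rewrite /= rE.
by apply: row_norm_lt => // i; rewrite !mxE.
Qed.

(** The components of an element of [RB] along [Q], the products of a basis of [H]
    and a basis of the part of [B] of degree at least [- n]: the coefficients are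
    the continuous extensions of [a * h * b |-> eta h * beta b * a], for coordinate
    functionals [eta] and [beta]. *)
Lemma triangular_expansion n : exists (Q : finType) (y : Q -> R)
    (g : Q -> {linear RB -> RB}),
  [/\ forall q, exists C, forall r, N (g q r) <= C * N r,
      forall q r, closure_of A (g q r),
      forall r, lower_ideal n (r - \sum_q g q r * j (y q)) &
      forall a h l b, A a -> H h -> B_ G B l b -> exists c : Q -> K,
        [/\ forall q, g q (j (a * h * b)) = c q *: j a,
            (l <= n)%N -> h * b = \sum_q c q *: y q &
            (n < l)%N -> forall q, c q = 0]].
Proof.
have [Ih [xh [eta [etaL etaB etaE]]]] := H_coordinates.
have [Ib [xb [beta [betaL betaB betaE beta0]]]] := B_coordinates n.
pose Q := (Ih * Ib)%type.
have [[A_vs A1 _] _] := tri_A tri; have [[B_vs _ _] _] := tri_B tri.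
have hAbar := closure_of_subspace A_vs.
have /choice[g gP] (q : Q) : exists g : {linear RB -> RB},
    (exists C, forall r, N (g r) <= C * N r) /\
    forall a h b, closure_of A a -> (j @` H) h -> closure_of B b ->
      g (a * h * b) = (eta q.1 h * beta q.2 b) *: a.
  have [||g [gB gE] _] := btri_tensor btri bN
      (f := fun a h b => (eta q.1 h * beta q.2 b) *: a).
  - split=> [h b Hh Bb c x y Ax Ay|a b Aa Bb c x y Hx Hy|a h Aa Hh c x y Bx By].
    + by rewrite scalerDr !scalerA mulrC.
    + by rewrite etaL// mulrDl scalerDl scalerA mulrA.
    + by rewrite betaL// mulrDr scalerDl scalerA mulrCA.
  - have [C hC] := etaB q.1; have [D hD] := betaB q.2.
    exists (Num.max C 0 * Num.max D 0) => a h b Aa Hh Bb.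
    have max_le (E : Rl) (x t : Rl) : 0 <= t -> x <= E * t -> x <= Num.max E 0 * t.
      by move=> t0 /le_trans; apply; rewrite ler_wpM2r// le_max lexx.
    rewrite (normZ bN) (absM hv).
    apply: (@le_trans _ _ ((Num.max C 0 * N h) * (Num.max D 0 * N b) * N a)).
      rewrite ler_wpM2r ?(ultra_ge0 uN)//.
      apply: ler_pM; rewrite ?abs_ge0//.
        by apply: max_le; rewrite ?(ultra_ge0 uN)//; exact: hC.
      by apply: max_le; rewrite ?(ultra_ge0 uN)//; exact: hD.
    by rewrite le_eqVlt; apply/orP; left; apply/eqP; ring.
  by exists g; split.
have gprod q a h l b : A a -> H h -> B_ G B l b ->
    g q (j (a * h * b)) = (eta q.1 (j h) * beta q.2 (j b)) *: j a.
  move=> Aa Hh [Bb _]; have [_ gE] := gP q; rewrite !rmorphM gE//.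
  - exact: closure_of_mem.
  - by exists h.
  - exact: closure_of_mem.
pose y (q : Q) := xh q.1 * xb q.2.
have hb_le h l b : (l <= n)%N -> H h -> B_ G B l b ->
    h * b = \sum_q (eta q.1 (j h) * beta q.2 (j b)) *: y q.
  move=> ln Hh Bb; rewrite {1}(etaE h Hh) {1}(betaE l b ln Bb).
  rewrite big_distrlr pair_bigA /=; apply: eq_bigr => q _.
  by rewrite -scalerAl -scalerAr scalerA.
have gB q : exists C, forall r, N (g q r) <= C * N r by have [] := gP q.
have gR q r : closure_of A (g q (j r)).
  have [m [a [h [b [k [l [Aa Hh Bb ->]]]]]]] := triangular_span_ord tri r.
  rewrite rmorph_sum linear_sum; apply: is_subspace_sum => // i _.
  rewrite (gprod q _ _ _ _ _ (Hh i) (Bb i)); last by have [] := Aa i.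
  by apply: (is_subspaceZ _ hAbar); apply: closure_of_mem; have [] := Aa i.
have dense r (e : Rl) : 0 < e -> exists r', N (j r' - r) < e.
  move=> e0; have : norm_closure N (range j) r by rewrite (btri_dense btri).
  by move=> /(_ e e0)[_ [r' _ <-] h]; exists r'.
have small (f : RB -> RB) : (exists C, forall r, N (f r) <= C * N r) ->
    forall e : Rl, 0 < e -> exists2 e', 0 < e' & forall r, N r < e' -> N (f r) < e.
  move=> [C hC] e e0; have C1 : 0 < Num.max C 1 by rewrite lt_max ltr01 orbT.
  exists (e / Num.max C 1) => [|r re]; first by rewrite divr_gt0.
  apply: le_lt_trans (hC r) _; apply: (@le_lt_trans _ _ (Num.max C 1 * N r)).
    by rewrite ler_wpM2r ?(ultra_ge0 uN)// le_max lexx.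
  by rewrite mulrC -ltr_pdivlMr.
exists Q, y, g; split=> // [q r|r|a h l b Aa Hh Bb].
- apply: closure_of_closed => e e0; have [e' e'0 he'] := small (g q) (gB q) e e0.
  by have [r' r'r] := dense r e' e'0; exists (g q (j r')) => //; rewrite -linearB; exact: he'.
- pose rest r := r - \sum_q g q r * j (y q).
  have restB a b : rest (a - b) = rest a - rest b.
    rewrite /rest (eq_bigr (fun q => g q a * j (y q) - g q b * j (y q))) => [|q _].
      by rewrite sumrB !opprB addrACA [RHS]addrACA; congr (_ + _); exact: addrC.
    by rewrite linearB mulrBl.
  have rest_b : exists C, forall r, N (rest r) <= C * N r.
    have [D D0 hD] := banach_mul_bound hv hB.
    have /choice[C hC] := gB.
    exists (\big[Num.max/1]_q (D * Num.max (C q) 0 * N (j (y q)))) => s.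
    apply: (ultra_suble uN).
      by rewrite ler_peMl ?(ultra_ge0 uN)//; exact: bigmax_ge_id.
    apply: (ultra_sumle uN) => [|q _].
      rewrite mulr_ge0 ?(ultra_ge0 uN)//; apply: le_trans ler01 _.
      exact: bigmax_ge_id.
    apply: (@le_trans _ _ ((D * Num.max (C q) 0 * N (j (y q))) * N s)); last first.
      by rewrite ler_wpM2r ?(ultra_ge0 uN)//; exact: le_bigmax.
    apply: le_trans (hD _ _) _; rewrite [leRHS]mulrAC ler_wpM2r ?(ultra_ge0 uN)//.
    rewrite -mulrA ler_wpM2l ?(ltW D0)//; apply: le_trans (hC q s) _.
    by rewrite ler_wpM2r ?(ultra_ge0 uN)// le_max lexx.
  have restR s : lower_ideal n (rest (j s)).
    have [m [a [h [b [k [l [Aa Hh Bb ->]]]]]]] := triangular_span_ord tri s.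
    have rest0 : rest 0 = 0 by have := restB 0 0; rewrite !subrr.
    have restD a' b' : rest (a' + b') = rest a' + rest b'.
      by rewrite -{1}[b']opprK restB -[- b']sub0r restB rest0 sub0r opprK.
    rewrite rmorph_sum (big_morph rest restD rest0).
    apply: sums_sum => i _.
    have [Aai _] := Aa i; rewrite /rest.
    rewrite (eq_bigr (fun q => j (a i) *
      j ((eta q.1 (j (h i)) * beta q.2 (j (b i))) *: y q))) => [|q _]; last first.
      rewrite (gprod q _ _ _ _ Aai (Hh i) (Bb i)).
      by rewrite [in RHS]linearZ /= -scalerAl -scalerAr.
    rewrite -mulr_sumr -linear_sum; case: (leqP (l i) n) => ln.
      rewrite -(hb_le _ _ _ ln (Hh i) (Bb i)) -rmorphM mulrA subrr; exact: sums0.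
    rewrite big1 ?linear0 ?mulr0 ?subr0 => [|q _]; last first.
      by rewrite (beta0 _ _ ln (Bb i)) mulr0 scale0r.
    by apply: sums1; exists (j (a i * h i)), (l i), (b i); rewrite rmorphM.
  apply: lower_ideal_closed => e e0; have [e' e'0 he'] := small rest rest_b e e0.
  have [r' r'r] := dense r e' e'0; exists (rest (j r')) => //.
  by rewrite -[r - _]/(rest r) -restB; exact: he'.
- exists (fun q => eta q.1 (j h) * beta q.2 (j b)); split=> [q|ln|nl q].
  + exact: gprod Bb.
  + exact: hb_le Bb.
  + by rewrite (beta0 _ _ nl Bb) mulr0.
Qed.

End BanachTriangular.

(** * The completed category O *)

Section FiniteModules.
Variables (Rl : realType) (p : nat) (K : fieldType) (v : K -> Rl)
  (RB : algType K) (N : RB -> Rl) (R : algType K) (j : {lrmorphism R -> RB})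
  (G : int -> set R) (A B H : set R) (d : R).
Hypothesis hv : nonarch_abs v.
Hypothesis hp : 0 < v p%:R <= 2^-1.
Hypothesis K_char0 : forall n, n.+1%:R != 0 :> K.
Hypothesis hB : banach_algebra v N.
Hypothesis RB_noeth : left_noetherian RB.
Hypothesis btri : banach_triangular_decomposition v N j G A B H d.
Local Notation Abar := (closure_of N j A).
Hypothesis A_noeth : left_noetherian_over Abar.
Let bN : banach_space v N. Proof. by case: hB. Qed.
Let uN := banach_ultra hv bN.
Let tri := btri_alg btri.
Let A_alg : subalgebra A. Proof. by case: (tri_A tri). Qed.

Lemma Abar_subring : is_subring Abar.
Proof. exact: (closure_of_subring j hv hB A_alg). Qed.
Let Abar_closed : norm_closed N Abar. Proof. exact: (closure_of_closed hv hB). Qed.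
Let Abar_scalar (c : K) : Abar c%:A.
Proof.
have <- : j c%:A = c%:A by rewrite linearZ /= rmorph1.
by apply: (closure_of_mem j hv hB); apply: subalgebraZ A_alg _; case: A_alg.
Qed.

Lemma presentation (M : lmodType RB) : fin_gen M ->
  exists r (f : {linear 'rV[RB]_r -> M}), forall m, exists x, f x = m.
Proof.
move=> [r [g gM]]; have f_lin : linear (fun x : 'rV[RB]_r => \sum_i x 0 i *: g i).
  move=> a x y; rewrite scaler_sumr -big_split /=; apply: eq_bigr => i _.
  by rewrite !mxE scalerDl scalerA.
exists r, (pack_linear f_lin) => m; have [a [_ mE]] := gM m.
by exists (\row_i a i); rewrite mE; apply: eq_bigr => i _; rewrite mxE.
Qed.

Lemma fin_gen_of_span (S : set RB) (M : lmodType RB) (I : finType) (e : I -> M) :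
  span_over S e = setT -> fin_gen_over S M.
Proof.
move=> eM; exists #|I|, (fun i => e (enum_val i)) => x.
have [a [Sa ->]] : span_over S e x by rewrite eM.
exists (fun i => a (enum_val i)); split=> [i //|].
by rewrite (reindex_onto enum_val enum_rank)/= => [|i _]; [apply: eq_bigl => i|];
  rewrite ?enum_valK ?eqxx ?enum_rankK.
Qed.

Lemma fin_gen_over_fin_gen (S : set RB) (M : lmodType RB) : fin_gen_over S M -> fin_gen M.
Proof.
move=> [r [g gM]]; exists r, g => x; have [a [_ xE]] := gM x.
by exists a.
Qed.

Section Module.
Variables (M : lmodType RB).
Local Notation X := (restrict_scalars (in_alg RB) M).
Local Notation D := (@act K RB M (j d)).

(** Leibniz rule for the action of [d]. *)
Lemma gen_eigen_scale b t lam (m : X) : adjoint (j d) b = t *: b ->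
  gen_eigen D lam m -> gen_eigen D (lam + t) (b *: (m : M) : X).
Proof.
move=> bt [k]; elim: k m => [|k IH] m.
  by move=> /= ->; exists 0%N; rewrite /= (scaler0 M b).
rewrite iterSr => /IH[l hl]; exists l.+1; rewrite iterSr.
rewrite (_ : shift D (lam + t) _ = (b *: (shift D lam m : M) : X))//.
rewrite /shift /act -[(lam + t) *: (_ : X)]/((lam + t)%:A *: (b *: (m : M))).
rewrite -[lam *: m]/(lam%:A *: (m : M)).
have E : j d * b - (lam + t) *: b = b * (j d - lam%:A).
  rewrite mulrBr -scalerAr mulr1 scalerDl -bt /adjoint opprD opprB addrCA.
  by rewrite [j d * b + _]addrC subrK addrC.
transitivity ((j d * b - (lam + t) *: b) *: (m : M)).
  rewrite [RHS]scalerBl !scalerA -scalerAl mul1r; congr (_ - _).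
  exact: (scalerA (j d) b m).
by rewrite E -scalerA; congr (b *: _); rewrite scalerBl.
Qed.

Lemma module_submod_closed r (f : {linear 'rV[RB]_r -> M}) (Z : set M) :
  (forall m, exists x, f x = m) -> is_submod Z ->
  norm_closed (@row_norm _ _ RB N r) [set x | Z (f x)].
Proof.
move=> f_surj [Z0 ZD ZZ].
have M_fg : fin_gen_over setT M.
  exists r, (fun i => f (delta_mx 0 i)) => m; have [x <-] := f_surj m.
  exists (fun i => x 0 i); split=> //; rewrite {1}(row_sum_delta x) linear_sum.
  by apply: eq_bigr => i _; rewrite linearZ.
apply: (submod_closed hv hp hB RB_noeth (S := setT)) => //; split=> // [x y Zx Zy|a x _].
  exact: (submodB (And3 Z0 ZD ZZ)).
exact: ZZ.
Qed.

Section Generated.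
Variables (I : finType) (e : I -> M) (lam : I -> K).
Hypothesis he : forall i, gen_eigen D (lam i) (e i).
Hypothesis eM : span_over Abar e = setT.

Lemma expand_element x : exists (a : I -> RB) (c : I -> K -> RB),
  [/\ x = \sum_i a i *: e i, forall i, has_sum N (c i) (a i) &
    forall i t, c i t = 0 \/ exists2 n : nat, t = n%:R & (j @` A_ G A n) (c i t)].
Proof.
have [a [Sa xE]] : span_over Abar e x by rewrite eM.
have /choice[c cP] i := A_expansion hv K_char0 hB btri (Sa i).
exists a, c; split=> // [i|i t]; first by have [] := cP i.
have [_ cn] := cP i; case/(_ t) => [->|[n tn]]; first by left.
by right; exists n => //; have := cn n; rewrite tn.
Qed.

Let A_eigen n b : (j @` A_ G A n) b -> adjoint (j d) b = n%:R *: b.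
Proof.
move=> [y Ay <-]; rewrite -linearZ /= -(A_adjoint btri Ay).
by rewrite /adjoint rmorphB !rmorphM.
Qed.

Let c_eigen (c : K -> RB) : (forall t, c t = 0 \/ exists2 n : nat, t = n%:R &
  (j @` A_ G A n) (c t)) -> forall t, adjoint (j d) (c t) = t *: c t.
Proof.
move=> cA t; case: (cA t) => [->|[n -> /A_eigen //]].
by rewrite linear0 scaler0.
Qed.

Lemma component_eigen (c : I -> K -> RB) mu :
  (forall i t, c i t = 0 \/ exists2 n : nat, t = n%:R & (j @` A_ G A n) (c i t)) ->
  gen_eigen D mu (\sum_i c i (mu - lam i) *: e i).
Proof.
move=> cA; apply: (is_subspace_sum (V := X)) => [|i _].
  exact: gen_eigen_subspace.
have := gen_eigen_scale (c_eigen (cA i) (mu - lam i)) (he i).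
by rewrite addrC subrK.
Qed.

Lemma component_mem (W : set M) (c : I -> K -> RB) (a : I -> RB) mu :
  is_submod W -> (forall i, has_sum N (c i) (a i)) ->
  (forall i t, c i t = 0 \/ exists2 n : nat, t = n%:R & (j @` A_ G A n) (c i t)) ->
  W (\sum_i a i *: e i) -> W (\sum_i c i (mu - lam i) *: e i).
Proof.
move=> hW c_sum cA.
have [r [f f_surj]] := presentation (fin_gen_over_fin_gen (fin_gen_of_span eM)).
apply: (weight_component hv hp K_char0 hB f_surj hW (module_submod_closed f_surj hW) he) => //.
  by move=> i; exact: c_eigen (cA i).
by move=> i t; case: (cA i t) => [->|[n -> _]]; [left|right; exists n].
Qed.

(** Add [x] to the generators; the relation [x - \sum_i a i *: e i = 0] holds
    in each weight. *)
Lemma gen_eigen_span mu (x : M) : gen_eigen D mu x ->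
  exists a : I -> R, x = \sum_i j (a i) *: e i /\
    forall i, a i = 0 \/ exists2 n : nat, mu = lam i + n%:R & A_ G A n (a i).
Proof.
move=> hx; have [a [c [xE c_sum cA]]] := expand_element x.
pose e' (i : option I) := if i is Some i then e i else x.
pose lam' (i : option I) := if i is Some i then lam i else mu.
pose c' (i : option I) := if i is Some i then c i else fun t => if t == 0 then -1 else 0.
pose a' (i : option I) := if i is Some i then a i else -1.
have [r [f f_surj]] := presentation (fin_gen_over_fin_gen (fin_gen_of_span eM)).
have h0 : is_submod ([set 0] : set M).
  split=> // [y z -> ->|b y ->]; [exact: addr0|exact: scaler0].
have sum_option (F : option I -> M) : \sum_i F i = F None + \sum_i F (Some i).
  rewrite (bigD1 None)//=; congr (_ + _).
  rewrite (reindex_omap Some id) => [|[i|]]//=; apply: eq_bigl => i.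
  by rewrite eqxx.
have he' i : exists k, iter k (shift D (lam' i)) (e' i) = 0.
  by case: i => [i|]; [exact: he|exact: hx].
have c'_eigen i t : adjoint (j d) (c' i t) = t *: c' i t.
  case: i => [i|] /=; first exact: c_eigen (cA i) t.
  case: eqP => [->|_]; last by rewrite linear0 scaler0.
  by rewrite /adjoint mulrN1 mulN1r subrr scale0r.
have c'_nat i t : c' i t = 0 \/ exists n : nat, t = n%:R.
  case: i => [i|] /=; first by case: (cA i t) => [->|[n -> _]]; [left|right; exists n].
  by case: eqP => [->|_]; [right; exists 0%N|left].
have c'_sum i : has_sum N (c' i) (a' i).
  by case: i => [i|]; [exact: c_sum|exact: (has_sum1 hv bN 0 (-1))].
have := weight_component hv hp K_char0 hB f_surj h0 (module_submod_closed f_surj h0)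
  he' c'_eigen c'_nat c'_sum mu.
rewrite !sum_option /= subrr eqxx scaleN1r -xE addNr => /(_ erefl) wE.
have {wE} xE' : x = \sum_i c i (mu - lam i) *: e i.
  by apply/eqP; rewrite eq_sym -subr_eq0 addrC wE.
have /choice[b bP] i : exists b, c i (mu - lam i) = j b /\
    (b = 0 \/ exists2 n : nat, mu = lam i + n%:R & A_ G A n b).
  case: (cA i (mu - lam i)) => [->|[n tn [b Ab <-]]].
    by exists 0; rewrite linear0; split=> //; left.
  by exists b; split=> //; right; exists n; rewrite // -tn addrC subrK.
exists b; split=> [|i]; last by have [] := bP i.
by rewrite {1}xE'; apply: eq_bigr => i _; have [-> _] := bP i.
Qed.

Let sum_shift (c : K -> RB) a t : has_sum N c a -> has_sum N (fun l => c (l - t)) a.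
Proof.
move=> ca e0 e00; have [F0 h] := ca e0 e00.
exists [fset (l + t)%R | l in F0]%fset => F F0F.
have inj : injective (fun l => l - t) by move=> x y /addIr.
have := h [fset (l - t)%R | l in F]%fset; rewrite big_imfset /=; last by move=> x y _ _ /inj.
apply; apply/fsubsetP => l lF0; apply/imfsetP; exists (l + t); rewrite ?addrK//=.
by apply: (fsubsetP F0F); apply/imfsetP; exists l.
Qed.

(** Finitely many expansions are truncated at a common finite set of weights; the lifts
    [e' i] transport the estimate to the presentation. *)
Lemma partial_sums_converge (a : I -> RB) (c : I -> K -> RB) r
    (f : {linear 'rV[RB]_r -> M}) (e' : I -> 'rV[RB]_r) (eps : Rl) :
  (forall i, has_sum N (c i) (a i)) -> 0 < eps -> exists F0 : {fset K},
  forall F : {fset K}, (F0 `<=` F)%fset ->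
    row_norm N (\sum_i (\sum_(l <- F) c i (l - lam i)) *: e' i - \sum_i a i *: e' i) < eps.
Proof.
move=> c_sum eps0; have uR := row_norm_ultra hv hB r.
have [C C0 hC] := row_normZ hv hB r.
have /choice[F FP] i : exists F0 : {fset K}, forall F : {fset K}, (F0 `<=` F)%fset ->
    row_norm N ((\sum_(l <- F) c i (l - lam i) - a i) *: e' i) < eps.
  have e1 : 0 < Num.max (row_norm N (e' i)) 1 by rewrite lt_max ltr01 orbT.
  have [F0 h] := sum_shift (lam i) (c_sum i) (divr_gt0 eps0 (mulr_gt0 C0 e1)).
  exists F0 => F /h {}h; apply: le_lt_trans (hC _ _) _; rewrite -mulrA mulrCA.
  apply: (@le_lt_trans _ _ (N (\sum_(l <- F) c i (l - lam i) - a i) *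
      (C * Num.max (row_norm N (e' i)) 1))).
    by rewrite ler_wpM2l ?(ultra_ge0 uN)// ler_pM2l// le_max lexx.
  by rewrite -ltr_pdivlMr ?mulr_gt0.
exists (\bigcup_(i <- enum I) F i)%fset => F' FF'.
rewrite -sumrB; apply: (ultra_sumlt uR) => // i _; rewrite -scalerBl; apply: FP.
by apply: fsubset_trans FF'; apply: (bigfcup_sup F (j := i)); rewrite // mem_enum.
Qed.

(** The weight components of an element are obtained from the expansions of its
    coefficients, and their sums converge by [partial_sums_converge]. *)
Lemma generated_weight_decomposition :
  weight_decomposition (V := X) (canonical_open N (M := M)) setT (fun m : M => j d *: m).
Proof.
exists (weights (V := X) setT (fun m : M => j d *: m)); split=> // x _.
have [a [c [xE c_sum cA]]] := expand_element x.
pose w l : X := \sum_i c i (l - lam i) *: e i.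
have w_weight l : weight_space (V := X) setT (fun m : M => j d *: m) l (w l).
  by split=> //; apply/(gen_eigenP D); exact: component_eigen.
exists w => [l _|U U_open Ux]; first exact: w_weight.
have [r [f f_surj]] := presentation (fin_gen_over_fin_gen (fin_gen_of_span eM)).
have /choice[e' e'P] i := f_surj (e i).
have f_lift (b : I -> RB) : f (\sum_i b i *: e' i) = \sum_i b i *: e i.
  by rewrite linear_sum; apply: eq_bigr => i _; rewrite linearZ /= e'P.
have Ufx : U (f (\sum_i a i *: e' i)) by rewrite f_lift -xE.
have [eps eps0 hU] := U_open r f f_surj _ Ufx.
have [F0 F0P] := partial_sums_converge f e' c_sum eps0.
pose isw l := `[< weights (V := X) setT (fun m : M => j d *: m) l >].
(* The components of an index that is not a weight vanish. *)
exists [fset l in F0 | isw l]%fset => [l|F F0F F_weights].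
  by rewrite !inE => /andP[_ /asboolP].
have -> : \sum_(l <- F) w l =
    f (\sum_i (\sum_(l <- (F `|` F0)%fset) c i (l - lam i)) *: e' i).
  rewrite f_lift [LHS](_ : _ = \sum_(l <- (F `|` F0)%fset) w l).
    under [RHS]eq_bigr do rewrite scaler_suml.
    by rewrite [RHS]exchange_big.
  apply: big_fset_incl; first exact: fsubsetUl.
  move=> l; rewrite !inE => lFF0 lF; apply: contrapT => /eqP wl0.
  have lw : weights (V := X) setT (fun m : M => j d *: m) l by exists (w l).
  move: lFF0; rewrite (negPf lF) /= => lF0; move/negP: lF; apply.
  by apply: (fsubsetP F0F); rewrite !inE lF0 /=; apply/asboolP.
apply: hU => i.
have := F0P (F `|` F0)%fset (fsubsetUr F F0); apply: le_lt_trans.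
by have := row_norm_ge N (\sum_i (\sum_(l <- (F `|` F0)%fset) c i (l - lam i)) *: e' i -
  \sum_i a i *: e' i) i; rewrite !mxE.
Qed.

(** The span of the weight vectors of a submodule is closed and contains the weight
    components of its elements. *)
Lemma submodule_eigen_span (W : set M) : is_submod W ->
  W `<=` sums [set x | exists b w, [/\ Abar b, W w, exists nu, gen_eigen D nu w & x = b *: w]].
Proof.
move=> hW; set V := sums _.
have hV : is_submod_over Abar V.
  have VZ b x : Abar b -> V x -> V (b *: x).
    move=> Ab; move=> Vx; apply: (sums_bind (f := fun x => b *: x)) Vx _.
    - by rewrite scaler0.
    - by move=> y z; rewrite scalerDr.
    move=> _ [b' [w [Ab' Ww hw ->]]]; apply: sums1; exists (b * b'), w.
    by split; rewrite ?scalerA//; exact: (subringM Abar_subring).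
  split=> [|x y Vx Vy|b x]; [exact: sums0| |exact: VZ].
  apply: sumsD => //; rewrite -scaleN1r; apply: VZ => //.
  by apply: (subringN Abar_subring); exact: (subring1 Abar_subring).
have M_fg := fin_gen_of_span eM.
have [r [f f_surj]] := presentation (fin_gen_over_fin_gen M_fg).
have V_closed := submod_closed hv hp hB RB_noeth Abar_subring Abar_scalar Abar_closed
  A_noeth M_fg hV f_surj.
move=> x Wx; have [a [c [xE c_sum cA]]] := expand_element x.
have /choice[e' e'P] i := f_surj (e i).
have f_lift (b : I -> RB) : f (\sum_i b i *: e' i) = \sum_i b i *: e i.
  by rewrite linear_sum; apply: eq_bigr => i _; rewrite linearZ /= e'P.
rewrite xE -f_lift; apply: V_closed => eps eps0.
have [F0 F0P] := partial_sums_converge f e' c_sum eps0.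
exists (\sum_i (\sum_(l <- F0) c i (l - lam i)) *: e' i); last exact: F0P.
rewrite /= f_lift; under eq_bigr do rewrite scaler_suml.
rewrite exchange_big /=; apply: sums_sum => l _; apply: sums1.
exists 1, (\sum_i c i (l - lam i) *: e i); split.
- exact: (subring1 Abar_subring).
- by apply: (component_mem l hW c_sum cA); rewrite -xE.
- by exists l; exact: component_eigen.
- by rewrite scale1r.
Qed.
End Generated.

(** Finitely many generators of [U] involve finitely many elements of [Y]. *)
Lemma noetherian_span_generators (Y U : set M) : fin_gen_over Abar M ->
  is_submod_over Abar U -> U `<=` sums [set x | exists b w, [/\ Abar b, Y w & x = b *: w]] ->
  exists (I : finType) (e : I -> M), (forall i, Y (e i)) /\ U `<=` span_over Abar e.
Proof.
move=> [s [g gM]] hU UY.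
have [|k [u [Uu uU]]] := noetherian_fin_gen_submod Abar_subring (g := g) A_noeth hU.
  by move=> x _; exact: gM.
have [I [e' [e'Y ue']]] := refine_generators Abar_subring (fun i => UY _ (Uu i)).
have /choice[e eP] i : exists w, Y w /\ exists2 b, Abar b & e' i = b *: w.
  by have [b [w [Ab Yw ->]]] := e'Y i; exists w; split=> //; exists b.
exists I, e; split=> [i|x /uU/ue']; first by have [] := eP i.
apply: span_over_min; first exact: (span_over_submod Abar_subring).
move=> i; have [_ [b Ab ->]] := eP i.
have [_ _ hZ] := span_over_submod Abar_subring e; apply: hZ => //.
exact: (mem_span_over Abar_subring).
Qed.

End Module.

Definition weight_generated (M : lmodType RB) :=
  exists (I : finType) (e : I -> M) (lam : I -> K),
    (forall i, gen_eigen (@act K RB M (j d)) (lam i) (e i)) /\ span_over Abar e = setT.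

(** Convergent sums of weight vectors lie in the span of the weight vectors over the
    closure of [A], because this span is closed; so it is the whole module, and
    finitely many weight vectors suffice as the module is noetherian. *)
Lemma categoryOhatP (M : LMod RB) : categoryOhat N j A d M <-> weight_generated M.
Proof.
split=> [[M_fg M_fgA [I [I_weights I_dec]]]|[I [e [lam [he eM]]]]]; last first.
  have M_fg := fin_gen_of_span eM; split=> //.
  - exact: fin_gen_over_fin_gen M_fg.
  - exact: generated_weight_decomposition he eM.
pose Y : set M := [set w | exists nu, gen_eigen (@act K RB M (j d)) nu w].
set V := sums [set x | exists b w, [/\ Abar b, Y w & x = b *: w]].
have VY w : Y w -> V w.
  move=> Yw; apply: sums1; exists 1, w; rewrite scale1r; split=> //.
  exact: (subring1 Abar_subring).
have hV : is_submod_over Abar V.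
  have VZ b x : Abar b -> V x -> V (b *: x).
    move=> Ab; move=> Vx; apply: (sums_bind (f := fun x => b *: x)) Vx _.
    - by rewrite scaler0.
    - by move=> y z; rewrite scalerDr.
    move=> _ [b' [w [Ab' Yw ->]]]; apply: sums1; exists (b * b'), w.
    by split; rewrite ?scalerA//; exact: (subringM Abar_subring).
  split=> [|x y Vx Vy|b x]; [exact: sums0| |exact: VZ].
  apply: sumsD => //; rewrite -scaleN1r; apply: VZ => //.
  by apply: (subringN Abar_subring); exact: (subring1 Abar_subring).
have VT : V = setT.
  apply/seteqP; split=> // x _; apply: contrapT => nVx.
  have [w wW wx] := I_dec x Logic.I.
  have [||F0 F0I F0P] := wx [set y | ~ V y] => //.
    move=> r f f_surj y nVy; apply: contrapT => ne; apply: nVy.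
    apply: (submod_closed hv hp hB RB_noeth Abar_subring Abar_scalar Abar_closed
      A_noeth M_fgA hV f_surj) => eps eps0.
    apply: contrapT => nz; apply: ne; exists eps => // z zy Vz; apply: nz.
    exists z => //; apply: row_norm_lt => // i; rewrite !mxE; exact: zy.
  apply: (F0P F0 (fsubset_refl _) F0I); rewrite big_seq; apply: sums_sum => l lF0.
  have [_ /(gen_eigenP (@act K RB M (j d))) hl] := wW l (F0I l lF0).
  by apply: VY; exists l.
have hT : is_submod_over Abar (setT : set M) by [].
have TV : setT `<=` V by rewrite VT.
have [I' [e [eY eM]]] := noetherian_span_generators M_fgA hT TV.
have /choice[lam lamP] i := eY i.
by exists I', e, lam; split=> //; apply/seteqP; split=> // x _; exact: eM.
Qed.

Let shift_map (M M' : lmodType RB) (f : lmod_hom M M') nu m :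
  shift (@act K RB M' (j d)) nu (f m) = f (shift (@act K RB M (j d)) nu m).
Proof.
transitivity (f (j d *: m - nu%:A *: m)); last by [].
by rewrite linearB !(linearZ_LR f); reflexivity.
Qed.

Let iter_shift_map (M M' : lmodType RB) (f : lmod_hom M M') nu k m :
  iter k (shift (@act K RB M' (j d)) nu) (f m) = f (iter k (shift (@act K RB M (j d)) nu) m).
Proof. by elim: k => //= k ->; rewrite shift_map. Qed.

Lemma gen_eigen_map (M M' : lmodType RB) (f : lmod_hom M M') nu m :
  gen_eigen (@act K RB M (j d)) nu m -> gen_eigen (@act K RB M' (j d)) nu (f m).
Proof.
by move=> [k hk]; exists k; rewrite iter_shift_map hk; exact: linear0.
Qed.

Lemma gen_eigen_map_inj (M M' : lmodType RB) (f : lmod_hom M M') nu m : injective f ->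
  gen_eigen (@act K RB M' (j d)) nu (f m) -> gen_eigen (@act K RB M (j d)) nu m.
Proof.
move=> f_inj [k hk]; exists k; apply: f_inj.
by rewrite -iter_shift_map hk; exact: (esym (linear0 f)).
Qed.

(** The weight components of an element of a submodule lie in the submodule, by
    [weight_component], so that the submodule is spanned by weight vectors. *)
Lemma categoryOhat_submodules : closed_under_submodules (categoryOhat N j A d).
Proof.
move=> M M' i i_inj /categoryOhatP[I [e [lam [he eM]]]]; apply/categoryOhatP.
have hW := im_submod i; have [W0 WD WZ] := hW.
have hW' : is_submod_over Abar [set x | exists y, i y = x].
  by split=> // [x y Wx Wy|b x _]; [exact: (submodB hW)|exact: WZ].
have [|I' [e' [e'Y We']]] := noetherian_span_generators (fin_gen_of_span eM)
    (Y := [set w | (exists y, i y = w) /\ exists nu, gen_eigen (@act K RB M (j d)) nu w]) hW'.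
  move=> x /(submodule_eigen_span he eM hW); apply: sums_sub => _ [b [w [Ab Ww hw ->]]].
  by apply: sums1; exists b, w.
have /choice[e'' e''P] k : exists y, i y = e' k /\ exists nu, gen_eigen (@act K RB M' (j d)) nu y.
  have [[y yE] [nu hnu]] := e'Y k; exists y; split=> //; exists nu.
  by apply: (gen_eigen_map_inj i_inj); rewrite yE.
have /choice[lam' lam'P] k : exists nu, gen_eigen (@act K RB M' (j d)) nu (e'' k).
  by have [] := e''P k.
exists I', e'', lam'; split=> //; apply/seteqP; split=> // y _.
have [|b [Ab yE]] := We' (i y); first by exists y.
exists b; split=> //; apply: i_inj; rewrite yE linear_sum; apply: eq_bigr => k _.
by rewrite linearZ /=; have [-> _] := e''P k.
Qed.

Lemma categoryOhat_quotients : closed_under_quotients (categoryOhat N j A d).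
Proof.
move=> M M' q q_surj /categoryOhatP[I [e [lam [he eM]]]]; apply/categoryOhatP.
exists I, (fun i => q (e i)), lam; split=> [i|]; first exact: gen_eigen_map.
apply/seteqP; split=> // y _; have [x <-] := q_surj y.
have [a [Aa ->]] : span_over Abar e x by rewrite eM.
by exists a; split=> //; rewrite linear_sum; apply: eq_bigr => i _; rewrite linearZ.
Qed.

Lemma categoryOhat_sums n (M : 'I_n -> lmodType RB) (S : lmodType RB)
    (i : forall k, lmod_hom (M k) S) :
  (forall x, exists y : forall k, M k, x = \sum_k i k (y k)) ->
  (forall k, categoryOhat N j A d (M k)) -> categoryOhat N j A d S.
Proof.
move=> i_surj hM; apply/categoryOhatP.
have h k : {I : finType & {e : I -> M k & {lam : I -> K |
    (forall i, gen_eigen (@act K RB (M k) (j d)) (lam i) (e i)) /\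
    span_over Abar e = setT}}}.
  have /categoryOhatP/cid[I /cid[e /cid[lam hh]]] := hM k.
  by exists I, e, lam.
pose I := {k : 'I_n & tag (h k)}.
pose e (z : I) : S := i (tag z) (tag (tagged (h (tag z))) (tagged z)).
pose lam (z : I) := sval (tagged (tagged (h (tag z)))) (tagged z).
exists I, e, lam; split=> [[k z]|].
  have [hk _] := svalP (tagged (tagged (h k))).
  exact: gen_eigen_map (hk z).
apply/seteqP; split=> // x _; have [y ->] := i_surj x.
have hS := span_over_submod Abar_subring e.
apply: (submod_over_sum _ hS) => k _.
have [_ eM] := svalP (tagged (tagged (h k))).
have [a [Aa ->]] : span_over Abar (tag (tagged (h k))) (y k) by rewrite eM.
rewrite linear_sum; apply: (submod_over_sum _ hS) => z _; rewrite linearZ.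
have [_ _ hZ] := hS; apply: hZ => //.
exact: (mem_span_over Abar_subring e (Tagged (fun k => tag (h k)) z)).
Qed.

End FiniteModules.

(** * Extension of scalars *)

Section PureTensors.
Variables (S T : nzRingType) (f : {rmorphism S -> T}) (M : lmodType S).
Local Notation E := (extend_scalars f M).

Definition pure (t : T) (m : M) : E := tens_pi f [:: (t, m)].

Lemma pureDl t t' m : pure (t + t') m = pure t m + pure t' m.
Proof. by rewrite -[RHS]/(tens_add _ _) tens_addE; apply/tens_piP; exact: tens_addl. Qed.
Lemma pureDr t m m' : pure t (m + m') = pure t m + pure t m'.
Proof. by rewrite -[RHS]/(tens_add _ _) tens_addE; apply/tens_piP; exact: tens_addr. Qed.
Lemma pure_balanced t s m : pure (t * f s) m = pure t (s *: m).
Proof. by apply/tens_piP; exact: tens_balanced. Qed.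
Lemma pureZ a t m : a *: pure t m = pure (a * t) m.
Proof. by rewrite -[LHS]/(tens_scale _ _) tens_scaleE. Qed.
Lemma pure0 t : pure t 0 = 0.
Proof. by apply: (addrI (pure t 0)); rewrite -pureDr !addr0. Qed.
Lemma pure0l m : pure 0 m = 0.
Proof. by apply: (addrI (pure 0 m)); rewrite -pureDl !addr0. Qed.
Lemma pure_suml (I : Type) (s : seq I) (P : pred I) (F : I -> T) m :
  pure (\sum_(i <- s | P i) F i) m = \sum_(i <- s | P i) pure (F i) m.
Proof. exact: (big_morph (pure^~ m) (fun t t' => pureDl t t' m) (pure0l m)). Qed.
Lemma pure_sumr (I : Type) (s : seq I) (P : pred I) t (F : I -> M) :
  pure t (\sum_(i <- s | P i) F i) = \sum_(i <- s | P i) pure t (F i).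
Proof. exact: (big_morph (pure t) (pureDr t) (pure0 t)). Qed.

Lemma tens_pi_pure u : tens_pi f u = \sum_(z <- u) pure z.1 z.2.
Proof.
elim: u => [|[t m] u IH]; first by rewrite big_nil.
rewrite big_cons -IH -[RHS]/(tens_add _ _) tens_addE; exact/tens_piP/tens_refl.
Qed.

Lemma pure_span x : exists (n : nat) (t : 'I_n -> T) (m : 'I_n -> M),
  x = \sum_i pure (t i) (m i).
Proof.
elim/tens_ind: x => u; exists (size u).
exists (fun i => (tnth (in_tuple u) i).1), (fun i => (tnth (in_tuple u) i).2).
by rewrite tens_pi_pure -(big_tuple _ _ _ predT (fun z => pure z.1 z.2)).
Qed.

Section Lift.
Variables (Q : zmodType) (F : T -> M -> Q).
Hypothesis FDl : forall t t' m, F (t + t') m = F t m + F t' m.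
Hypothesis FDr : forall t m m', F t (m + m') = F t m + F t m'.
Hypothesis F_bal : forall t s m, F (t * f s) m = F t (s *: m).

Let ev u := \sum_(z <- u) F z.1 z.2.

Let ev_rel u v : tens_rel f u v -> ev u = ev v.
Proof.
rewrite /ev; elim=> {u v} //= [u v w _ -> _ ->|u u' v v' _ uu' _ vv'|u v|m|t t' m|t m m'|t s m] //.
- by rewrite !big_cat /= uu' vv'.
- by rewrite !big_cat /= addrC.
- rewrite big_nil big_seq1 /=; apply: (addrI (F 0 m)).
  by rewrite -FDl !addr0.
- by rewrite !big_cons !big_nil /= !addr0 FDl.
- by rewrite !big_cons !big_nil /= !addr0 FDr.
- by rewrite !big_seq1 /= F_bal.
Qed.

Definition tensor_lift (x : E) : Q := ev (repr x).

Lemma tensor_lift_pure t m : tensor_lift (pure t m) = F t m.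
Proof.
by rewrite /tensor_lift (ev_rel (tens_reprP f [:: (t, m)])) /ev big_seq1.
Qed.

Lemma tensor_liftD x y : tensor_lift (x + y) = tensor_lift x + tensor_lift y.
Proof.
elim/tens_ind: x => u; elim/tens_ind: y => w; rewrite -[_ + _]/(tens_add _ _) tens_addE.
by rewrite /tensor_lift !(ev_rel (tens_reprP f _)) /ev big_cat.
Qed.

Lemma tensor_lift0 : tensor_lift 0 = 0.
Proof. by apply: (addrI (tensor_lift 0)); rewrite -tensor_liftD !addr0. Qed.
End Lift.

(** Half of the adjunction between extension and restriction of scalars; uniqueness is
    [extend_hom_eq]. *)
Lemma extend_hom (X : lmodType T) (g : M -> X) :
  (forall m m', g (m + m') = g m + g m') -> (forall s m, g (s *: m) = f s *: g m) ->
  exists h : lmod_hom E X, forall t m, h (pure t m) = t *: g m.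
Proof.
move=> gD gZ; pose F t m := t *: g m.
have FDl t t' m : F (t + t') m = F t m + F t' m by rewrite /F scalerDl.
have FDr t m m' : F t (m + m') = F t m + F t m' by rewrite /F gD scalerDr.
have F_bal t s m : F (t * f s) m = F t (s *: m) by rewrite /F gZ scalerA.
have lin : linear (tensor_lift F : E -> X).
  move=> a x y; rewrite tensor_liftD//; congr (_ + _).
  have [n [t [m ->]]] := pure_span x.
  have sumE k (z : 'I_k -> E) : tensor_lift F (\sum_i z i) = \sum_i tensor_lift F (z i).
    exact: (big_morph _ (tensor_liftD FDl FDr F_bal) (tensor_lift0 FDl FDr F_bal)).
  rewrite scaler_sumr !sumE scaler_sumr; apply: eq_bigr => i _.
  by rewrite pureZ !tensor_lift_pure// /F scalerA.
exists (pack_linear lin) => t m; exact: tensor_lift_pure.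
Qed.

Lemma extend_hom_eq (X : lmodType T) (h h' : lmod_hom E X) :
  (forall m, h (pure 1 m) = h' (pure 1 m)) -> h = h'.
Proof.
move=> hh'; apply: lmod_homP => x; have [n [t [m ->]]] := pure_span x.
rewrite !linear_sum; apply: eq_bigr => i _.
by rewrite -[t i]mulr1 -pureZ !linearZ /= hh'.
Qed.
End PureTensors.

Lemma extend_map_pure (S T : nzRingType) (f : {rmorphism S -> T}) (M M' : lmodType S)
  (g : lmod_hom M M') t m : extend_map f g (pure f t m) = pure f t (g m).
Proof. by rewrite [LHS]extend_map_funE. Qed.

Lemma extension_additive (S T : nzRingType) (f : {rmorphism S -> T}) :
  additive_functor (extension_of_scalars f).
Proof.
move=> M M' g g'; apply: extend_hom_eq => m /=.
by rewrite !extend_map_pure pureDr.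
Qed.

Section Functionals.
Variables (K : fieldType) (V : lmodType K).

(** The subspace [U] has finite codimension. By induction it is enlarged by those of
    the [x i] that keep [m] outside, until [m] spans a complement. *)
Lemma separating_functional (r : nat) (U : set V) (m : V) (x : 'I_r -> V) :
  is_subspace U -> ~ U m ->
  (forall y, exists a (c : 'I_r -> K), U (y - a *: m - \sum_i c i *: x i)) ->
  exists phi : V -> K, [/\ forall a y z, phi (a *: y + z) = a * phi y + phi z,
    forall u, U u -> phi u = 0 & phi m = 1].
Proof.
elim: r U x => [|r IH] U x hU Um span.
  have /choice[phi phiP] y : exists a, U (y - a *: m).
    by have [a [c]] := span y; rewrite big_ord0 subr0; exists a.
  have phiE y a : U (y - a *: m) -> phi y = a.
    move=> h; apply/eqP/negPn/negP => ne; apply: Um.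
    have h2 := is_subspaceB hU (phiP y) h.
    rewrite opprB addrC addrA subrK -scalerBl in h2.
    have := is_subspaceZ (a - phi y)^-1 hU h2.
    by rewrite scalerA mulVf ?scale1r// subr_eq0 eq_sym.
  exists phi; split=> [a y z|u Uu|].
  - apply: phiE; rewrite scalerDl opprD addrACA -scalerA -scalerBr.
    by have [_ h] := hU; apply: h.
  - by apply: phiE; rewrite scale0r subr0.
  - by apply: phiE; rewrite scale1r subrr; case: hU.
pose x' i := x (widen_ord (leqnSn r) i); set x0 := x ord_max.
have [[a0 Ua0]|nU] := pselect (exists a, U (x0 - a *: m)).
  apply: (IH U x') => // y; have [a [c]] := span y; rewrite big_ord_recr /= => h.
  exists (a + c ord_max * a0), (fun i => c (widen_ord (leqnSn r) i)).
  have := is_subspaceD hU h (is_subspaceZ (c ord_max) hU Ua0).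
  congr U; rewrite -/x0 scalerBr scalerA scalerDl !opprD !addrA.
  by rewrite subrK [LHS]addrAC.
pose U' : set V := [set y | exists c, U (y - c *: x0)].
have hU' : is_subspace U'.
  split=> [|a y z [c Uc] [c' Uc']]; first by exists 0; rewrite scale0r subr0; case: hU.
  exists (a * c + c'); rewrite scalerDl opprD addrACA -scalerA -scalerBr.
  by have [_ h] := hU; apply: h.
have [|y|phi [phiL phiU phim]] := IH U' x' hU'.
- move=> [c Uc]; have [c0|c0] := eqVneq c 0.
    by apply: Um; move: Uc; rewrite c0 scale0r subr0.
  apply: nU; exists c^-1; have := is_subspaceZ (- c^-1) hU Uc.
  by congr U; rewrite scalerBr scalerA mulNr mulVf// scaleN1r opprK scaleNr addrC.
- have [a [c]] := span y; rewrite big_ord_recr /= => h.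
  exists a, (fun i => c (widen_ord (leqnSn r) i)), (c ord_max).
  by move: h; congr U; rewrite opprD !addrA.
exists phi; split=> // u Uu; apply: phiU; exists 0.
by rewrite scale0r subr0.
Qed.

(** By induction, each of the [y i] is removed by a power of [T - nu i]. *)
Lemma gen_eigen_disjoint (T : {linear V -> V}) n (y : 'I_n -> V) (nu : 'I_n -> K)
    (J : finType) (z : J -> V) (nu' : J -> K) :
  (forall i, gen_eigen T (nu i) (y i)) -> (forall i, gen_eigen T (nu' i) (z i)) ->
  (forall i k, nu' k != nu i) -> \sum_i y i = \sum_i z i -> \sum_i y i = 0.
Proof.
elim: n y nu J z nu' => [|n IH] y nu J z nu' hy hz nunu' yz; first by rewrite big_ord0.
have [k hk] := hy ord_max.
have itersum (I : finType) (w : I -> V) : iter k (shift T (nu ord_max)) (\sum_i w i) =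
    \sum_i iter k (shift T (nu ord_max)) (w i).
  exact: (big_morph _ (iter_shiftD T _ k) (iter_shift0 T _ k)).
have hiter l mu x : gen_eigen T mu x -> gen_eigen T mu (iter l (shift T (nu ord_max)) x).
  by elim: l => //= l IHl /IHl; exact: gen_eigen_shift.
apply: (@gen_eigen_direct _ _ T (nu ord_max) _ J predT nu' z) => //.
exists k; rewrite itersum big_ord_recr /= hk addr0.
apply: (IH _ (fun i => nu (widen_ord (leqnSn n) i)) J
  (fun i => iter k (shift T (nu ord_max)) (z i)) nu') => //.
- by move=> i; exact: hiter.
- by move=> i; exact: hiter.
- by rewrite -[RHS]itersum -yz itersum big_ord_recr /= hk addr0.
Qed.
End Functionals.

(** * The equivalence of categories *)

Section Equivalence.
Variables (Rl : realType) (p : nat) (K : fieldType) (v : K -> Rl)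
  (RB : algType K) (N : RB -> Rl) (R : algType K) (j : {lrmorphism R -> RB})
  (G : int -> set R) (A B H : set R) (d : R).
Hypothesis hv : nonarch_abs v.
Hypothesis v_complete : complete_for v.
Hypothesis hp : 0 < v p%:R <= 2^-1.
Hypothesis K_char0 : forall n, n.+1%:R != 0 :> K.
Hypothesis hB : banach_algebra v N.
Hypothesis RB_noeth : left_noetherian RB.
Hypothesis btri : banach_triangular_decomposition v N j G A B H d.
Local Notation Abar := (closure_of N j A).
Hypothesis A_noeth : left_noetherian_over Abar.
Let bN : banach_space v N. Proof. by case: hB. Qed.
Let uN := banach_ultra hv bN.
Let tri := btri_alg btri.
Let A_alg : subalgebra A. Proof. by case: (tri_A tri). Qed.
Let Abar_ring : is_subring Abar. Proof. exact: Abar_subring hv hB btri. Qed.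
Local Notation OhatP := (categoryOhatP hv hp K_char0 hB RB_noeth btri A_noeth).

Local Notation iota := (pure j 1).
Local Notation DR M := (@act K R M d).
Local Notation DB X := (@act K RB X (j d)).

Section ModuleO.
Variable M : lmodType R.
Implicit Types (m : M) (s : R).

Lemma iotaZ s m : iota (s *: m) = j s *: iota m.
Proof. by rewrite pureZ mulr1 -pure_balanced mul1r. Qed.

Lemma pure_iota t m : pure j t m = t *: iota m.
Proof. by rewrite pureZ mulr1. Qed.

Lemma gen_eigen_iota nu m : gen_eigen (DR M) nu m ->
  gen_eigen (DB (extend_scalars j M)) nu (iota m).
Proof.
move=> [k hk]; exists k.
have sh (m' : M) : shift (DB (extend_scalars j M)) nu (iota m') = iota (shift (DR M) nu m').
  have jnu : j nu%:A = nu%:A by rewrite linearZ /= rmorph1.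
  transitivity (j d *: iota m' - nu%:A *: iota m'); first by [].
  transitivity (iota (d *: m' - nu%:A *: m')); last by [].
  rewrite -jnu -!iotaZ; apply/eqP; rewrite subr_eq -pureDr; apply/eqP.
  by rewrite subrK.
have E l (m' : M) : iter l (shift (DB (extend_scalars j M)) nu) (iota m') =
    iota (iter l (shift (DR M) nu) m').
  by elim: l => //= l ->; rewrite sh.
by rewrite E hk; exact: pure0.
Qed.

Hypothesis MO : categoryO G B (M : LMod R).

Let killed m : exists n, killed_above G B n m.
Proof. by have [_ /(_ m)[n h]] := MO; exists n; apply/upper_part_killed. Qed.

(** In [RB \otimes M] the elements of [B] move to the factor [m], which they kill. *)
Let lower_ideal_tensor n r m : killed_above G B n m -> lower_ideal j G B n r ->
  pure j r m = 0.
Proof.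
move=> hm hr; have [k [w [Xw ->]]] := sums_ord hr.
rewrite pure_suml big1// => i _; have [s [l [b [nl Bb ->]]]] := Xw i.
by rewrite pure_balanced (hm _ _ nl Bb) pure0.
Qed.

Section Generators.
Variables (I : finType) (e : I -> M) (lam : I -> K).
Hypothesis he : forall i, gen_eigen (DR M) (lam i) (e i).
Hypothesis eM : span_over A e = setT.

(** Modulo the left ideal that kills [m], an element of the Banach algebra is a finite
    combination of elements of [R] over the closure of [A]. *)
Lemma extend_span_over : span_over Abar (fun i => iota (e i)) = setT.
Proof.
apply/seteqP; split=> // x _; have hS := span_over_submod Abar_ring (fun i => iota (e i)).
have [_ _ hZ] := hS.
have iota_span m : span_over Abar (fun i => iota (e i)) (iota m).
  have [a [Aa ->]] : span_over A e m by rewrite eM.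
  rewrite pure_sumr; apply: (submod_over_sum _ hS) => i _; rewrite iotaZ.
  by apply: hZ; [exact: (closure_of_mem j hv hB)|exact: (mem_span_over Abar_ring)].
have [k [r [m ->]]] := pure_span x; apply: (submod_over_sum _ hS) => i _.
have [n hn] := killed (m i).
have [Q [y [g [gB gA gJ _]]]] :=
  triangular_expansion hv v_complete hp K_char0 hB RB_noeth btri n.
rewrite -(subrK (\sum_q g q (r i) * j (y q)) (r i)) pureDl (lower_ideal_tensor hn (gJ _)).
rewrite add0r pure_suml; apply: (submod_over_sum _ hS) => q _.
by rewrite pure_iota -scalerA -iotaZ; apply: hZ.
Qed.

(** For each [i] and [k] there is at most one such [n]. *)
Lemma weight_degree_bound (J : finType) (nu : J -> K) : exists n0, forall i k (n : nat),
  lam i + n%:R = nu k -> (n <= n0)%N.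
Proof.
have /choice[deg degP] (ik : I * J) : exists n0, forall n : nat,
    lam ik.1 + n%:R = nu ik.2 -> n = n0.
  have [[n0 En0]|ne] := pselect (exists n0 : nat, lam ik.1 + n0%:R = nu ik.2).
    exists n0 => n; rewrite -En0 => /addrI; exact: natr_inj_char0.
  by exists 0%N => n En; case: ne; exists n.
exists (\max_ik deg ik) => i k n /(degP (i, k)) ->.
exact: (leq_bigmax (i, k)).
Qed.

Let A_mul k l a b : A_ G A k a -> A_ G A l b -> A_ G A (k + l) (a * b).
Proof.
move=> [Aa Ga] [Ab Gb]; have [_ _ AM] := A_alg; split; first exact: AM.
by rewrite PoszD; have [_ _ h _ _] := tri_grading tri; exact: h.
Qed.

Let A_weight n a i : A_ G A n a -> gen_eigen (DR M) (lam i + n%:R) (a *: e i).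
Proof.
move=> Aa; have [_ Ga] := Aa; have ad_a : adjoint d a = n%:R *: a.
  exact: (A_adjoint btri Aa).
have [k] := he i; elim: k (e i) => [|k IH] m.
  by move=> /= ->; exists 0%N; exact: (scaler0 M a).
rewrite iterSr => /IH[l hl]; exists l.+1; rewrite iterSr -[RHS]hl; congr iter.
transitivity ((d * a - (lam i + n%:R)%:A * a) *: m).
  rewrite [RHS]scalerBl -!scalerA; reflexivity.
transitivity (a *: (d *: m - (lam i)%:A *: m)); last by [].
rewrite -scalerBl scalerA; congr (fun r : R => r *: m).
rewrite mulrBr -scalerAl mul1r -scalerAr mulr1 scalerDl -ad_a /adjoint opprD opprB addrCA.
by rewrite [d * a + _]addrC subrK addrC.
Qed.

Let A_component x : exists (n : nat) (a : 'I_n -> R) (i : 'I_n -> I) (k : 'I_n -> nat),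
  (forall t, A_ G A (k t) (a t)) /\ x = \sum_t a t *: e (i t).
Proof.
have [a [Aa ->]] : span_over A e x by rewrite eM.
pose Y : set M := [set y | exists a i k, A_ G A k a /\ y = a *: e i].
have /sums_ord[n [y [Yy ->]]] : sums Y (\sum_i a i *: e i).
  apply: sums_sum => i _.
  apply: (sums_bind (f := fun b => b *: e i)) (A_sums tri (Aa i)) _.
  - exact: scale0r.
  - by move=> b b'; exact: scalerDl.
  by move=> b [k _ Ab]; apply: sums1; exists b, i, k.
have /choice[t tP] (s : 'I_n) : exists t : R * I * nat, A_ G A t.2 t.1.1 /\ y s = t.1.1 *: e t.1.2.
  by have [b [i [k h]]] := Yy s; exists (b, i, k).
exists n, (fun q => (t q).1.1), (fun q => (t q).1.2), (fun q => (t q).2).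
split=> [q|]; first by have [] := tP q.
by apply: eq_bigr => q _; have [] := tP q.
Qed.

(** For large [l] the weights of [A_ l *: M] are not weights of [m], and these spaces
    together span a subspace of finite codimension, as the [A_ l] are
    finite-dimensional. *)
Lemma truncated_functional (m : M) : m <> 0 -> exists (k : nat) (phi : M -> K),
  [/\ forall (a : K) y z, phi (a%:A *: y + z) = a * phi y + phi z,
    forall l a y, (k < l)%N -> A_ G A l a -> phi (a *: y) = 0 & phi m = 1].
Proof.
move=> m0; pose X := restrict_scalars (in_alg R) M.
have [n [a [i [l [Aa mE]]]]] := A_component m.
have [k hk] := weight_degree_bound (fun t : 'I_n => lam (i t) + (l t)%:R).
pose high : set M := [set y | exists b i' l', [/\ (k < l')%N, A_ G A l' b & y = b *: e i']].
pose U : set X := sums high.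
have A_scale l' (c : K) b : A_ G A l' b -> A_ G A l' (c *: b).
  move=> [Ab Gb]; split; first exact: subalgebraZ.
  have [+ _ _ _ _] := tri_grading tri; move=> /(_ l'%:Z)[G0 GL].
  by rewrite -[_ *: _]addr0; exact: GL.
have hU : is_subspace U.
  split=> [|c x y Ux Uy]; first exact: sums0.
  apply: sumsD => //.
  apply: (@sums_bind X X high high (fun y : X => c *: y)) Ux _ => //.
  - exact: scaler0.
  - by move=> z w; exact: scalerDr.
  move=> _ [b [i' [l' [kl' Ab ->]]]]; apply: sums1; exists (c *: b), i', l'; split=> //.
    exact: A_scale.
  by rewrite -[c *: (_ : X)]/(c%:A *: (b *: e i')) scalerA -scalerAl mul1r.
have Um : ~ U m.
  move=> /sums_ord[n' [z [Xz mz]]]; apply: m0; rewrite mE.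
  have /choice[w wP] (s : 'I_n') : exists w : I * nat, (k < w.2)%N /\
      gen_eigen (DR M) (lam w.1 + w.2%:R) (z s).
    have [b [i' [l' [kl' Ab ->]]]] := Xz s; exists (i', l'); split=> //.
    exact: A_weight.
  apply: (@gen_eigen_disjoint K X (DR M) n (fun t => a t *: e (i t))
    (fun t => lam (i t) + (l t)%:R) _ z (fun q => lam (w q).1 + (w q).2%:R)).
  - by move=> t; exact: A_weight.
  - by move=> q; have [] := wP q.
  - move=> t q; apply/eqP => /hk; have [h _] := wP q.
    by rewrite leqNgt h.
  - by rewrite -mz -mE.
have /choice[bas basP] l' : exists bas : {r & 'I_r -> R}, forall x, A_ G A l' x ->
    exists c : 'I_(projT1 bas) -> K, x = \sum_i c i *: projT2 bas i.
  by have [r [g [_ h]]] := tri_A_fin tri l'%:Z; exists (existT _ r g).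
pose L := {l' : 'I_k.+1 & 'I_(projT1 (bas l'))}.
pose J : finType := (I * L)%type.
pose x (q : J) : X := projT2 (bas (tag q.2)) (tagged q.2) *: e q.1.
have span_x y : exists c : J -> K, U (y - \sum_q c q *: x q).
  pose W : set X := [set y | exists c : J -> K, U (y - \sum_q c q *: x q)].
  have hW : is_subspace W.
    split=> [|b y1 y2 [c Uc] [c' Uc']].
      exists (fun=> 0); rewrite big1 ?subr0; first exact: sums0.
      by move=> q _; rewrite scale0r.
    exists (fun q => b * c q + c' q).
    have := is_subspaceD hU (is_subspaceZ b hU Uc) Uc'.
    congr U; rewrite scalerBr addrACA -opprD scaler_sumr -big_split /=.
    by congr (_ - _); apply: eq_bigr => q _; rewrite scalerDl scalerA.
  have [n1 [a1 [i1 [l1 [Aa1 ->]]]]] := A_component y.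
  have : forall t, W (a1 t *: e (i1 t)); last first.
    move=> Wt; exact: (@is_subspace_sum K X W 'I_n1 (index_enum _) xpredT
      (fun t => a1 t *: e (i1 t)) hW (fun t _ => Wt t)).
  move=> t; case: (leqP (l1 t) k) => lk; last first.
    exists (fun=> 0); rewrite big1 => [|q _]; last exact: scale0r.
    by rewrite subr0; apply: sums1; exists (a1 t), (i1 t), (l1 t).
  have [c cE] := basP _ _ (Aa1 t); pose l'' : 'I_k.+1 := Ordinal (lk : (l1 t < k.+1)%N).
  have Wx q : W (x q).
    exists (fun q' => (q' == q)%:R); rewrite (bigD1 q)//= eqxx scale1r big1 ?addr0.
      by rewrite subrr; exact: sums0.
    by move=> q' /negPf ->; rewrite scale0r.
  rewrite cE scaler_suml; apply: (is_subspace_sum (V := X)) => // u _.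
  rewrite (_ : _ *: e _ = c u *: x (i1 t, Tagged (fun l' : 'I_k.+1 => 'I_(projT1 (bas l')))
    (i := l'') u)); first exact: is_subspaceZ.
  rewrite -[RHS]/((c u)%:A *: (projT2 (bas (l1 t)) u *: e (i1 t))) scalerA.
  by rewrite -scalerAl mul1r.
have [|phi [phiL phiU phim]] :=
    @separating_functional K X #|J| U m (fun i => x (enum_val i)) hU Um.
  move=> y; have [c Uc] := span_x y; exists 0, (fun i => c (enum_val i)).
  rewrite scale0r subr0; move: Uc; congr (U (_ - _)).
  rewrite (reindex_onto enum_val enum_rank)/= => [|q _]; last by rewrite enum_rankK.
  by apply: eq_bigl => q; rewrite enum_valK eqxx.
exists k, phi; split=> // l' b y kl' Ab; apply: phiU.
have [n1 [a1 [i1 [l1 [Aa1 ->]]]]] := A_component y.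
rewrite scaler_sumr; apply: sums_sum => t _; rewrite scalerA; apply: sums1.
exists (b * a1 t), (i1 t), (l' + l1 t)%N; split=> //; last exact: A_mul.
by rewrite ltn_addr.
Qed.

(** The value of [phi] at [s *: m] involves only the components of [s] of bounded
    degree in [A] and [B], and their coordinates are defined and bounded on the whole
    Banach algebra. *)
Lemma orbit_functional k (phi : M -> K) m :
  (forall (a : K) y z, phi (a%:A *: y + z) = a * phi y + phi z) ->
  (forall l a y, (k < l)%N -> A_ G A l a -> phi (a *: y) = 0) ->
  exists F : RB -> K, [/\ forall x y, F (x - y) = F x - F y,
    exists C, forall x, v (F x) <= C * N x & forall s, F (j s) = phi (s *: m)].
Proof.
move=> phiL phi0; have [n hn] := killed m.
have phi00 : phi 0 = 0.
  by have := phiL (-1) 0 0; rewrite scaler0 add0r mulN1r addNr.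
have phiD y z : phi (y + z) = phi y + phi z.
  by rewrite -[y]scale1r -[1 in LHS]scale1r phiL mul1r !scale1r.
have phiZ (c : K) y : phi (c%:A *: y) = c * phi y.
  by rewrite -[_ *: y]addr0 phiL phi00 addr0.
have phiZ' (c : K) s y : phi ((c *: s) *: y) = c * phi (s *: y).
  by rewrite -phiZ scalerA -scalerAl mul1r.
have phi_sum (J : finType) (F : J -> M) : phi (\sum_i F i) = \sum_i phi (F i).
  exact: (big_morph phi phiD phi00).
have [Q [y [g [gB gA _ gE]]]] :=
  triangular_expansion hv v_complete hp K_char0 hB RB_noeth btri n.
have [I' [x [xi [xiL xiB xiE xi0]]]] := A_coordinates hv v_complete hp K_char0 hB btri k.
have xiBB i a b : Abar a -> Abar b -> xi i (a - b) = xi i a - xi i b.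
  by move=> Aa Ab; rewrite addrC -scaleN1r xiL// mulN1r addrC.
pose F r := \sum_q \sum_i xi i (g q r) * phi ((x i * y q) *: m).
have FB a b : F (a - b) = F a - F b.
  rewrite /F -sumrB; apply: eq_bigr => q _; rewrite -sumrB; apply: eq_bigr => i _.
  by rewrite linearB xiBB// mulrBl.
have F0 : F 0 = 0 by have := FB 0 0; rewrite !subrr.
have FD a b : F (a + b) = F a + F b.
  by rewrite -{1}[b]opprK FB -[- b]sub0r FB F0 sub0r opprK.
exists F; split=> // [|s].
  have /choice[C CP] q := gB q; have /choice[C' CP'] i := xiB i.
  pose bound q i := Num.max (C' i) 0 * Num.max (C q) 0 * v (phi ((x i * y q) *: m)).
  have bound0 q i : 0 <= bound q i.
    by apply: mulr_ge0 (abs_ge0 hv _); apply: mulr_ge0; rewrite le_max lexx orbT.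
  exists (\big[Num.max/0]_q \big[Num.max/0]_i bound q i) => r.
  have uv := abs_ultra hv.
  have b0 : 0 <= \big[Num.max/0]_q \big[Num.max/0]_i bound q i by exact: bigmax_ge_id.
  apply: (ultra_sumle uv) => [|q _]; first by rewrite mulr_ge0// (ultra_ge0 uN).
  apply: (ultra_sumle uv) => [|i _]; first by rewrite mulr_ge0// (ultra_ge0 uN).
  apply: (@le_trans _ _ (bound q i * N r)); last first.
    rewrite ler_wpM2r ?(ultra_ge0 uN)//; apply: (bigmax_sup q) => //.
    exact: le_bigmax.
  rewrite (absM hv) /bound mulrAC; apply: ler_wpM2r; first exact: (abs_ge0 hv).
  apply: le_trans (CP' i _ (gA q r)) _.
  apply: (@le_trans _ _ (Num.max (C' i) 0 * N (g q r))).
    by rewrite ler_wpM2r ?(ultra_ge0 uN)// le_max lexx.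
  rewrite -mulrA ler_wpM2l ?le_max ?lexx ?orbT//; apply: le_trans (CP q r) _.
  by rewrite ler_wpM2r ?(ultra_ge0 uN)// le_max lexx.
have [l [a [h [b [da [db [Aa Hh Bb ->]]]]]]] := triangular_span_ord tri s.
rewrite rmorph_sum (big_morph F FD F0) scaler_suml phi_sum; apply: eq_bigr => t _.
have [Aat _] := Aa t; have jA : Abar (j (a t)) by exact: (closure_of_mem j hv hB).
have [c [cg c_le c_gt]] := gE _ _ _ _ Aat (Hh t) (Bb t).
have xiZ i u : xi i (u *: j (a t)) = u * xi i (j (a t)).
  have A0 : Abar 0.
    by rewrite -(linear0 j); apply: (closure_of_mem j hv hB); case: A_alg => -[].
  rewrite -[_ *: _]addr0 xiL//.
  by have := xiBB i _ _ A0 A0; rewrite !subrr => ->; rewrite addr0.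
have FE : F (j (a t * h t * b t)) =
    \sum_q c q * \sum_i xi i (j (a t)) * phi ((x i * y q) *: m).
  apply: eq_bigr => q _; rewrite mulr_sumr; apply: eq_bigr => i _.
  by rewrite cg xiZ mulrA.
rewrite FE; case: (leqP (da t) k) => dk; last first.
  rewrite big1 => [|q _]; last first.
    by rewrite big1 ?mulr0// => i _; rewrite (xi0 _ _ dk (Aa t)) mul0r.
  by rewrite -mulrA -scalerA (phi0 _ _ _ dk (Aa t)).
case: (leqP (db t) n) => dn; last first.
  rewrite big1 => [|q _]; last by rewrite c_gt// mul0r.
  by rewrite -scalerA (hn _ _ dn (Bb t)) scaler0 phi00.
rewrite -mulrA c_le// mulr_sumr scaler_suml phi_sum; apply: eq_bigr => q _.
rewrite -scalerAr phiZ'; congr (_ * _).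
rewrite {2}(xiE _ _ dk (Aa t)) mulr_suml scaler_suml phi_sum; apply: eq_bigr => i _.
by rewrite -scalerAl phiZ'.
Qed.

(** The extended functionals of [orbit_functional] define by continuity a balanced map
    on [RB * M], hence an additive map on [RB \otimes M] that takes the value [phi m]
    at the image of [m]; by [truncated_functional] one may have [phi m = 1]. *)
Lemma iota_injective_gen (m : M) : iota m = 0 -> m = 0.
Proof.
move=> im0; apply: contrapT => m0.
have [k [phi [phiL phi0 phim]]] := truncated_functional m0.
have /choice[F FP] := fun m => orbit_functional m phiL phi0.
have uv := abs_ultra hv.
have dense0 (f : RB -> K) : (forall x y, f (x - y) = f x - f y) ->
    (exists C, forall x, v (f x) <= C * N x) -> (forall s, f (j s) = 0) ->
    forall r, f r = 0.
  move=> fB [C hC] fj r; apply: (ultra_small_eq0 uv) => e0 e00.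
  have C1 : 0 < Num.max C 1 by rewrite lt_max ltr01 orbT.
  have : norm_closure N (range j) r by rewrite (btri_dense btri).
  move=> /(_ _ (divr_gt0 e00 C1))[_ [s _ <-] sr].
  have -> : f r = f (r - j s) by rewrite fB fj subr0.
  apply: le_trans (hC _) _; rewrite (ultra_distC uN).
  apply: (@le_trans _ _ (Num.max C 1 * N (j s - r))).
    by rewrite ler_wpM2r ?(ultra_ge0 uN)// le_max lexx.
  by rewrite mulrC -ler_pdivlMr// ltW.
have phiD y z : phi (y + z) = phi y + phi z.
  by rewrite -[y]scale1r -[1 in LHS]scale1r phiL mul1r !scale1r.
have FB m' : forall x y, F m' (x - y) = F m' x - F m' y by have [] := FP m'.
have F0 m' : F m' 0 = 0 by have := FB m' 0 0; rewrite !subrr.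
have FDl t t' m' : F m' (t + t') = F m' t + F m' t'.
  by rewrite -{1}[t']opprK FB -[- t']sub0r FB F0 sub0r opprK.
have Fb m' : exists C, forall x, v (F m' x) <= C * N x by have [] := FP m'.
have Fj m' s : F m' (j s) = phi (s *: m') by have [] := FP m'.
have add_bounded (f g : RB -> K) : (exists C, forall x, v (f x) <= C * N x) ->
    (exists C, forall x, v (g x) <= C * N x) ->
    exists C, forall x, v (f x - g x) <= C * N x.
  move=> [C hC] [C' hC']; exists (Num.max C C') => x; apply: (ultra_suble uv).
    by apply: le_trans (hC x) _; rewrite ler_wpM2r ?(ultra_ge0 uN)// le_max lexx.
  by apply: le_trans (hC' x) _; rewrite ler_wpM2r ?(ultra_ge0 uN)// le_max lexx orbT.
have FDr t m' m'' : F (m' + m'') t = F m' t + F m'' t.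
  apply/eqP; rewrite -subr_eq0 opprD addrA; apply/eqP.
  apply: (dense0 (fun t => F (m' + m'') t - F m' t - F m'' t)) => [x y||s].
  - by rewrite !FB; ring.
  - by apply: (add_bounded) => //; exact: add_bounded.
  - by rewrite !Fj scalerDr phiD addrAC addrK subrr.
have F_bal t s m' : F m' (t * j s) = F (s *: m') t.
  apply/eqP; rewrite -subr_eq0; apply/eqP.
  apply: (dense0 (fun t => F m' (t * j s) - F (s *: m') t)) => [x y||s'].
  - by rewrite mulrBl !FB; ring.
  - apply: (add_bounded) => //; have [C hC] := Fb m'.
    have [E E0 hE] := banach_mul_bound hv hB; exists (Num.max C 0 * (E * N (j s))) => x.
    apply: le_trans (hC _) _; apply: (@le_trans _ _ (Num.max C 0 * N (x * j s))).
      by rewrite ler_wpM2r ?(ultra_ge0 uN)// le_max lexx.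
    rewrite -mulrA ler_wpM2l ?le_max ?lexx ?orbT//.
    by apply: le_trans (hE _ _) _; rewrite mulrAC.
  - by rewrite -rmorphM !Fj scalerA subrr.
have := tensor_lift_pure FDl (fun t m m' => FDr t m m') F_bal 1 m.
rewrite im0 (tensor_lift0 FDl (fun t m m' => FDr t m m') F_bal).
rewrite -(rmorph1 j) Fj scale1r phim => /esym/eqP.
by rewrite oner_eq0.
Qed.
End Generators.

Lemma extend_categoryO : categoryOhat N j A d (extend_scalars j M : LMod RB).
Proof.
have [I [e [lam [he eM]]]] := categoryO_generators tri MO.
apply/OhatP; exists I, (fun i => iota (e i)), lam; split=> [i|].
  exact: gen_eigen_iota.
exact: extend_span_over eM.
Qed.

Lemma iota_injective (m m' : M) : iota m = iota m' -> m = m'.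
Proof.
have [I [e [lam [he eM]]]] := categoryO_generators tri MO.
move=> mm'; apply/eqP; rewrite -subr_eq0; apply/eqP/(iota_injective_gen he eM).
by rewrite pureDr mm' -pureDr subrr pure0.
Qed.

(** The extension is generated by weight vectors of [M], and the components of their
    coefficients in each weight lie in [A]. *)
Lemma gen_eigen_extend nu x : gen_eigen (DB (extend_scalars j M)) nu x ->
  exists m : M, x = iota m.
Proof.
have [I [e [lam [he eM]]]] := categoryO_generators tri MO.
move=> hx; have [|a [-> _]] := gen_eigen_span hv hp K_char0 hB RB_noeth btri
    (fun i => gen_eigen_iota (he i)) _ hx; first exact: extend_span_over eM.
exists (\sum_i a i *: e i); rewrite pure_sumr.
by apply: eq_bigr => i _; rewrite iotaZ.
Qed.

Lemma categoryO_sums_gen_eigen (m : M) : sums [set m | exists nu, gen_eigen (DR M) nu m] m.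
Proof.
have [n hn] := killed m; have [s hs] := killed_above_split tri M n.
exact: split_gen_eigen (hs m hn).
Qed.
End ModuleO.

Lemma extension_faithful (M M' : lmodType R) (f g : lmod_hom M M') :
  categoryO G B (M' : LMod R) -> extend_map j f = extend_map j g -> f = g.
Proof.
move=> M'O fg; apply: lmod_homP => m; apply: (iota_injective M'O).
by rewrite -!extend_map_pure fg.
Qed.

(** A morphism preserves weight vectors, and those of the extensions are those of [M]
    and [M'], which are spanned by their weight vectors. *)
Lemma extension_full (M M' : lmodType R)
    (h : lmod_hom (extend_scalars j M) (extend_scalars j M')) :
  categoryO G B (M : LMod R) -> categoryO G B (M' : LMod R) ->
  exists f : lmod_hom M M', extend_map j f = h.
Proof.
move=> MO M'O; have /choice[f fP] m : exists m', h (iota m) = iota m'.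
  have [n [y [hy ->]]] := sums_ord (categoryO_sums_gen_eigen MO m).
  have /choice[z zP] i : exists m', h (iota (y i)) = iota m'.
    have [nu hnu] := hy i; apply: (gen_eigen_extend M'O (nu := nu)).
    by apply: (gen_eigen_map (d := d)); exact: gen_eigen_iota.
  exists (\sum_i z i); rewrite !pure_sumr linear_sum.
  by apply: eq_bigr => i _; rewrite zP.
have f_lin : linear f.
  move=> a x y; apply: (iota_injective M'O).
  by rewrite -fP !pureDr !iotaZ linearP !fP.
exists (pack_linear f_lin); apply: extend_hom_eq => m.
by rewrite extend_map_pure fP.
Qed.

(** The span [M] of the weight vectors of [X] is an object of category O. The map from
    its extension to [X] is onto, as weight vectors generate [X], and its kernel is an
    object of the completed category, hence is generated by weight vectors; these come
    from [M], on which the map is injective. *)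
Lemma extension_surjective (X : lmodType RB) : categoryOhat N j A d (X : LMod RB) ->
  exists2 M : lmodType R, categoryO G B (M : LMod R) &
  exists2 h : lmod_hom (extend_scalars j M) X, injective h & forall x, exists y, h y = x.
Proof.
move=> XO; have /OhatP[I [e [lam [he eX]]]] := XO.
pose XR := restrict_scalars j X.
pose W : set XR := sums [set x | exists nu, gen_eigen (DB X) nu x].
have hW : is_submod W.
  split=> [|x y|s x]; [exact: sums0|exact: sumsD|move=> Wx].
  have [_ _ _ s_sums _] := tri_grading tri.
  apply: (@sums_bind R XR (\bigcup_n G n) _ (fun s => s *: (x : XR))) (s_sums s) _.
  - exact: scale0r.
  - by move=> a b; exact: scalerDl.
  move=> s' [n _ Gs']; apply: (@sums_bind XR XR _ _ (fun y : XR => s' *: y)) Wx _.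
  - exact: scaler0.
  - by move=> a b; exact: scalerDr.
  move=> y [nu hy]; apply: sums1; exists (nu + n%:~R).
  apply: (gen_eigen_scale (d := d) (b := j s')) hy.
  move: Gs'; rewrite (tri_ad tri) /= => E.
  rewrite /adjoint -!rmorphM -rmorphB E. exact: (linearZ_LR j).
pose M : lmodType R := submod_type hW.
pose val (m : M) : X := submod_incl hW m.
have span := gen_eigen_span hv hp K_char0 hB RB_noeth btri he eX.
have We i : W (e i) by apply: sums1; exists (lam i).
pose eM i : M := exist W (e i) (We i).
have MO : categoryO G B (M : LMod R).
  split.
    exists #|I|, (fun i => eM (enum_val i)) => m.
    have : exists a : I -> R, val m = \sum_i j (a i) *: e i.
      have [n [y [hy mE]]] := sums_ord (svalP m).
      rewrite (mE : val m = _).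
      have /choice[a aP] t : exists a : I -> R, y t = \sum_i j (a i) *: e i.
        by have [nu hnu] := hy t; have [a [aE _]] := span nu (y t) hnu; exists a.
      exists (fun i => \sum_t a t i); under eq_bigr do rewrite aP.
      rewrite exchange_big /=; apply: eq_bigr => i _.
      by rewrite rmorph_sum scaler_suml.
    move=> [a aE]; exists (fun i => a (enum_val i)); split=> //.
    apply: submod_inj; rewrite -[sval m]/(val m) aE.
    rewrite -[RHS]/(submod_incl hW _) linear_sum.
    rewrite (reindex_onto enum_val enum_rank)/= => [|i _]; last by rewrite enum_rankK.
    by rewrite (eq_bigl predT) => [//|i]; rewrite enum_valK eqxx.
  move=> m; have [n [y [hy mE]]] := sums_ord (svalP m).
  have /choice[nu nuP] t : exists nu, gen_eigen (DB X) nu (y t) := hy t.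
  have [n0 hn0] := weight_degree_bound lam nu.
  exists n0; apply/upper_part_killed => k b nk Bb; apply: submod_inj.
  rewrite -[LHS]/(j b *: (sval m : X)) mE scaler_sumr big1// => t _.
  have adb : adjoint (j d) (j b) = (- k%:R) *: j b.
    have := B_adjoint btri Bb; rewrite /adjoint => E.
    rewrite -!rmorphM -rmorphB. rewrite E mulN1r; exact: (linearZ_LR j).
  have [a [-> a0]] := span _ _ (gen_eigen_scale adb (nuP t)).
  rewrite big1// => i _; case: (a0 i) => [->|[n' E _]]; first by rewrite linear0 scale0r.
  have E' : lam i + (n' + k)%:R = nu t by rewrite natrD addrA -E subrK.
  have := hn0 _ _ _ E'; rewrite leqNgt.
  by rewrite (leq_trans nk) ?leq_addl.
have [||h hE] := @extend_hom _ _ j M X val => //.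
exists M => //; exists h; last first.
  move=> x; have [a [_ ->]] : span_over Abar e x by rewrite eX.
  exists (\sum_i a i *: iota (eM i)); rewrite linear_sum; apply: eq_bigr => i _.
  by rewrite linearZ /= hE scale1r.
apply: ker0_inj => x hx0; have hK := ker_submod h.
have KO : categoryOhat N j A d (submod_type hK : LMod RB).
  apply: (categoryOhat_submodules hv hp K_char0 hB RB_noeth btri A_noeth
    (i := submod_incl hK)).
    exact: submod_incl_inj.
  exact: extend_categoryO.
have /OhatP[I' [e' [lam' [he' eK]]]] := KO.
have e'0 i : e' i = 0.
  have [m mE] := gen_eigen_extend MO (gen_eigen_map (submod_incl hK) (he' i)).
  apply: submod_inj; rewrite -[sval (e' i)]/(submod_incl hK (e' i)) mE.
  have : h (iota m) = 0 by rewrite -mE; exact: (svalP (e' i)).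
  rewrite hE scale1r => m0; rewrite (_ : m = 0) ?pure0//.
  exact: submod_inj.
have [y <-] := (submod_inclP hK x).1 hx0.
have [a [_ ->]] : span_over Abar e' y by rewrite eK.
by rewrite big1 ?linear0// => i _; rewrite e'0 scaler0.
Qed.

End Equivalence.

(** * The algebraic category O is abelian *)

Section CategoryO.
Variables (K : fieldType) (R : algType K) (G : int -> set R) (B : set R).
Hypothesis R_noeth : left_noetherian R.

Lemma categoryO_submodules : closed_under_submodules (categoryO G B).
Proof.
move=> M M' i i_inj [[r [g gM]] nil]; split; last first.
  move=> m; have [n hn] := nil (i m); exists n => b /hn bm; apply: i_inj.
  by rewrite linearZ linear0.
have R_ring : is_subring (setT : set R) by [].
have [W0 WD WZ] := im_submod i.
have [||r' [u [Wu uW]]] := noetherian_fin_gen_submod R_ring (g := g)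
    (U := [set x | exists y, i y = x]) R_noeth.
- by split=> // [x y Wx Wy|a x _]; [exact: submodB (And3 W0 WD WZ) Wx Wy|exact: WZ].
- by move=> x _; exact: gM.
have /choice[w wu] k := Wu k.
exists r', w => x; have [|a [_ xE]] := uW (i x); first by exists x.
exists a; split=> //; apply: i_inj; rewrite xE linear_sum.
by apply: eq_bigr => k _; rewrite linearZ /= wu.
Qed.

Lemma categoryO_quotients : closed_under_quotients (categoryO G B).
Proof.
move=> M M' q q_surj [[r [g gM]] nil]; split=> [|y]; last first.
  have [m <-] := q_surj y; have [n hn] := nil m.
  by exists n => b /hn bm; rewrite -[LHS](linearZ_LR q) bm linear0.
exists r, (fun k => q (g k)) => y; have [x <-] := q_surj y.
have [a [_ ->]] := gM x; exists a; split=> //.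
by rewrite linear_sum; apply: eq_bigr => k _; rewrite linearZ.
Qed.

Lemma categoryO_sums : closed_under_sums (categoryO G B).
Proof.
move=> n M S i i_surj hM; split=> [|x].
  have h k : {g : {r & 'I_r -> M k} | forall x, exists a, x = \sum_l a l *: projT2 g l}.
    apply: cid; have [[r [g gM]] _] := hM k; exists (existT _ r g) => x.
    by have [a [_ xE]] := gM x; exists a.
  pose g k := sval (h k); pose gP k := svalP (h k).
  pose I := {k : 'I_n & 'I_(projT1 (g k))}.
  pose e (z : I) := i (tag z) (projT2 (g (tag z)) (tagged z)).
  apply: (@fin_gen_of_span K R setT S I e); apply/seteqP; split=> // x _.
  have R_ring : is_subring (setT : set R) by [].
  have hS := span_over_submod R_ring e; have [_ _ hZ] := hS.
  have [y ->] := i_surj x; apply: (submod_over_sum _ hS) => k _.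
  have [a ->] := gP k (y k); rewrite linear_sum; apply: (submod_over_sum _ hS) => l _.
  rewrite linearZ; apply: hZ => //.
  exact: (mem_span_over R_ring e (Tagged (fun k => 'I_(projT1 (g k))) l)).
have [y ->] := i_surj x.
have /choice[m mP] k : exists m, killed_above G B m (y k).
  by have [_ /(_ (y k))[m h]] := hM k; exists m; apply/upper_part_killed.
exists (\max_k m k); apply/upper_part_killed => l b nl Bb; rewrite scaler_sumr big1// => k _.
rewrite -(linearZ_LR (i k)) (mP k l) ?linear0//.
by apply: leq_ltn_trans nl; exact: (leq_bigmax k).
Qed.
End CategoryO.

Theorem theorem1 (Rl : realType) (p : nat) (K : fieldType) (v : K -> Rl)
    (RB : algType K) (N : RB -> Rl) (R : algType K) (j : {lrmorphism R -> RB})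
    (G : int -> set R) (A B H : set R) (d : R)
    (p_prime : prime p)
    (K_ext : complete_dv_extension_of_Qp p v)
    (RB_banach : banach_algebra v N)
    (RB_noetherian : two_sided_noetherian RB)
    (RB_triangular : banach_triangular_decomposition v N j G A B H d)
    (A_noetherian : left_noetherian_over (norm_closure N (j @` A)))
    (B_noetherian : left_noetherian_over (norm_closure N (j @` B))) :
  [/\ full_abelian_subcategory
        (@categoryOhat_fin_gen Rl K RB N R j A d),
      closed_under_submodules (categoryOhat N j A d) /\
        closed_under_direct_sums (categoryOhat N j A d) &
      exists extO : forall M, categoryO G B M ->
          categoryOhat N j A d (extension_of_scalars j M),
        abelian_equivalence (sub_functor extO)].
Proof.
have [hp K_char0] := padic_scalars p_prime K_ext.
have hv := cdv_abs K_ext; have v_complete := cdv_complete K_ext.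
have [RB_noeth _] := RB_noetherian.
have A_noeth : left_noetherian_over (closure_of N j A) := A_noetherian.
have subs := categoryOhat_submodules hv hp K_char0 RB_banach RB_noeth RB_triangular A_noeth.
have quots := categoryOhat_quotients hv hp K_char0 RB_banach RB_noeth RB_triangular A_noeth.
have sums : closed_under_sums (categoryOhat N j A d).
  move=> n M S i; exact: (categoryOhat_sums hv hp K_char0 RB_banach RB_noeth RB_triangular A_noeth).
have Ohat_abelian := full_sub_abelian subs quots sums.
have tri := btri_alg RB_triangular.
split.
- by split=> //; exact: full_sub_inclusion_exact.
- by split=> //; exact: direct_sums_of_sums.
exists (extend_categoryO hv v_complete hp K_char0 RB_banach RB_noeth RB_triangular A_noeth).
have O_abelian : is_abelian (full_sub (categoryO G B)).
  have R_noeth := tri_noetherian tri.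
  exact: full_sub_abelian (categoryO_submodules R_noeth) (@categoryO_quotients _ _ _ _)
    (@categoryO_sums _ _ _ _).
set F := sub_functor _.
have F_full (X Y : full_sub (categoryO G B)) (h : hom (F X) (F Y)) :
    exists f, fmap F f = h.
  have [f fE] := extension_full hv v_complete hp K_char0 RB_banach RB_noeth RB_triangular
    h (svalP X) (svalP Y).
  by exists f; exact: fE.
have F_faithful (X Y : full_sub (categoryO G B)) (f g : hom X Y) :
    fmap F f = fmap F g -> f = g.
  move=> fg; exact: (extension_faithful hv v_complete hp K_char0 RB_banach RB_noeth
    RB_triangular (svalP Y) fg).
have F_surj (Y : full_sub (categoryOhat N j A d)) :
    exists (X : full_sub (categoryO G B)) (e : hom (F X) Y), is_iso e.
  have [M MO [h h_inj h_surj]] := extension_surjective hv v_complete hp K_char0 RB_banach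
    RB_noeth RB_triangular A_noeth (svalP Y).
  exists (exist _ (M : LMod R) MO), h.
  have [u hu] := linear_lift h_inj (h := hom_id _) h_surj.
  exists u; split=> //; apply: lmod_homP => x; apply: h_inj.
  by have /(congr1 (fun g : lmod_hom _ _ => g (h x))) := hu.
split=> //; last exact: fully_faithful_equivalence.
apply: fully_faithful_exact => // X Y f g.
exact: extension_additive.
Qed.
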